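(* Let $n\ge0$, $m,r\ge1$, $\varkappa\ge1$ be integers, $p\in[1,\infty)$, $1/p+1/q=1$, $[a,b]\subset\mathbb{R}$ a compact interval, $\varepsilon_0>0$, and let $t_1,\dots,t_\varkappa\in[a,b]$ be distinct points. Consider the limiting multipoint problem $$Ly(t)\equiv y^{(r)}(t)+\sum_{j=1}^{r}A_{r-j}(t)y^{(r-j)}(t)=f(t),\quad a\le t\le b,\qquad By\equiv\sum_{l=0}^{n+r-1}\sum_{i=1}^{\varkappa}\alpha_i^{(l)}y^{(l)}(t_i)=c,$$ with unknown $y\in(W^{n+r}_p)^m$, where $A_{r-j}\in(W^n_p)^{m\times m}$, $f\in(W^n_p)^m$, $\alpha_i^{(l)}\in\mathbb{C}^{rm\times m}$, $c\in\mathbb{C}^{rm}$, and, for $\varepsilon\in(0,\varepsilon_0)$, the multipoint problem $$L(\varepsilon)y(t,\varepsilon)\equiv y^{(r)}(t,\varepsilon)+\sum_{j=1}^{r}A_{r-j}(t,\varepsilon)y^{(r-j)}(t,\varepsilon)=f(t,\varepsilon),\quad a\le t\le b,$$ $$B(\varepsilon)y(\cdot,\varepsilon)\equiv\sum_{l=0}^{n+r-1}\sum_{i=0}^{\varkappa}\sum_{j=1}^{k_i}\alpha_{i,j}^{(l)}(\varepsilon)\,y^{(l)}(t_{i,j}(\varepsilon),\varepsilon)=c(\varepsilon),$$ with unknown $y(\cdot,\varepsilon)\in(W^{n+r}_p)^m$, where $A_{r-j}(\cdot,\varepsilon)\in(W^n_p)^{m\times m}$, $f(\cdot,\varepsilon)\in(W^n_p)^m$,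 $\alpha_{i,j}^{(l)}(\varepsilon)\in\mathbb{C}^{rm\times m}$, $t_{i,j}(\varepsilon)\in[a,b]$, $c(\varepsilon)\in\mathbb{C}^{rm}$, and the positive integers $k_0,k_1,\dots,k_\varkappa$ do not depend on $\varepsilon$. Suppose that $A_{r-j}(\cdot,\varepsilon)\to A_{r-j}$ in $(W^n_p)^{m\times m}$ as $\varepsilon\to0+$ for each $j\in\{1,\dots,r\}$, and that the following conditions hold as $\varepsilon\to0+$: (d1) $t_{i,j}(\varepsilon)\to t_i$ for all $i\in\{1,\dots,\varkappa\}$ and $j\in\{1,\dots,k_i\}$; (d2) $\sum_{j=1}^{k_i}\alpha_{i,j}^{(l)}(\varepsilon)\to\alpha_i^{(l)}$ for all $i\in\{1,\dots,\varkappa\}$ and $l\in\{0,\dots,n+r-1\}$; (d3) $\|\alpha_{i,j}^{(n+r-1)}(\varepsilon)\|\cdot|t_{i,j}(\varepsilon)-t_i|^{1/q}=O(1)$ for all $i\in\{1,\dots,\varkappa\}$ and $j\in\{1,\dots,k_i\}$; (d4) $\|\alpha_{i,j}^{(l)}(\varepsilon)\|\cdot|t_{i,j}(\varepsilon)-t_i|\to0$ for all $i\in\{1,\dots,\varkappa\}$, $j\in\{1,\dots,k_i\}$, and $l\in\mathbb{Z}$ with $0\le l\le n+r-2$; (d5) $\alpha_{0,j}^{(l)}(\varepsilon)\to0$ for all $j\in\{1,\dots,k_0\}$ and $l\in\{0,\dots,n+r-1\}$. Suppose also that the limiting problem with $f\equiv0$ and $c=0$ has only the trivial solution in $(W^{n+r}_p)^m$.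 Then the solution to the $\varepsilon$-dependent multipoint problem depends continuously on the parameter $\varepsilon$ at $\varepsilon=0$ (where the problem for $\varepsilon=0$ is the limiting problem).
   Context: $W^n_p=W^n_p([a,b],\mathbb{C})$ is the complex Sobolev space with norm $\|x\|_{n,p}=\bigl(\sum_{j=0}^{n}\int_a^b|x^{(j)}(t)|^p\,dt\bigr)^{1/p}$; $W^0_p=L_p([a,b],\mathbb{C})$. $(W^n_p)^m$ and $(W^n_p)^{m\times m}$ are the spaces of $\mathbb{C}^m$-valued, respectively $\mathbb{C}^{m\times m}$-valued, functions on $[a,b]$ with all components in $W^n_p$; their norms are the sums of the norms in $W^n_p$ of all components. The norm $\|\cdot\|$ of a number matrix is the sum of the absolute values of its entries. Vectors are columns. Since $W^{n+r}_p$ embeds continuously in $C^{n+r-1}([a,b])$, the boundary conditions are well posed and $B$, $B(\varepsilon)$ are continuous linear operators $(W^{n+r}_p)^m\to\mathbb{C}^{rm}$. The differential equations are understood at every $t\in[a,b]$ if $n\ge1$, and almost everywhere on $[a,b]$ if $n=0$. If $p=1$, then $1/q=0$ and (d3) means $\|\alpha_{i,j}^{(n+r-1)}(\varepsilon)\|=O(1)$. No convergence of the points $t_{0,j}(\varepsilon)$ and no regularity in $\varepsilon$ beyond the stated conditions is assumed. Conventions at $\varepsilon=0$: $L(0):=L$, $B(0):=B$, $f(\cdot,0):=f$, $c(0):=c$, $y(\cdot,0):=y$. Definition. The solution to the problem $L(\varepsilon)y(\cdot,\varepsilon)=f(\cdot,\varepsilon)$, $B(\varepsilon)y(\cdot,\varepsilon)=c(\varepsilon)$,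 $\varepsilon\in[0,\varepsilon_0)$, is said to depend continuously on the parameter $\varepsilon$ at $\varepsilon=0$ if the following two conditions hold: $(\ast)$ there exists a positive number $\varepsilon_1<\varepsilon_0$ such that for arbitrary $\varepsilon\in[0,\varepsilon_1)$, $f(\cdot,\varepsilon)\in(W^n_p)^m$ and $c(\varepsilon)\in\mathbb{C}^{rm}$ the problem has a unique solution $y(\cdot,\varepsilon)\in(W^{n+r}_p)^m$; $(\ast\ast)$ the convergence of the right-hand sides $f(\cdot,\varepsilon)\to f(\cdot,0)$ in $(W^n_p)^m$ and $c(\varepsilon)\to c(0)$ in $\mathbb{C}^{rm}$ as $\varepsilon\to0+$ implies the convergence of the solutions $y(\cdot,\varepsilon)\to y(\cdot,0)$ in $(W^{n+r}_p)^m$ as $\varepsilon\to0+$ (for all families of right-hand sides). *)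

(* Defs.v *)
From mathcomp Require Import all_boot all_order all_algebra.
From mathcomp Require Import all_classical all_reals all_analysis.
From mathcomp Require Export complex.

Set Implicit Arguments.
Unset Strict Implicit.
Unset Printing Implicit Defensive.

Import Order.TTheory GRing.Theory Num.Theory.
Import numFieldNormedType.Exports.
Import ComplexField.Normc.

Local Open Scope classical_set_scope.
Local Open Scope ring_scope.
Local Open Scope complex_scope.

(* A function on [a, b] is represented by a total function on R; every notion
   below depends only on its values on [a, b]. *)

(* The limit is taken inside [a, b], hence one-sided at a and b. *)
Definition diff_quotient (R : realType) (a b t : R) (g : R -> R) :
    set_system R :=
  ((g s - g t) / (s - t) @[s --> within `[a, b] t^']).

Definition has_cderiv (R : realType) (a b : R) (x : R -> R[i]) (t : R)
    (z : R[i]) : Prop :=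
  (diff_quotient a b t (fun s => complex.Re (x s)) --> complex.Re z) /\
  (diff_quotient a b t (fun s => complex.Im (x s)) --> complex.Im z).

(* The total operator has an arbitrary value at points where the limit does
   not exist. *)
Definition cderiv (R : realType) (a b : R) (x : R -> R[i]) (t : R) : R[i] :=
  lim (diff_quotient a b t (fun s => complex.Re (x s))) +i*
  lim (diff_quotient a b t (fun s => complex.Im (x s))).

Definition cderivn (R : realType) (a b : R) (k : nat) (x : R -> R[i]) :
    R -> R[i] :=
  iter k (cderiv a b) x.

Definition abs_cont (R : realType) (a b : R) (x : R -> R[i]) : Prop :=
  forall e : R, 0 < e -> exists2 d : R, 0 < d &
    forall (N : nat) (u v : nat -> R),
      (forall i, (i < N)%N -> [/\ a <= u i, u i <= v i & v i <= b]) ->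
      (forall i, (i.+1 < N)%N -> v i <= u i.+1) ->
      \sum_(i < N) (v i - u i) < d ->
      \sum_(i < N) normc (x (v i) - x (u i)) < e.

(* Borel representatives of the classes in L_p([a, b], C). *)
Definition Lp_borel (R : realType) (p a b : R) (g : R -> R[i]) : Prop :=
  [/\ measurable_fun `[a, b] (fun t => complex.Re (g t)),
      measurable_fun `[a, b] (fun t => complex.Im (g t)) &
      (\int[@lebesgue_measure R]_(t in `[a, b])
          (normc (g t) `^ p)%:E < +oo)%E].

(* W^0_p = L_p; for n = k + 1, x is in W^n_p when x is in C^k, x^(k) is
   absolutely continuous (hence continuous), and its derivative, which exists
   almost everywhere, is in L_p. *)
Definition sobolev (R : realType) (n : nat) (p a b : R) (x : R -> R[i]) :
    Prop :=
  match n with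
  | 0 => exists2 g, Lp_borel p a b g &
      {ae @lebesgue_measure R, forall t, t \in `[a, b] -> x t = g t}
  | k.+1 =>
      [/\ forall j, (j < k)%N -> forall t, t \in `[a, b] ->
            exists z, has_cderiv a b (cderivn a b j x) t z,
          abs_cont a b (cderivn a b k x) &
          exists2 g, Lp_borel p a b g &
            {ae @lebesgue_measure R, forall t, t \in `[a, b] ->
               has_cderiv a b (cderivn a b k x) t (g t)}]
  end.

Definition sobolev_norm (R : realType) (n : nat) (p a b : R)
    (x : R -> R[i]) : \bar R :=
  ((\sum_(0 <= j < n.+1)
      \int[@lebesgue_measure R]_(t in `[a, b])
         (normc (cderivn a b j x t) `^ p)%:E) `^ p^-1)%E.

(* Matrix-valued versions; vectors are the case of one column. *)

Definition sobolev_mx (R : realType) (n : nat) (p a b : R) (m k : nat)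
    (X : R -> 'M[R[i]]_(m, k)) : Prop :=
  forall i j, sobolev n p a b (fun t => X t i j).

Definition sobolev_norm_mx (R : realType) (n : nat) (p a b : R) (m k : nat)
    (X : R -> 'M[R[i]]_(m, k)) : \bar R :=
  (\sum_(i < m) \sum_(j < k) sobolev_norm n p a b (fun t => X t i j))%E.

Definition cderivn_mx (R : realType) (a b : R) (l m k : nat)
    (X : R -> 'M[R[i]]_(m, k)) (t : R) : 'M[R[i]]_(m, k) :=
  \matrix_(i, j) cderivn a b l (fun s => X s i j) t.

Definition mxnorm1 (R : realType) (m k : nat) (M : 'M[R[i]]_(m, k)) : R :=
  \sum_(i < m) \sum_(j < k) normc (M i j).

(* Convergence as the parameter tends to 0 from the right. *)

Definition cvg_sobolev (R : realType) (n : nat) (p a b : R) (m k : nat)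
    (X : R -> R -> 'M[R[i]]_(m, k)) (X0 : R -> 'M[R[i]]_(m, k)) : Prop :=
  (sobolev_norm_mx n p a b (fun t => X eps t - X0 t) @[eps --> 0^'+]
     --> 0%E).

Definition cvg_mx (R : realType) (m k : nat)
    (M : R -> 'M[R[i]]_(m, k)) (M0 : 'M[R[i]]_(m, k)) : Prop :=
  (mxnorm1 (M eps - M0) @[eps --> 0^'+] --> (0 : R)).

(* Coefficients are indexed by the order of the derivative they multiply. *)
Definition diff_op (R : realType) (a b : R) (r m : nat)
    (A : nat -> R -> 'M[R[i]]_m) (y : R -> 'cV[R[i]]_m) (t : R) :
    'cV[R[i]]_m :=
  cderivn_mx a b r y t +
  \sum_(1 <= j < r.+1) A (r - j)%N t *m cderivn_mx a b (r - j) y t.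

Definition multipoint_op (R : realType) (a b : R) (n r m kappa : nat)
    (alpha : nat -> nat -> 'M[R[i]]_(r * m, m)) (tau : nat -> R)
    (y : R -> 'cV[R[i]]_m) : 'cV[R[i]]_(r * m) :=
  \sum_(0 <= l < n + r) \sum_(1 <= i < kappa.+1)
    alpha l i *m cderivn_mx a b l y (tau i).

Definition multipoint_op_eps (R : realType) (a b : R) (n r m kappa : nat)
    (k : nat -> nat) (alpha : nat -> nat -> nat -> 'M[R[i]]_(r * m, m))
    (tau : nat -> nat -> R) (y : R -> 'cV[R[i]]_m) : 'cV[R[i]]_(r * m) :=
  \sum_(0 <= l < n + r) \sum_(0 <= i < kappa.+1) \sum_(1 <= j < (k i).+1)
    alpha l i j *m cderivn_mx a b l y (tau i j).

(* Both sides lie in W^n_p: for n = 0 equality is almost everywhere. *)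
Definition eq_sobolev (R : realType) (n : nat) (a b : R) (m : nat)
    (u v : R -> 'cV[R[i]]_m) : Prop :=
  if n is 0 then
    {ae @lebesgue_measure R, forall t, t \in `[a, b] -> u t = v t}
  else forall t, t \in `[a, b] -> u t = v t.

Definition is_solution (R : realType) (n r : nat) (p a b : R) (m d : nat)
    (L : (R -> 'cV[R[i]]_m) -> R -> 'cV[R[i]]_m)
    (B : (R -> 'cV[R[i]]_m) -> 'cV[R[i]]_d)
    (f : R -> 'cV[R[i]]_m) (c : 'cV[R[i]]_d) (y : R -> 'cV[R[i]]_m) : Prop :=
  [/\ sobolev_mx (n + r) p a b y, eq_sobolev n a b (L y) f & B y = c].

Definition depends_continuously_at0 (R : realType) (n r : nat) (p a b : R)
    (m d : nat) (eps0 : R)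
    (L : R -> (R -> 'cV[R[i]]_m) -> R -> 'cV[R[i]]_m)
    (B : R -> (R -> 'cV[R[i]]_m) -> 'cV[R[i]]_d) : Prop :=
  exists eps1 : R, [/\ 0 < eps1 < eps0,
    forall eps, 0 <= eps < eps1 ->
      forall (f : R -> 'cV[R[i]]_m) (c : 'cV[R[i]]_d),
        sobolev_mx n p a b f ->
        exists2 y, is_solution n r p a b (L eps) (B eps) f c y &
          forall z, is_solution n r p a b (L eps) (B eps) f c z ->
            forall t, t \in `[a, b] -> z t = y t &
    forall (f : R -> R -> 'cV[R[i]]_m) (c : R -> 'cV[R[i]]_d)
        (y : R -> R -> 'cV[R[i]]_m),
      (forall eps, 0 <= eps < eps1 -> sobolev_mx n p a b (f eps)) ->
      (forall eps, 0 <= eps < eps1 ->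
         is_solution n r p a b (L eps) (B eps) (f eps) (c eps) (y eps)) ->
      cvg_sobolev n p a b f (f 0) ->
      cvg_mx c (c 0) ->
      cvg_sobolev (n + r) p a b y (y 0)].

(* Main.v *)
Require Import Defs.
From mathcomp Require Import all_boot all_order all_algebra.
From mathcomp Require Import all_classical all_reals all_analysis.
From mathcomp Require Import measurable_realfun ring lra.

Import Order.TTheory GRing.Theory Num.Theory.
Import numFieldNormedType.Exports.
Import ComplexField.Normc.

Local Open Scope classical_set_scope.
Local Open Scope ring_scope.
Local Open Scope complex_scope.

Set Implicit Arguments.
Unset Strict Implicit.
Unset Printing Implicit Defensive.

(* Everything rests on one estimate, uniform for small eps: if z solves the
   perturbed system with right-hand side h, then the norm of z in W^(n+r)_p is
   at most a constant times the sum of the norms of h and B(eps) z. Applied to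
   the difference of the perturbed and the limiting solution it gives the
   convergence, and applied to the homogeneous problem it gives uniqueness,
   whence existence because the problem is of Fredholm index zero.

   For the Cauchy problem the estimate comes from the linear Volterra system
   satisfied by (y, ..., y^(r-1)), whose integral operator is a contraction in
   an exponentially weighted sup norm; regularity is then read off the
   equation. It remains to control the initial data by B(eps) z. On the
   solutions of the limiting homogeneous system, parametrized by their initial
   data, B is an invertible matrix, and B(eps) is a small perturbation of it,
   because B(eps) is bounded uniformly in eps and converges to B strongly.
   Both facts come from (d1)-(d5): the increments of y^(n+r-1) over an interval
   of length s are O(s^(1/q)) uniformly on bounded sets of W^(n+r)_p, and
   o(s^(1/q)) for each fixed y, which matches (d3); the derivatives of lower
   order are Lipschitz continuous, which matches (d4). *)

(** Two obstacles shape the proof. The derivatives in [sobolev_norm] are limits that may exist only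
    almost everywhere, and the norm may be infinite. Norms are therefore replaced by the predicate
    [sob n M x], which carries membership and bound together; constants need only be uniform, never
    sharp. Secondly, B(eps) need not converge to B in operator norm: for p = 1 the evaluations of
    the derivative of order n+r-1 at two distinct points stay a fixed distance apart, however close
    the points are. Convergence holds only on fixed functions. Hence B(eps) and B are compared on
    finitely many of them, a fundamental system of the limiting equation; for the remainder, whose
    norm is estimated by the change of coefficients and the right-hand side, the uniform bound of
    B(eps) is enough. The case p = 1 needs no separate treatment: 1 - 1/p vanishes, the Hoelder
    estimate of increments becomes boundedness, and its little-o form becomes absolute continuity of
    the integral. The equation is used in integral form, which reads the same for n = 0 and n >
    0. *)

Section complex_modulus.
Context {R : realType}.
Implicit Types x y z : R[i].

Lemma normc_ge0 x : 0 <= normc x.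
Proof. by case: x => u v /=; rewrite sqrtr_ge0. Qed.

Lemma Re_add x y : complex.Re (x + y) = complex.Re x + complex.Re y.
Proof. by case: x y => [? ?] [? ?]. Qed.

Lemma Im_add x y : complex.Im (x + y) = complex.Im x + complex.Im y.
Proof. by case: x y => [? ?] [? ?]. Qed.

Lemma Re_opp x : complex.Re (- x) = - complex.Re x.
Proof. by case: x. Qed.

Lemma Im_opp x : complex.Im (- x) = - complex.Im x.
Proof. by case: x. Qed.

Lemma Re_mul x y : complex.Re (x * y) =
  complex.Re x * complex.Re y - complex.Im x * complex.Im y.
Proof. by case: x y => [? ?] [? ?]. Qed.

Lemma Im_mul x y : complex.Im (x * y) =
  complex.Re x * complex.Im y + complex.Im x * complex.Re y.
Proof. by case: x y => [? ?] [? ?]. Qed.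

Lemma normc_Re x : `|complex.Re x| <= normc x.
Proof.
by case: x => u v /=; rewrite -sqrtr_sqr ler_wsqrtr// lerDl sqr_ge0.
Qed.

Lemma normc_Im x : `|complex.Im x| <= normc x.
Proof.
by case: x => u v /=; rewrite -sqrtr_sqr ler_wsqrtr// lerDr sqr_ge0.
Qed.

Lemma le_normc_ReIm x : normc x <= `|complex.Re x| + `|complex.Im x|.
Proof.
case: x => u v /=; rewrite -[leRHS]ger0_norm ?addr_ge0// -sqrtr_sqr.
rewrite ler_wsqrtr// sqrrD !real_normK ?num_real//.
by rewrite -addrA lerD2l lerDr mulrn_wge0// mulr_ge0.
Qed.

Lemma normcB x y : normc (x - y) = normc (y - x).
Proof. by rewrite -normcN opprB. Qed.

Lemma le_normcDl x y z : normc (x - z) <= normc (x - y) + normc (y - z).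
Proof. by rewrite -[x - z](subrKA y) le_normcD. Qed.

Lemma normc_sum (I : Type) (s : seq I) (P : pred I) (F : I -> R[i]) :
  normc (\sum_(i <- s | P i) F i) <= \sum_(i <- s | P i) normc (F i).
Proof.
elim/big_rec2 : _ => [|i u v _ uv]; first by rewrite normc0.
by rewrite (le_trans (le_normcD _ _))// lerD2l.
Qed.

Lemma normc_eq0 x : (normc x == 0) = (x == 0).
Proof.
by apply/eqP/eqP => [/eq0_normc//|->]; rewrite normc0.
Qed.

Lemma complex_eqP x y : complex.Re x = complex.Re y ->
  complex.Im x = complex.Im y -> x = y.
Proof. by case: x y => [? ?] [? ?] /= -> ->. Qed.

End complex_modulus.

(** * Integrals of functions that agree almost everywhere *)

Section integral_almost_everywhere.
Context d {T : measurableType d} {R : realType}.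
Variable mu : {measure set T -> \bar R}.
Import HBNNSimple.

(* No measurability is required: the integral of a nonnegative function is a
   supremum of integrals of simple functions, which may be cut off on N. *)
Lemma ge0_le_integral_off_null (D N : set T) (f g : T -> \bar R) :
  measurable N -> mu N = 0%E ->
  (forall x, D x -> (0 <= f x)%E) -> (forall x, D x -> (0 <= g x)%E) ->
  (forall x, D x -> ~ N x -> (f x <= g x)%E) ->
  (\int[mu]_(x in D) f x <= \int[mu]_(x in D) g x)%E.
Proof.
move=> mN N0 f0 g0 fg.
rewrite (ge0_integralE mu f0) (ge0_integralE mu g0).
apply: ge_ereal_sup => _ [h /= hf <-].
apply: ereal_sup_ubound => /=; exists (proj_nnsfun h (measurableC mN)).
  move=> x /=; rewrite mindicE; have [|] := boolP (x \in ~` N).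
    rewrite inE/= => Nx; rewrite mulr1 (le_trans (hf x))//.
    by rewrite !patchE; case: ifPn => //; rewrite inE => Dx; exact: fg.
  by rewrite mulr0 patchE; case: ifPn => //; rewrite inE => Dx _; exact: g0.
rewrite -!integralT_nnsfun; apply: ge0_ae_eq_integral => //.
- by apply/measurable_EFinP; exact: measurable_funP.
- by apply/measurable_EFinP; exact: measurable_funP.
- by move=> x _; rewrite lee_fin.
- by move=> x _; rewrite lee_fin.
- exists N; split => // x /= /not_implyP[_]; apply: contra_notP => Nx.
  by rewrite mindicE mem_set// mulr1.
Qed.

(** The measure lives on Borel sets, so a function that agrees with a Borel one off a null set may
    fail to be measurable; the cut-off argument applies all the same, once in each direction. *)
Lemma ge0_ae_eq_integral_any (D : set T) (f g : T -> \bar R) :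
  (forall x, D x -> (0 <= f x)%E) -> (forall x, D x -> (0 <= g x)%E) ->
  {ae mu, forall x, D x -> f x = g x} ->
  (\int[mu]_(x in D) f x = \int[mu]_(x in D) g x)%E.
Proof.
move=> f0 g0 [N [mN N0 fgN]].
have fg x : D x -> ~ N x -> f x = g x.
  by move=> Dx; apply: contra_notP => fgx; apply: fgN => /= /(_ Dx).
apply/eqP; rewrite eq_le; apply/andP; split;
  apply: (ge0_le_integral_off_null mN N0) => // x Dx Nx; by rewrite fg.
Qed.

Lemma ae_eq_integral_any (D : set T) (f g : T -> \bar R) :
  {ae mu, forall x, D x -> f x = g x} ->
  (\int[mu]_(x in D) f x = \int[mu]_(x in D) g x)%E.
Proof.
move=> fg; rewrite integralE [in RHS]integralE; congr (_ - _)%E.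
  apply: ge0_ae_eq_integral_any => //; apply: filterS fg => x fg Dx.
  by rewrite !funeposE fg.
apply: ge0_ae_eq_integral_any => //; apply: filterS fg => x fg Dx.
by rewrite !funenegE fg.
Qed.

Lemma ae_eq_Rintegral (D : set T) (f g : T -> R) :
  {ae mu, forall x, D x -> f x = g x} ->
  \int[mu]_(x in D) f x = \int[mu]_(x in D) g x.
Proof.
move=> fg; congr fine; apply: ae_eq_integral_any; apply: filterS fg => x fg Dx.
by rewrite fg.
Qed.

End integral_almost_everywhere.

(** * Compact intervals *)

Section cousin.
Context {R : realType}.
Implicit Types a b t u v w : R.

(* Compactness of [a, b] as a local-to-global principle for additive
   properties of intervals. *)
Lemma cousin (P : R -> R -> Prop) a b : a <= b ->
  (forall u v w, a <= u -> u <= v -> v <= w -> w <= b ->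
     P u v -> P v w -> P u w) ->
  (forall t, a <= t <= b -> exists2 d : R, 0 < d &
     forall u v, a <= u -> u <= t -> t <= v -> v <= b ->
       t - d < u -> v < t + d -> P u v) ->
  P a b.
Proof.
move=> ab Padd Ploc.
pose S := [set s | a <= s <= b /\ P a s].
have Sa : S a.
  split; first by rewrite lexx.
  have [|d d0 Pd] := Ploc a; first by rewrite lexx.
  by apply: Pd; rewrite // ?gtrDl ?oppr_lt0// ltrDl.
have Sb : ubound S b by move=> s [/andP[]].
have supS : has_sup S by split; [exists a|exists b].
have as_ : a <= sup S by exact: ub_le_sup supS.2 _ Sa.
have sb : sup S <= b by apply: ge_sup => //; exists a.
have [|d d0 Pd] := Ploc (sup S); first by rewrite as_.
have [x Sx sx] := sup_adherent d0 supS.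
have xs : x <= sup S by exact: ub_le_sup supS.2 _ Sx.
case: Sx => /andP[ax xb] Pax.
have Pas v : sup S <= v -> v <= b -> v < sup S + d -> P a v.
  move=> sv vb vd; apply: (Padd a x v) => //; first exact: le_trans sv.
  exact: Pd.
have [bs|sbd] := ltP b (sup S + d); first exact: Pas.
have Ss : S (sup S + d / 2).
  split; first by apply/andP; split; lra.
  by apply: Pas; lra.
by have := ub_le_sup supS.2 Ss; lra.
Qed.

End cousin.

(** * Difference quotients relative to the interval *)

Section derivative_within.
Context {R : realType}.
Implicit Types a b t l : R.

(** Multiplying out the quotient admits [s = t], so the estimate can be used at both ends of any
    short interval containing [t]. *)
Lemma diff_quotientP a b t l (h : R -> R) :
  (diff_quotient a b t h --> l) <->
  (forall e : R, 0 < e -> exists2 d : R, 0 < d & forall s, a <= s <= b ->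
     `|s - t| < d -> `|h s - h t - l * (s - t)| <= e * `|s - t|).
Proof.
rewrite /diff_quotient; split=> [/cvgrPdist_le H e e0|H].
  have [d /= d0 Hd] := H _ e0.
  exists d => // s sab st; have [->|nst] := eqVneq s t.
    by rewrite !subrr mulr0 subrr normr0 mulr0.
  have := Hd s; rewrite /ball/= distrC => /(_ st nst); rewrite in_itv/= => /(_ sab).
  have st0 : 0 < `|s - t| by rewrite normr_gt0 subr_eq0.
  rewrite -(ler_pM2r st0) -normrM mulrBl divfK ?subr_eq0//.
  by rewrite distrC.
apply/cvgrPdist_le => e e0; have [d d0 Hd] := H _ e0.
exists d => //= s.
rewrite /ball/= distrC => st nst; rewrite in_itv/= => sab.
have st0 : 0 < `|s - t| by rewrite normr_gt0 subr_eq0.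
rewrite -(ler_pM2r st0) -normrM mulrBl divfK ?subr_eq0//.
by rewrite distrC Hd.
Qed.

(** Guarantees that [lim] in [cderiv] returns the limit whenever there is one. For [a < b] no point
    of the interval is isolated: a point near [t] is found on the right, or on the left when
    [t = b]. *)
Lemma diff_quotient_proper a b t : a < b -> a <= t <= b ->
  ProperFilter (within `[a, b] t^').
Proof.
move=> ab /andP[at_ tb]; split=> [[d /= d0 Hd]|]; last exact: within_filter.
have [tb'|bt] := ltP t b.
  pose s := Num.min b (t + d / 2).
  have ts : t < s by rewrite lt_min tb'/=; lra.
  have sd : s <= t + d / 2 by rewrite ge_min lexx orbT.
  apply: (Hd s) => /=; last 2 first.
  - by rewrite gt_eqF.
  - by rewrite in_itv/= ge_min lexx/= andbT (le_trans at_)// ltW.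
  by rewrite distrC ger0_norm; lra.
have tE : t = b by apply/eqP; rewrite eq_le tb bt.
pose s := Num.max a (t - d / 2).
have ts : s < t by rewrite gt_max; apply/andP; split; lra.
have sd : t - d / 2 <= s by rewrite le_max lexx orbT.
apply: (Hd s) => /=; last 2 first.
- by rewrite lt_eqF.
- by rewrite in_itv/= le_max lexx/= (le_trans (ltW ts)).
by rewrite ger0_norm; lra.
Qed.

Lemma diff_quotient_lim a b t l (h : R -> R) : a < b -> a <= t <= b ->
  (diff_quotient a b t h --> l) -> lim (diff_quotient a b t h) = l.
Proof.
move=> ab tab; have := diff_quotient_proper ab tab => FF.
by apply: cvg_lim; exact: norm_hausdorff.
Qed.

End derivative_within.

(** * Absolutely continuous functions with vanishing derivative *)

Section absolute_continuity.
Context {R : realType}.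
Local Notation mu := (@lebesgue_measure R).
Implicit Types a b t u v w : R.

Definition rabs_cont a b (h : R -> R) := forall e : R, 0 < e ->
  exists2 d : R, 0 < d & forall (N : nat) (u v : nat -> R),
    (forall i, (i < N)%N -> [/\ a <= u i, u i <= v i & v i <= b]) ->
    (forall i, (i.+1 < N)%N -> v i <= u i.+1) ->
    \sum_(i < N) (v i - u i) < d ->
    \sum_(i < N) `|h (v i) - h (u i)| < e.

(** Half-open intervals make this content additive over adjacent intervals. *)
Let loc (U : set R) u v : R := fine (mu (U `&` `]u, v])).

Let loc_ltoo (U : set R) u v : measurable U -> (mu (U `&` `]u, v]) < +oo)%E.
Proof.
move=> mU; apply: (@le_lt_trans _ _ (mu `]u, v])).
  by apply: le_measure; rewrite ?inE//; exact: measurableI.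
by rewrite lebesgue_measure_itv/=; case: ifP => // _; rewrite -EFinD ltry.
Qed.

Let loc_add (U : set R) u v w : measurable U -> u <= v -> v <= w ->
  loc U u w = loc U u v + loc U v w.
Proof.
move=> mU uv vw; rewrite /loc -fineD; last 2 first.
- by rewrite ge0_fin_numE// loc_ltoo.
- by rewrite ge0_fin_numE// loc_ltoo.
rewrite -measureU//.
- rewrite -setIUr -itv_bndbnd_setU//.
- exact: measurableI.
- exact: measurableI.
- apply/seteqP; split => // x [[_ /=]]; rewrite in_itv/= => /andP[_ xv] [_ /=].
  by rewrite in_itv/= => /andP[/lt_le_trans/(_ xv)]; rewrite ltxx.
Qed.

(* The intervals around points of a null set of bad points have small total
   length, so they contribute little by absolute continuity; on all other
   intervals the increment of h is at most e times the length. *)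
Lemma rabs_cont_deriv0 a b (h : R -> R) : a <= b -> rabs_cont a b h ->
  {ae mu, forall t, a <= t <= b -> forall e : R, 0 < e ->
     exists2 d : R, 0 < d & forall s, a <= s <= b ->
     `|s - t| < d -> `|h s - h t| <= e * `|s - t|} ->
  h b = h a.
Proof.
move=> ab hac [N [mN N0 hN]].
suff H (e : R) : 0 < e -> `|h b - h a| <= e * (b - a) + e.
  apply/eqP; rewrite -subr_eq0 -normr_le0; apply/ler_addgt0Pr => e e0.
  have K0 : 0 < b - a + 1 by rewrite ltr_wpDl// subr_ge0.
  have := H (e / (b - a + 1)) (divr_gt0 e0 K0).
  by rewrite -[X in _ <= _ + X]mulr1 -mulrDr divfK ?gt_eqF// add0r.
move=> e0; have [d d0 hd] := hac _ e0.
have [U [oU NU mUN]] : exists U : set R,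
    [/\ open U, N `<=` U & (mu (U `\` N) < d%:E)%E].
  by apply: lebesgue_regularity_outer => //;
    apply: (@le_lt_trans _ _ 0%E) => //; rewrite -N0.
have mU : measurable U by exact: open_measurable.
have muU : (mu U < d%:E)%E.
  rewrite -(setDKU NU) (le_lt_trans (measureU2 _ _ _))//; first exact: measurableD.
  by rewrite [X in (_ + X < _)%E](_ : _ = 0%E)// adde0.
(* The exceptional intervals are carried as an existential list, with total length below the content
   of [U]. In this form the estimate is additive in the interval, lists being concatenated, and
   [cousin] applies. *)
pose P u v := exists (K : nat) (x y : nat -> R),
  [/\ forall i, (i < K)%N -> [/\ u <= x i, x i <= y i & y i <= v],
      forall i, (i.+1 < K)%N -> y i <= x i.+1,
      \sum_(i < K) (y i - x i) <= loc U u v &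
      `|h v - h u| <= e * (v - u) + \sum_(i < K) `|h (y i) - h (x i)|].
have [] : P a b; last first.
  move=> K [x [y [xy yx s1 s2]]]; rewrite (le_trans s2)// lerD2l ltW// hd//.
  rewrite (le_lt_trans s1)// -lte_fin fineK ?ge0_fin_numE ?loc_ltoo//.
  rewrite (le_lt_trans _ muU)// le_measure ?inE//; exact: measurableI.
apply: cousin => // [u v w au uv vw wb|t tab].
  move=> [K [x [y [xy yx s1 s2]]]] [K' [x' [y' [xy' yx' s1' s2']]]].
  pose c (z z' : nat -> R) i := if (i < K)%N then z i else z' (i - K)%N.
  have sumc (F : R -> R -> R) : \sum_(i < K + K') F (c y y' i) (c x x' i) =
      \sum_(i < K) F (y i) (x i) + \sum_(i < K') F (y' i) (x' i).
    rewrite big_split_ord/=; congr (_ + _); apply: eq_bigr => i _.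
      by rewrite /c ltn_ord.
    by rewrite /c ltnNge leq_addr/= addKn.
  exists (K + K')%N, (c x x'), (c y y'); split.
  - move=> i iK; rewrite /c; case: ltnP => iK1.
      by have [? ? yv] := xy _ iK1; split => //; exact: le_trans vw.
    have [|vx ? ?] := xy' (i - K)%N; first by rewrite ltn_subLR.
    by split => //; exact: le_trans vx.
  - move=> i iK; rewrite /c; case: ltnP => iK1; case: ltnP => iK2.
    + exact: yx.
    + have [_ _ yv] := xy _ iK1.
      have [|vx _ _] := xy' (i.+1 - K)%N; first by rewrite ltn_subLR.
      exact: le_trans vx.
    + by move: (leq_trans iK2 iK1); rewrite ltnNge leqnSn.
    + by rewrite subSn//; apply: yx'; rewrite -subSn// ltn_subLR// leqW.
  - by rewrite (sumc (fun p q => p - q)) (loc_add mU uv vw) lerD.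
  - rewrite (sumc (fun p q => `|h p - h q|)).
    rewrite -[h w - h u](subrKA (h v)) (le_trans (ler_normD _ _))// addrC.
    have -> : e * (w - u) = e * (v - u) + e * (w - v) by ring.
    by rewrite addrACA lerD.
(* At a bad point the whole interval, contained in [U], is listed as exceptional; at any other point
   the list is empty. *)
have [Nt|Nt] := pselect (N t).
  have /oU := NU _ Nt => -[r /= r0 rU].
  exists r => // u v au ut tv vb tu vt.
  exists 1%N, (fun=> u), (fun=> v); split => //.
  - by move=> i _; split => //; exact: le_trans tv.
  - rewrite big_ord_recl big_ord0 addr0 /loc.
    rewrite (_ : U `&` `]u, v] = `]u, v]%classic); last first.
      apply/seteqP; split=> [x []//|x /=]; rewrite in_itv/= => /andP[ux xv].
      split; last by rewrite ux.
      by apply: rU; rewrite /ball/= ltr_norml; apply/andP; split; lra.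
    rewrite lebesgue_measure_itv/= lte_fin; case: ltP => //= vu.
    by rewrite subr_le0.
  - by rewrite big_ord_recl big_ord0 addr0 lerDr mulr_ge0 ?(ltW e0)//; lra.
have hdt : forall e : R, 0 < e ->
     exists2 d : R, 0 < d & forall s, a <= s <= b ->
     `|s - t| < d -> `|h s - h t| <= e * `|s - t|.
  by apply: contrapT => K; apply: Nt; apply: hN => /= /(_ tab).
have [r r0 hr] := hdt _ e0.
exists r => // u v au ut tv vb tu vt.
exists 0%N, (fun=> 0), (fun=> 0); split => //.
  by rewrite big_ord0 fine_ge0.
rewrite big_ord0 addr0 -[h v - h u](subrKA (h t)).
rewrite (le_trans (ler_normD _ _))//.
have -> : e * (v - u) = e * `|v - t| + e * `|u - t|.
  by rewrite ger0_norm ?subr_ge0// ler0_norm ?subr_le0//; ring.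
rewrite lerD//; last rewrite distrC; apply: hr.
- by apply/andP; split => //; lra.
- by rewrite ger0_norm ?subr_ge0//; lra.
- by apply/andP; split => //; lra.
- by rewrite ler0_norm ?subr_le0//; lra.
Qed.

End absolute_continuity.

#[global] Instance ae_lebesgue_filter (R : realType) :
  Filter (nbhs (almost_everywhere (@lebesgue_measure R))).
Proof. exact: (ae_filter_ringOfSetsType (@lebesgue_measure R)). Qed.

Lemma derivable_diff_quotient (R : realType) (a b t : R) (F : R -> R) :
  derivable F t 1 -> diff_quotient a b t F --> derive1 F t.
Proof.
move=> dF; apply/diff_quotientP => e e0.
have H : (fun h => h^-1 *: (F (h + t) - F t)) @ 0^' --> derive1 F t.
  rewrite derive1E /derive.
  have -> : (fun h => h^-1 *: (F (h + t) - F t)) =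
     (fun h => h^-1 *: ((F \o shift t) (h *: 1) - F t)).
    by apply/funext => h /=; rewrite [h *: 1]mulr1.
  exact: dF.
have /cvgrPdist_le/(_ _ e0)[d /= d0 Hd] := H.
exists d => // s sab std; have [->|nst] := eqVneq s t.
  by rewrite !subrr mulr0 subrr normr0 mulr0.
have := Hd (s - t); rewrite /ball/= sub0r normrN subrK subr_eq0 => /(_ std nst).
have st0 : 0 < `|s - t| by rewrite normr_gt0 subr_eq0.
rewrite -(ler_pM2r st0) -normrM mulrBl [_ *: _]mulrC divfK ?subr_eq0//.
by rewrite distrC.
Qed.

(** * Real Lebesgue integrals over subintervals of [a, b] *)

Section interval_integral.
Context {R : realType}.
Variables a b : R.
Local Notation mu := (@lebesgue_measure R).
Implicit Types (f g : R -> R) (t u v w : R).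

(** Integrability includes Borel measurability, which a change on a null set can destroy, whereas
    derivatives of Sobolev functions are known only up to null sets. *)
Definition ae_integrable f := exists2 g : R -> R, mu.-integrable `[a, b] (EFin \o g) &
  {ae mu, forall x, a <= x <= b -> f x = g x}.

Definition bounded_borel f := measurable_fun `[a, b] f /\
  exists K : R, forall x, a <= x <= b -> `|f x| <= K.

Definition rint u v f : R := \int[mu]_(x in `[u, v]) f x.

Let mI u v : measurable (`[u, v]%classic : set (measurableTypeR R)).
Proof. exact: measurable_itv. Qed.

Lemma ae_eq_ae_integrable f g : {ae mu, forall x, a <= x <= b -> f x = g x} ->
  ae_integrable g -> ae_integrable f.
Proof.
move=> fg [h ih gh]; exists h => //.
by apply: filterS2 fg gh => x fg gh xab; rewrite fg ?gh.
Qed.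

Lemma ae_eq_rint u v f g : a <= u -> v <= b ->
  {ae mu, forall x, a <= x <= b -> f x = g x} -> rint u v f = rint u v g.
Proof.
move=> au vb fg; apply: ae_eq_Rintegral; apply: filterS fg => x fg /=.
rewrite in_itv/= => /andP[ux xv]; apply: fg.
by rewrite (le_trans au ux) (le_trans xv vb).
Qed.

Lemma eq_rint u v f g : (forall x, u <= x <= v -> f x = g x) ->
  rint u v f = rint u v g.
Proof. by move=> fg; apply: eq_Rintegral => x; rewrite inE/= in_itv; exact: fg. Qed.

Lemma integrable_ae_integrable f :
  mu.-integrable `[a, b] (EFin \o f) -> ae_integrable f.
Proof. by exists f => //; exact: aeW. Qed.

Lemma bounded_borel_integrable f : bounded_borel f ->
  mu.-integrable `[a, b] (EFin \o f).
Proof.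
move=> [mf [K fK]]; apply: measurable_bounded_integrable => //.
  by rewrite /= lebesgue_measure_itv/=; case: ifP => // _; rewrite -EFinD ltry.
exists `|K|; split; first exact: num_real.
move=> M KM x /=; rewrite in_itv/= => xab.
by rewrite (le_trans (fK _ xab))// ltW// (le_lt_trans _ KM)// ler_norm.
Qed.

Lemma bounded_borel_ae_integrable f : bounded_borel f -> ae_integrable f.
Proof. by move=> /bounded_borel_integrable; exact: integrable_ae_integrable. Qed.

Lemma bounded_borel_cst c : bounded_borel (fun=> c).
Proof. by split; [exact: measurable_cst|exists `|c|]. Qed.

Lemma ae_integrable_cst c : ae_integrable (fun=> c).
Proof. exact/bounded_borel_ae_integrable/bounded_borel_cst. Qed.

Lemma bounded_borelD f g : bounded_borel f -> bounded_borel g ->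
  bounded_borel (fun x => f x + g x).
Proof.
move=> [mf [K fK]] [mg [L gL]]; split; first exact: measurable_funD.
exists (K + L) => x xab; rewrite (le_trans (ler_normD _ _))// lerD ?fK ?gL//.
Qed.

Lemma bounded_borelM f g : bounded_borel f -> bounded_borel g ->
  bounded_borel (fun x => f x * g x).
Proof.
move=> [mf [K fK]] [mg [L gL]]; split; first exact: measurable_funM.
by exists (K * L) => x xab; rewrite normrM ler_pM ?fK ?gL.
Qed.

Lemma bounded_borelN f : bounded_borel f -> bounded_borel (fun x => - f x).
Proof.
move=> [mf [K fK]]; split; first exact: measurable_funN.
by exists K => x xab; rewrite normrN fK.
Qed.

Lemma eq_bounded_borel f g : (forall x, a <= x <= b -> f x = g x) ->
  bounded_borel f -> bounded_borel g.
Proof.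
move=> fg [mf [K fK]]; split.
  by apply: eq_measurable_fun mf => x; rewrite inE/= in_itv/=; exact: fg.
by exists K => x xab; rewrite -fg// fK.
Qed.

Lemma ae_integrableD f g : ae_integrable f -> ae_integrable g ->
  ae_integrable (fun x => f x + g x).
Proof.
move=> [f' if' ff'] [g' ig' gg']; exists (fun x => f' x + g' x).
  by have := integrableD (mI a b) if' ig'.
by apply: filterS2 ff' gg' => x ff' gg' xab; rewrite ff' ?gg'.
Qed.

Lemma ae_integrableZ c f : ae_integrable f -> ae_integrable (fun x => c * f x).
Proof.
move=> [f' if' ff']; exists (fun x => c * f' x).
  by have := integrableZl (mI a b) c if'.
by apply: filterS ff' => x ff' xab; rewrite ff'.
Qed.

Lemma ae_integrableN f : ae_integrable f -> ae_integrable (fun x => - f x).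
Proof.
move=> /(ae_integrableZ (-1)); apply: ae_eq_ae_integrable; apply: aeW => x _.
by rewrite mulN1r.
Qed.

Lemma ae_integrableB f g : ae_integrable f -> ae_integrable g ->
  ae_integrable (fun x => f x - g x).
Proof. by move=> fi gi; apply: ae_integrableD => //; exact: ae_integrableN. Qed.

Lemma ae_integrable_norm f : ae_integrable f ->
  ae_integrable (fun x => `|f x|).
Proof.
move=> [f' if' ff']; exists (fun x => `|f' x|); first exact: integrable_norm.
by apply: filterS ff' => x ff' xab; rewrite ff'.
Qed.

Lemma ae_integrableM f g : ae_integrable f -> bounded_borel g ->
  ae_integrable (fun x => f x * g x).
Proof.
move=> [f' if' ff'] [mg [K gK]]; exists (fun x => f' x * g x); last first.
  by apply: filterS ff' => x ff' xab; rewrite ff'.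
apply: (@le_integrable _ _ _ mu `[a, b] _ _ (EFin \o (fun x => `|K| * f' x))) => //.
- apply/measurable_EFinP; apply: measurable_funM => //.
  by have /integrableP[/measurable_EFinP] := if'.
- move=> x /=; rewrite in_itv/= => xab; rewrite lee_fin !normrM mulrC.
  by rewrite ler_wpM2r// normr_id (le_trans (gK _ xab))// ler_norm.
- exact: (integrableZl (mI a b) `|K| if').
Qed.

Lemma ae_integrable_sum (I : Type) (s : seq I) (F : I -> R -> R) :
  (forall i, ae_integrable (F i)) ->
  ae_integrable (fun x => \sum_(i <- s) F i x).
Proof.
move=> iF; elim: s => [|i s IH].
  apply: (@ae_eq_ae_integrable _ (fun=> 0)).
    by apply: aeW => x _; rewrite big_nil.
  exact: ae_integrable_cst.
apply: (@ae_eq_ae_integrable _ (fun x => F i x + \sum_(i <- s) F i x)).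
  by apply: aeW => x _; rewrite big_cons.
exact: ae_integrableD.
Qed.

Let rint_rep u v f g : a <= u -> v <= b ->
  mu.-integrable `[a, b] (EFin \o g) ->
  {ae mu, forall x, a <= x <= b -> f x = g x} ->
  mu.-integrable `[u, v] (EFin \o g) /\ rint u v f = rint u v g.
Proof.
move=> au vb ig fg; split; last exact: ae_eq_rint.
by apply: (integrableS _ _ _ ig) => //; apply: subset_itv; rewrite bnd_simp.
Qed.

Lemma rintD u v f g : a <= u -> v <= b -> ae_integrable f -> ae_integrable g ->
  rint u v (fun x => f x + g x) = rint u v f + rint u v g.
Proof.
move=> au vb [f' if' ff'] [g' ig' gg'].
have [ifuv ->] := rint_rep au vb if' ff'.
have [iguv ->] := rint_rep au vb ig' gg'.
rewrite (@ae_eq_rint u v _ (fun x => f' x + g' x))//; first exact: RintegralD.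
by apply: filterS2 ff' gg' => x ff' gg' xab; rewrite ff' ?gg'.
Qed.

Lemma rintZ u v c f : a <= u -> v <= b -> ae_integrable f ->
  rint u v (fun x => c * f x) = c * rint u v f.
Proof.
move=> au vb [f' if' ff'].
have [ifuv ->] := rint_rep au vb if' ff'.
rewrite (@ae_eq_rint u v _ (fun x => c * f' x))//; first exact: RintegralZl.
by apply: filterS ff' => x ff' xab; rewrite ff'.
Qed.

Lemma rintN u v f : a <= u -> v <= b -> ae_integrable f ->
  rint u v (fun x => - f x) = - rint u v f.
Proof.
move=> au vb fi; rewrite -mulN1r -rintZ//.
by apply: eq_rint => x _; rewrite mulN1r.
Qed.

Lemma rintB u v f g : a <= u -> v <= b -> ae_integrable f -> ae_integrable g ->
  rint u v (fun x => f x - g x) = rint u v f - rint u v g.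
Proof.
by move=> au vb fi gi; rewrite rintD ?rintN//; exact: ae_integrableN.
Qed.

Lemma rint_sum (I : Type) (s : seq I) (F : I -> R -> R) u v :
  a <= u -> v <= b -> (forall i, ae_integrable (F i)) ->
  rint u v (fun x => \sum_(i <- s) F i x) = \sum_(i <- s) rint u v (F i).
Proof.
move=> au vb iF; elim: s => [|i s IH].
  rewrite big_nil (@eq_rint _ _ _ (fun=> 0)).
    by rewrite /rint Rintegral_cst// mul0r.
  by move=> x _; rewrite big_nil.
rewrite big_cons -IH -rintD//; last exact: ae_integrable_sum.
by apply: eq_rint => x _; rewrite big_cons.
Qed.

Lemma rint_cat u v w f : a <= u -> u <= v -> v <= w -> w <= b ->
  ae_integrable f -> rint u w f = rint u v f + rint v w f.
Proof.
move=> au uv vw wb [f' if' ff'].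
have [ifuw ->] := rint_rep au wb if' ff'.
have [ifuv ->] := rint_rep au (le_trans vw wb) if' ff'.
have [ifvw ->] := rint_rep (le_trans au uv) wb if' ff'.
have := @Rintegral_itvB _ f' (BLeft u) (BRight w) v ifuw.
rewrite !bnd_simp => /(_ uv vw) E.
rewrite /rint -[X in _ + X]Rintegral_itv_obnd_cbnd; first by rewrite -E addrC subrK.
apply: integrableS ifvw => //; apply: subset_itv; rewrite bnd_simp//.
Qed.

Lemma rint_ge0 u v f : (forall x, u <= x <= v -> 0 <= f x) -> 0 <= rint u v f.
Proof. by move=> f0; apply: Rintegral_ge0 => x /=; rewrite in_itv; exact: f0. Qed.

Lemma le_rint u v f g : a <= u -> v <= b -> ae_integrable f ->
  ae_integrable g -> (forall x, u <= x <= v -> f x <= g x) ->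
  rint u v f <= rint u v g.
Proof.
move=> au vb fi gi fg; rewrite -subr_ge0 -rintB//.
by apply: rint_ge0 => x xuv; rewrite subr_ge0 fg.
Qed.

Lemma normr_rint u v f : a <= u -> v <= b -> ae_integrable f ->
  `|rint u v f| <= rint u v (fun x => `|f x|).
Proof.
move=> au vb fi; have fi' := ae_integrable_norm fi.
rewrite ler_norml; apply/andP; split; last first.
  by apply: le_rint => // x _; exact: ler_norm.
rewrite -rintN//; apply: le_rint => //; first exact: ae_integrableN.
by move=> x _; rewrite lerNl -normrN ler_norm.
Qed.

Lemma rint_cst u v c : u <= v -> rint u v (fun=> c) = c * (v - u).
Proof.
move=> uv; rewrite /rint Rintegral_cst//= lebesgue_measure_itv/= lte_fin.
by case: ltP => //= vu; congr (_ * _); lra.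
Qed.

Lemma rint_id u f : rint u u f = 0.
Proof. by rewrite /rint set_itv1 Rintegral_set1. Qed.

Lemma rint_subset u v u' v' f : a <= u' -> u' <= u -> u <= v -> v <= v' ->
  v' <= b -> ae_integrable f -> (forall x, u' <= x <= v' -> 0 <= f x) ->
  rint u v f <= rint u' v' f.
Proof.
move=> au' u'u uv vv' v'b fi f0.
rewrite (@rint_cat u' u v')//; last exact: le_trans uv vv'.
rewrite (@rint_cat u v v')//; last exact: le_trans u'u.
rewrite addrCA lerDl addr_ge0// rint_ge0// => x /andP[h1 h2]; apply: f0; lra.
Qed.

(** The integral of an integrable function over a set of small measure is small; the set is here the
    union of the given intervals. *)
Lemma rint_abs_cont f : ae_integrable f -> forall e : R, 0 < e ->
  exists2 d : R, 0 < d & forall (N : nat) (u v : nat -> R),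
    (forall i, (i < N)%N -> [/\ a <= u i, u i <= v i & v i <= b]) ->
    (forall i, (i.+1 < N)%N -> v i <= u i.+1) ->
    \sum_(i < N) (v i - u i) < d ->
    \sum_(i < N) rint (u i) (v i) (fun x => `|f x|) < e.
Proof.
move=> [f' if' ff'] e e0; pose h := f' \_ `[a, b].
have ih : mu.-integrable setT (EFin \o h).
  by rewrite /h -restrict_EFin; apply/integrable_restrict => //=; rewrite setTI.
have [d [d0 hd]] := integral_normr_continuous ih e0.
exists d => // N u v uv vu sd.
(* Half-open pieces stay disjoint when consecutive intervals share an endpoint, so measures and
   integrals simply add up. *)
pose A n := \big[setU/set0]_(i < n) `]u i, v i]%classic.
have mA n : measurable (A n : set (measurableTypeR R)).
  by apply: bigsetU_measurable => i _.
have Ale n x : (n < N)%N -> A n x -> x <= u n.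
  elim: n => [|n IH] nN; first by rewrite /A big_ord0.
  rewrite /A big_ord_recr/= => -[xA|].
    have [_ uvn _] := uv n (ltnW nN).
    by rewrite (le_trans (IH (ltnW nN) xA))// (le_trans uvn)// vu.
  by rewrite in_itv/= => /andP[_ xv]; rewrite (le_trans xv)// vu.
have AN n : (n <= N)%N ->
    (mu (A n) <= (\sum_(i < n) (v i - u i))%:E)%E /\
    \sum_(i < n) rint (u i) (v i) (fun x => `|f x|) =
    \int[mu]_(x in A n) `|h x|.
  elim: n => [|n IH] nN.
    by rewrite /A !big_ord0 measure0 Rintegral_set0.
  have [IH1 IH2] := IH (ltnW nN); have [aun uvn vbn] := uv n nN.
  have AS : A n.+1 = A n `|` `]u n, v n]%classic by rewrite /A big_ord_recr.
  split.
    rewrite AS big_ord_recr/= EFinD.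
    apply: (le_trans (measureU2 _ (mA n) _)) => //.
    apply: leeD => //; rewrite [leLHS](_ : _ = mu `]u n, v n]%classic)//.
    rewrite lebesgue_measure_itv/= lte_fin; case: ltP => // vun.
    by rewrite lee_fin subr_ge0.
  have ihn : mu.-integrable setT (EFin \o (fun x => `|h x|)).
    exact: integrable_norm.
  rewrite AS big_ord_recr/= IH2 Rintegral_setU//.
  - congr (_ + _).
    rewrite (@ae_eq_rint _ _ _ (fun x => `|f' x|))//; last first.
      by apply: filterS ff' => x ff' xab; rewrite ff'.
    rewrite Rintegral_itv_obnd_cbnd; last by apply: integrableS ihn.
    apply: eq_rint => x /andP[ux xv]; rewrite /h patchE ifT// inE/= in_itv/=.
    by rewrite (le_trans aun ux) (le_trans xv vbn).
  - by apply: integrableS ihn => //; exact: measurableU.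
  - apply/disj_set2P/seteqP; split => // x [xA /=]; rewrite in_itv/= => /andP[+ _].
    by rewrite ltNge (Ale n).
have [AN1 ->] := AN N (leqnn N).
apply: hd => //; apply: (le_lt_trans AN1); by rewrite lte_fin.
Qed.

Lemma rint_small f : ae_integrable f -> forall e : R, 0 < e ->
  exists2 d : R, 0 < d & forall u v, a <= u -> u <= v -> v <= b ->
    v - u < d -> rint u v (fun x => `|f x|) < e.
Proof.
move=> fi e e0; have [d d0 H] := rint_abs_cont fi e0; exists d => // u v au uv vb vud.
have := H 1%N (fun=> u) (fun=> v); rewrite !big_ord1; apply => //.
Qed.

Lemma rabs_cont_rint f : ae_integrable f -> rabs_cont a b (fun t => rint a t f).
Proof.
move=> fi e e0; have [d d0 H] := rint_abs_cont fi e0; exists d => // N u v uv vu sd.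
apply: le_lt_trans (H N u v uv vu sd); apply: ler_sum => i _.
have [au uvi vb] := uv i (ltn_ord i).
by rewrite (@rint_cat a (u i) (v i))// addrAC subrr add0r normr_rint.
Qed.

Lemma rabs_contB (h1 h2 : R -> R) : rabs_cont a b h1 -> rabs_cont a b h2 ->
  rabs_cont a b (fun t => h1 t - h2 t).
Proof.
move=> H1 H2 e e0; have e20 : 0 < e / 2 by rewrite divr_gt0.
have [d1 d10 {}H1] := H1 _ e20; have [d2 d20 {}H2] := H2 _ e20.
exists (Num.min d1 d2); first by rewrite lt_min d10.
move=> N u v uv vu; rewrite lt_min => /andP[s1 s2].
rewrite (splitr e) (le_lt_trans _ (ltrD (H1 _ _ _ uv vu s1) (H2 _ _ _ uv vu s2)))//.
rewrite -big_split/=; apply: ler_sum => i _.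
by rewrite opprD addrACA -opprD (le_trans (ler_normD _ _))// normrN.
Qed.

Lemma diff_quotient_rint_continuous f t : ae_integrable f -> a <= t <= b ->
  (forall e : R, 0 < e -> exists2 d : R, 0 < d & forall s, a <= s <= b ->
     `|s - t| < d -> `|f s - f t| <= e) ->
  diff_quotient a b t (fun s => rint a s f) --> f t.
Proof.
move=> fi /andP[at_ tb] fc; apply/diff_quotientP => e e0.
have [d d0 fd] := fc _ e0; exists d => // s /andP[as_ sb] std.
have H u v : a <= u -> u <= v -> v <= b -> u <= t <= v ->
    `|u - t| < d -> `|v - t| < d ->
    `|rint a v f - rint a u f - f t * (v - u)| <= e * (v - u).
  move=> au uv vb /andP[ut tv] ud vd.
  have ci := ae_integrable_cst.
  rewrite (@rint_cat a u v)// (addrAC (rint a u f)) subrr add0r -!rint_cst//.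
  rewrite -rintB// (le_trans (normr_rint _ _ _))//; first exact: ae_integrableB.
  apply: le_rint => //; first exact/ae_integrable_norm/ae_integrableB.
  move=> x /andP[ux xv]; apply: fd; first lra.
  by move: ud vd; rewrite !ltr_norml => /andP[? ?] /andP[? ?]; lra.
have d0' : `|t - t| < d by rewrite subrr normr0.
have [ts|/ltW st] := leP t s.
  by rewrite [X in _ <= _ * X]ger0_norm ?subr_ge0//; apply: H => //; rewrite lexx.
rewrite -normrN (_ : - (_ - _) =
    rint a t f - rint a s f - f t * (t - s)); last by ring.
rewrite [X in _ <= _ * X]distrC [X in _ <= _ * X]ger0_norm ?subr_ge0//.
by apply: H => //; rewrite lexx andbT.
Qed.

Lemma bounded_borel_rint f : a <= b -> ae_integrable f ->
  bounded_borel (fun t => rint a t f).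
Proof.
move=> ab fi; have [f' if' ff'] := fi; split; last first.
  exists (rint a b (fun x => `|f x|)) => t /andP[at_ tb].
  rewrite (le_trans (normr_rint _ _ _))// rint_subset//.
  exact: ae_integrable_norm.
have cf' := parameterized_integral_continuous ab if'.
have mf' := subspace_continuous_measurable_fun (measurable_itv _) cf'.
apply: eq_measurable_fun mf' => t; rewrite inE/= in_itv/= => /andP[at_ tb].
by rewrite -[LHS](@ae_eq_rint a t f f').
Qed.

(** Lebesgue differentiation for the extension of [f] by zero. The endpoints are discarded as a null
    set, so that the fundamental theorem is applied at interior points only. *)
Lemma diff_quotient_rint f : ae_integrable f ->
  {ae mu, forall t, a <= t <= b ->
    diff_quotient a b t (fun s => rint a s f) --> f t}.
Proof.
move=> [f' if' ff']; pose h := f' \_ `[a, b].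
have lh : locally_integrable setT h by exact: integrable_locally.
have := lebesgue_differentiation lh.
have nset c : {ae mu, forall x, x <> c}.
  exists [set c]; split => //; first exact: lebesgue_measure_set1.
  by move=> x /= /contrapT.
have nab : {ae mu, forall x, x <> a /\ x <> b}.
  by apply: filterS2 (nset a) (nset b) => x; split.
apply: filterS3 (ff') nab => x ff'x [xa xb] lx /[dup] xab /andP[ax_ xb_].
have ax : a < x by rewrite lt_neqAle ax_ andbT eq_sym; exact/eqP.
have bx : x < b by rewrite lt_neqAle xb_ andbT; exact/eqP.
have ih : mu.-integrable `[a, b] (EFin \o h).
  by rewrite /h -restrict_EFin; apply/integrable_restrict => //=; rewrite setIidr.
have [dF F'] := @FTC1_lebesgue_pt R h (BLeft a) x b bx ih ax lx.
have fh s : a <= s <= b -> rint a s f = \int[mu]_(t in `[a, s]) h t.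
  move=> /andP[as_ sb]; rewrite (ae_eq_rint _ _ ff')//.
  apply: eq_rint => t /andP[at_ ts].
  by rewrite /h patchE ifT// inE/= in_itv/= at_ (le_trans ts).
apply/diff_quotientP => e e0.
have hx : h x = f x by rewrite /h patchE ifT ?ff'x// inE/= in_itv.
have := derivable_diff_quotient a b dF; rewrite F' hx.
move=> /diff_quotientP/(_ _ e0)[d d0 H]; exists d => // s sab st.
by rewrite !fh//; exact: H.
Qed.

(** The difference of [h] and the integral of [g] is absolutely continuous with derivative zero
    almost everywhere, hence constant. *)
Lemma rabs_cont_primitive (h g : R -> R) : rabs_cont a b h ->
  ae_integrable g ->
  {ae mu, forall t, a <= t <= b -> diff_quotient a b t h --> g t} ->
  forall t, a <= t <= b -> h t = h a + rint a t g.
Proof.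
move=> hac ig hg t /andP[at_ tb].
have Hac := rabs_contB hac (rabs_cont_rint ig).
suff : h t - rint a t g = h a - rint a a g.
  by rewrite rint_id subr0 => /eqP; rewrite subr_eq => /eqP.
apply: (@rabs_cont_deriv0 R a t (fun s => h s - rint a s g)) => //.
  move=> e e0; have [d d0 H] := Hac _ e0; exists d => // N u v uv.
  by apply: H => i iN; have [? ? vt] := uv i iN; split => //; exact: le_trans tb.
apply: filterS2 hg (diff_quotient_rint ig) => s hgs igs /andP[as_ st] e e0.
have e20 : 0 < e / 2 by rewrite divr_gt0.
have sab : a <= s <= b by rewrite as_ (le_trans st).
have /diff_quotientP/(_ _ e20)[d1 d10 H1] := hgs sab.
have /diff_quotientP/(_ _ e20)[d2 d20 H2] := igs sab.
exists (Num.min d1 d2) => [|r /andP[ar rt]]; first by rewrite lt_min d10.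
have rab : a <= r <= b by rewrite ar (le_trans rt).
rewrite lt_min => /andP[/(H1 _ rab) {}H1 /(H2 _ rab) {}H2].
rewrite [X in X * _](splitr e) mulrDl (le_trans _ (lerD H1 H2))//.
rewrite (le_trans _ (ler_normB _ _))// le_eqVlt; apply/orP; left; apply/eqP.
by congr (`|_|); ring.
Qed.

End interval_integral.

(** * Complex integrals, primitives and the product rule *)

Section complex_integral.
Context {R : realType}.
Variables a b : R.
Local Notation mu := (@lebesgue_measure R).
Implicit Types (f g x y : R -> R[i]) (t u v w : R).

Definition ae_borel f := exists2 g : R -> R[i],
  measurable_fun `[a, b] (fun t => complex.Re (g t)) /\
  measurable_fun `[a, b] (fun t => complex.Im (g t)) &
  {ae mu, forall t, a <= t <= b -> f t = g t}.

Definition cintegrable f :=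
  ae_integrable a b (fun t => complex.Re (f t)) /\
  ae_integrable a b (fun t => complex.Im (f t)).

Definition cbounded_borel f :=
  bounded_borel a b (fun t => complex.Re (f t)) /\
  bounded_borel a b (fun t => complex.Im (f t)).

Definition cint u v f : R[i] :=
  rint u v (fun t => complex.Re (f t)) +i* rint u v (fun t => complex.Im (f t)).

Lemma measurable_normc g (D : set R) : measurable D ->
  measurable_fun D (fun t => complex.Re (g t)) ->
  measurable_fun D (fun t => complex.Im (g t)) ->
  measurable_fun D (fun t => normc (g t)).
Proof.
move=> mD mr mi.
have -> : (fun t => normc (g t)) =
    (fun t => (complex.Re (g t) ^+ 2 + complex.Im (g t) ^+ 2) `^ 2^-1).
  by apply/funext => t; rewrite powR12_sqrt ?addr_ge0 ?sqr_ge0//; case: (g t).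
apply: (@measurableT_comp _ _ _ _ _ _ (fun z : R => z `^ 2^-1)) => //.
by apply: measurable_funD; exact: measurable_funX.
Qed.

Lemma ae_integrable_le (f h : R -> R) :
  (exists2 g : R -> R, measurable_fun `[a, b] g &
     {ae mu, forall t, a <= t <= b -> f t = g t}) ->
  ae_integrable a b h -> (forall t, a <= t <= b -> `|f t| <= h t) ->
  ae_integrable a b f.
Proof.
move=> [g mg fg] [k ik hk] fh.
(* The bound on [f] reaches the representative [g] only almost everywhere. Truncating [g] at [|k|]
   makes it hold everywhere and changes [g] only on a null set. *)
exists (fun t => Num.max (Num.min (g t) `|k t|) (- `|k t|)); last first.
  apply: filterS2 fg hk => t fg hk tab.
  have := fh _ tab; rewrite fg// hk// => gk.
  have kk := le_trans gk (ler_norm _); move: kk.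
  by rewrite ler_norml => /andP[k1 k2]; rewrite (min_idPl k2) (max_idPl k1).
have /integrableP[/measurable_EFinP mk _] := ik.
have mk' : measurable_fun `[a, b] (fun t => `|k t|) by exact: measurableT_comp.
apply: (@le_integrable _ _ _ mu `[a, b] _ _ (EFin \o k)) => //.
  apply/measurable_EFinP; apply: measurable_maxr; last exact: measurable_funN.
  exact: measurable_minr.
move=> t _ /=; rewrite lee_fin ler_norml le_max lexx orbT/= ge_max ge_min lexx orbT/=.
by rewrite (le_trans _ (normr_ge0 _))// oppr_le0.
Qed.

Lemma ae_borel_cst c : ae_borel (fun=> c).
Proof. by exists (fun=> c); [split; exact: measurable_cst|exact: aeW]. Qed.

Lemma ae_borelD f g : ae_borel f -> ae_borel g -> ae_borel (fun t => f t + g t).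
Proof.
move=> [f' [mr mi] ff'] [g' [mr' mi'] gg']; exists (fun t => f' t + g' t).
  split.
    apply: (eq_measurable_fun (fun t => complex.Re (f' t) + complex.Re (g' t))).
      by move=> t _; rewrite Re_add.
    exact: measurable_funD.
  apply: (eq_measurable_fun (fun t => complex.Im (f' t) + complex.Im (g' t))).
    by move=> t _; rewrite Im_add.
  exact: measurable_funD.
by apply: filterS2 ff' gg' => t ff' gg' tab; rewrite ff' ?gg'.
Qed.

Lemma ae_borelM f g : ae_borel f -> ae_borel g -> ae_borel (fun t => f t * g t).
Proof.
move=> [f' [mr mi] ff'] [g' [mr' mi'] gg']; exists (fun t => f' t * g' t).
  split.
    apply: (eq_measurable_fun (fun t => complex.Re (f' t) * complex.Re (g' t) -
        complex.Im (f' t) * complex.Im (g' t))).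
      by move=> t _; rewrite Re_mul.
    by apply: measurable_funB; exact: measurable_funM.
  apply: (eq_measurable_fun (fun t => complex.Re (f' t) * complex.Im (g' t) +
      complex.Im (f' t) * complex.Re (g' t))).
    by move=> t _; rewrite Im_mul.
  by apply: measurable_funD; exact: measurable_funM.
by apply: filterS2 ff' gg' => t ff' gg' tab; rewrite ff' ?gg'.
Qed.

Lemma ae_eq_ae_borel f g : {ae mu, forall t, a <= t <= b -> f t = g t} ->
  ae_borel g -> ae_borel f.
Proof.
move=> fg [h mh gh]; exists h => //.
by apply: filterS2 fg gh => t fg gh tab; rewrite fg ?gh.
Qed.

Lemma cbounded_ae_borel f : cbounded_borel f -> ae_borel f.
Proof. by move=> [[mr _] [mi _]]; exists f => //; exact: aeW. Qed.

Lemma cintegrable_ae_borel f : cintegrable f -> ae_borel f.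
Proof.
move=> [[r ir fr] [i ii fi]]; exists (fun t => r t +i* i t).
  by split; [have /integrableP[/measurable_EFinP] := ir|
             have /integrableP[/measurable_EFinP] := ii].
apply: filterS2 fr fi => t fr fi tab; apply: complex_eqP; [exact: fr|exact: fi].
Qed.

Lemma ae_borel_normc f : ae_borel f -> exists2 g : R -> R,
  measurable_fun `[a, b] g & {ae mu, forall t, a <= t <= b -> normc (f t) = g t}.
Proof.
move=> [g [mr mi] fg]; exists (fun t => normc (g t)).
  by apply: measurable_normc.
by apply: filterS fg => t fg tab; rewrite fg.
Qed.

Lemma cintegrable_normc f : cintegrable f ->
  ae_integrable a b (fun t => normc (f t)).
Proof.
move=> fi; have [fr fj] := fi.
apply: (@ae_integrable_le _ (fun t => `|complex.Re (f t)| + `|complex.Im (f t)|)).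
- exact/ae_borel_normc/cintegrable_ae_borel.
- by apply: ae_integrableD; exact: ae_integrable_norm.
- by move=> t _; rewrite ger0_norm ?normc_ge0// le_normc_ReIm.
Qed.

Lemma cintegrable_le f (h : R -> R) : ae_borel f -> ae_integrable a b h ->
  (forall t, a <= t <= b -> normc (f t) <= h t) -> cintegrable f.
Proof.
move=> [g [mr mi] fg] ih fh; split; apply: (ae_integrable_le _ ih).
- exists (fun t => complex.Re (g t)) => //.
  by apply: filterS fg => t fg tab; rewrite fg.
- by move=> t tab; rewrite (le_trans (normc_Re _))// fh.
- exists (fun t => complex.Im (g t)) => //.
  by apply: filterS fg => t fg tab; rewrite fg.
- by move=> t tab; rewrite (le_trans (normc_Im _))// fh.
Qed.

Lemma cbounded_borelP f : cbounded_borel f ->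
  exists2 K : R, 0 < K & forall t, a <= t <= b -> normc (f t) <= K.
Proof.
move=> [[_ [K fK]] [_ [L fL]]]; exists (`|K| + `|L| + 1).
  by rewrite ltr_pwDr// addr_ge0.
move=> t tab; rewrite (le_trans (le_normc_ReIm _))// ler_wpDr//.
by rewrite lerD// (le_trans _ (ler_norm _))// ?fK ?fL.
Qed.

Lemma cbounded_borel_cst c : cbounded_borel (fun=> c).
Proof. by split; exact: bounded_borel_cst. Qed.

Lemma cbounded_borelD f g : cbounded_borel f -> cbounded_borel g ->
  cbounded_borel (fun t => f t + g t).
Proof.
move=> [fr fi] [gr gi]; split.
  by under eq_fun do rewrite Re_add; exact: bounded_borelD.
by under eq_fun do rewrite Im_add; exact: bounded_borelD.
Qed.

Lemma cbounded_borelM f g : cbounded_borel f -> cbounded_borel g ->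
  cbounded_borel (fun t => f t * g t).
Proof.
move=> [fr fi] [gr gi]; split.
  under eq_fun do rewrite Re_mul; apply: bounded_borelD.
    exact: bounded_borelM.
  by apply: bounded_borelN; exact: bounded_borelM.
by under eq_fun do rewrite Im_mul; apply: bounded_borelD; exact: bounded_borelM.
Qed.

Lemma cbounded_borelB f g : cbounded_borel f -> cbounded_borel g ->
  cbounded_borel (fun t => f t - g t).
Proof.
move=> bf bg; apply: cbounded_borelD => //.
under eq_fun do rewrite -mulN1r.
by apply: cbounded_borelM => //; exact: cbounded_borel_cst.
Qed.

Lemma eq_cbounded_borel f g : (forall t, a <= t <= b -> f t = g t) ->
  cbounded_borel f -> cbounded_borel g.
Proof.
move=> fg [fr fi]; split.
  by apply: eq_bounded_borel fr => t tab; rewrite fg.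
by apply: eq_bounded_borel fi => t tab; rewrite fg.
Qed.

Lemma cbounded_borel_cintegrable f : cbounded_borel f -> cintegrable f.
Proof. by move=> [? ?]; split; exact: bounded_borel_ae_integrable. Qed.

Lemma cintegrableD f g : cintegrable f -> cintegrable g ->
  cintegrable (fun t => f t + g t).
Proof.
move=> [fr fi] [gr gi]; split.
  by under eq_fun do rewrite Re_add; exact: ae_integrableD.
by under eq_fun do rewrite Im_add; exact: ae_integrableD.
Qed.

Lemma cintegrableM f g : cintegrable f -> cbounded_borel g ->
  cintegrable (fun t => f t * g t).
Proof.
move=> [fr fi] [gr gi]; split.
  under eq_fun do rewrite Re_mul; apply: ae_integrableB; exact: ae_integrableM.
by under eq_fun do rewrite Im_mul; apply: ae_integrableD; exact: ae_integrableM.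
Qed.

Lemma cintegrableMl f g : cbounded_borel f -> cintegrable g ->
  cintegrable (fun t => f t * g t).
Proof.
move=> bf ig; under eq_fun do rewrite mulrC; exact: cintegrableM.
Qed.

Lemma cintegrableZ c f : cintegrable f -> cintegrable (fun t => c * f t).
Proof. by apply: cintegrableMl; exact: cbounded_borel_cst. Qed.

Lemma cintegrableN f : cintegrable f -> cintegrable (fun t => - f t).
Proof.
by move=> /(cintegrableZ (-1)); under eq_fun do rewrite mulN1r.
Qed.

Lemma cintegrableB f g : cintegrable f -> cintegrable g ->
  cintegrable (fun t => f t - g t).
Proof. by move=> fi gi; apply: cintegrableD => //; exact: cintegrableN. Qed.

Lemma cintegrable_sum (I : Type) (s : seq I) (F : I -> R -> R[i]) :
  (forall i, cintegrable (F i)) ->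
  cintegrable (fun t => \sum_(i <- s) F i t).
Proof.
move=> iF; elim: s => [|i s IH].
  under eq_fun do rewrite big_nil.
  exact/cbounded_borel_cintegrable/cbounded_borel_cst.
by under eq_fun do rewrite big_cons; exact: cintegrableD.
Qed.

Lemma ae_eq_cint u v f g : a <= u -> v <= b ->
  {ae mu, forall t, a <= t <= b -> f t = g t} -> cint u v f = cint u v g.
Proof.
move=> au vb fg; rewrite /cint; congr (_ +i* _); apply: (@ae_eq_rint _ a b) => //.
  by apply: filterS fg => t fg tab; rewrite fg.
by apply: filterS fg => t fg tab; rewrite fg.
Qed.

Lemma eq_cint u v f g : (forall t, u <= t <= v -> f t = g t) ->
  cint u v f = cint u v g.
Proof.
by move=> fg; congr (_ +i* _); apply: eq_rint => t tuv; rewrite fg.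
Qed.

Lemma cint_id u f : cint u u f = 0.
Proof. by rewrite /cint !rint_id. Qed.

Lemma cintD u v f g : a <= u -> v <= b -> cintegrable f -> cintegrable g ->
  cint u v (fun t => f t + g t) = cint u v f + cint u v g.
Proof.
move=> au vb [fr fi] [gr gi]; apply: complex_eqP; rewrite ?Re_add ?Im_add/=.
  by rewrite -(rintD au vb fr gr); apply: eq_rint => t _; rewrite Re_add.
by rewrite -(rintD au vb fi gi); apply: eq_rint => t _; rewrite Im_add.
Qed.

Lemma cintZ u v c f : a <= u -> v <= b -> cintegrable f ->
  cint u v (fun t => c * f t) = c * cint u v f.
Proof.
move=> au vb [fr fi]; apply: complex_eqP; rewrite ?Re_mul ?Im_mul/=.
  rewrite -!(rintZ _ au vb)// -(rintB au vb)//; try exact: ae_integrableZ.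
  by apply: eq_rint => t _; rewrite Re_mul.
rewrite -!(rintZ _ au vb)// -(rintD au vb)//; try exact: ae_integrableZ.
by apply: eq_rint => t _; rewrite Im_mul.
Qed.

Lemma cintZr u v c f : a <= u -> v <= b -> cintegrable f ->
  cint u v (fun t => f t * c) = cint u v f * c.
Proof.
move=> au vb fi; rewrite mulrC -cintZ//.
by apply: eq_cint => t _; rewrite mulrC.
Qed.

Lemma cintN u v f : a <= u -> v <= b -> cintegrable f ->
  cint u v (fun t => - f t) = - cint u v f.
Proof.
move=> au vb fi; rewrite -mulN1r -cintZ//.
by apply: eq_cint => t _; rewrite mulN1r.
Qed.

Lemma cintB u v f g : a <= u -> v <= b -> cintegrable f -> cintegrable g ->
  cint u v (fun t => f t - g t) = cint u v f - cint u v g.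
Proof. by move=> au vb fi gi; rewrite cintD ?cintN//; exact: cintegrableN. Qed.

Lemma cint_cat u v w f : a <= u -> u <= v -> v <= w -> w <= b ->
  cintegrable f -> cint u w f = cint u v f + cint v w f.
Proof.
move=> au uv vw wb [fr fi]; apply: complex_eqP; rewrite ?Re_add ?Im_add/=.
  exact: (@rint_cat _ a b).
exact: (@rint_cat _ a b).
Qed.

(** Real and imaginary parts are bounded separately, which costs the factor 2 that recurs in later
    constants. *)
Lemma normc_cint u v f : a <= u -> v <= b -> cintegrable f ->
  normc (cint u v f) <= 2 * rint u v (fun t => normc (f t)).
Proof.
move=> au vb fi; have ni := cintegrable_normc fi; have [fr fj] := fi.
rewrite (le_trans (le_normc_ReIm _))//= mulr2n mulrDl !mul1r lerD//.
  rewrite (le_trans (normr_rint au vb fr))// (le_rint au vb)//.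
    exact: ae_integrable_norm.
  by move=> t _; exact: normc_Re.
rewrite (le_trans (normr_rint au vb fj))// (le_rint au vb)//.
  exact: ae_integrable_norm.
by move=> t _; exact: normc_Im.
Qed.

Lemma normc_cint_le t f : a <= t <= b -> cintegrable f ->
  normc (cint a t f) <= 2 * rint a b (fun s => normc (f s)).
Proof.
move=> /andP[at_ tb] fi; rewrite (le_trans (normc_cint _ _ fi))// ler_pM2l//.
apply: (@rint_subset _ a b) => //; first exact: cintegrable_normc.
by move=> s _; exact: normc_ge0.
Qed.

Lemma cbounded_borel_cint f : a <= b -> cintegrable f ->
  cbounded_borel (fun t => cint a t f).
Proof. by move=> ab [fr fi]; split; exact: bounded_borel_rint. Qed.

Lemma cint_small f : cintegrable f -> forall e : R, 0 < e ->
  exists2 d : R, 0 < d & forall u v, a <= u -> u <= v -> v <= b ->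
    v - u < d -> rint u v (fun t => normc (f t)) < e.
Proof.
move=> /cintegrable_normc /rint_small H e /H[d d0 {}H]; exists d => // u v au uv vb vud.
apply: le_lt_trans (H u v au uv vb vud).
rewrite (@eq_rint _ _ _ _ (fun t => `|normc (f t)|))// => t _.
by rewrite ger0_norm// normc_ge0.
Qed.

(** The working form of absolute continuity: no derivative is mentioned, so that [f] matters only up
    to a null set. *)
Definition primitive_of x f := forall t, a <= t <= b -> x t = x a + cint a t f.

Lemma primitive_of_sub x f u v : cintegrable f -> primitive_of x f ->
  a <= u -> u <= v -> v <= b -> x v - x u = cint u v f.
Proof.
move=> fi xf au uv vb; rewrite (xf v) ?(xf u); last 2 first.
- by rewrite au (le_trans uv).
- by rewrite (le_trans au uv).
by rewrite (@cint_cat a u v)//; ring.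
Qed.

Lemma primitive_of_cbounded x f : a <= b -> cintegrable f -> primitive_of x f ->
  cbounded_borel x.
Proof.
move=> ab fi xf; apply: (@eq_cbounded_borel (fun t => x a + cint a t f)).
  by move=> t tab; rewrite -xf.
by apply: cbounded_borelD; [exact: cbounded_borel_cst|exact: cbounded_borel_cint].
Qed.

Lemma primitive_of_continuous x f : cintegrable f -> primitive_of x f ->
  forall e : R, 0 < e -> exists2 d : R, 0 < d &
    forall s t, a <= s <= b -> a <= t <= b -> `|s - t| < d ->
      normc (x s - x t) < e.
Proof.
move=> fi xf e e0; have [d d0 H] := cint_small fi (divr_gt0 e0 (ltr0Sn _ 1)).
exists d => //.
have W s t : a <= s <= b -> a <= t <= b -> `|s - t| < d -> s <= t ->
    normc (x s - x t) < e.
  move=> /andP[as_ sb] /andP[at_ tb] std st.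
  rewrite normcB (primitive_of_sub fi xf)// (le_lt_trans (normc_cint _ _ fi))//.
  rewrite mulrC -ltr_pdivlMr// H//.
  by move: std; rewrite distrC ger0_norm// subr_ge0.
move=> s t sab tab std; have [st|/ltW ts] := leP s t; first exact: W.
by rewrite normcB; apply: W => //; rewrite distrC.
Qed.

(** The increment of [x * y] minus the integral of the candidate derivative is, on a short interval,
    at most [e] times the integral of [|f| + |g|], by uniform continuity of [x] and [y]. Such a
    bound is additive, so [cousin] extends it to the whole interval, and [e] is arbitrary. *)
Lemma primitive_ofM x y f g : cintegrable f -> cintegrable g ->
  primitive_of x f -> primitive_of y g ->
  primitive_of (fun t => x t * y t) (fun t => f t * y t + x t * g t).
Proof.
move=> fi gi xf yg t /andP[at_ tb]; have ab := le_trans at_ tb.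
have bx := primitive_of_cbounded ab fi xf.
have by_ := primitive_of_cbounded ab gi yg.
have fyi : cintegrable (fun t => f t * y t) by exact: cintegrableM.
have xgi : cintegrable (fun t => x t * g t) by exact: cintegrableMl.
have Gi := cintegrableD fyi xgi.
set G := (fun t => f t * y t + x t * g t) in Gi *.
pose h t := x t * y t - cint a t G.
pose N t := normc (f t) + normc (g t).
have Ni : ae_integrable a b N by apply: ae_integrableD; exact: cintegrable_normc.
suff H (e : R) : 0 < e -> normc (h t - h a) <= e * rint a t N.
  apply/eqP; rewrite -subr_eq0 (_ : _ - _ = h t - h a); last first.
    by rewrite /h cint_id; ring.
  rewrite -normc_eq0 eq_le normc_ge0 andbT.
  apply/ler_addgt0Pr => e e0; rewrite add0r.
  have K0 : 0 <= rint a t N by apply: rint_ge0 => s _; rewrite addr_ge0 ?normc_ge0.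
  have K1 : 0 < rint a t N + 1 by rewrite ltr_wpDl.
  rewrite (le_trans (H _ (divr_gt0 e0 K1)))// mulrAC ler_pdivrMr// ler_pM2l//.
  by rewrite lerDl.
move=> e0; have e20 : 0 < e / 2 by rewrite divr_gt0.
have [d1 d10 H1] := primitive_of_continuous fi xf e20.
have [d2 d20 H2] := primitive_of_continuous gi yg e20.
apply: (@cousin _ (fun u v => normc (h v - h u) <= e * rint u v N) a t) => //.
  move=> u v w au uv vw wt Huv Hvw; have wb := le_trans wt tb.
  rewrite (@rint_cat _ a b u v w)// mulrDr.
  rewrite (le_trans (le_normcDl _ (h v) _))// addrC lerD//.
move=> r /andP[ar rt]; exists (Num.min d1 d2 / 2).
  by rewrite divr_gt0// lt_min d10.
move=> u v au ur rv vt ru vr.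
have uv := le_trans ur rv; have vb := le_trans vt tb.
have vud : v - u < Num.min d1 d2 by lra.
have [vud1 vud2] : v - u < d1 /\ v - u < d2.
  by move: vud; rewrite lt_min => /andP.
have -> : h v - h u = cint u v (fun s => f s * (y v - y s) + (x u - x s) * g s).
  (* Freezing [y] at the right end and [x] at the left end leaves only the differences [y v - y s]
     and [x u - x s] under the integral, each below [e / 2]. *)
  have -> : h v - h u = (x v - x u) * y v + x u * (y v - y u) - cint u v G.
    by rewrite /h (@cint_cat a u v)//; ring.
  rewrite (primitive_of_sub fi xf)// (primitive_of_sub gi yg)//.
  have fyv : cintegrable (fun s => f s * y v).
    by apply: cintegrableM => //; exact: cbounded_borel_cst.
  have xug : cintegrable (fun s => x u * g s) by exact: cintegrableZ.
  rewrite -(cintZr _ au vb)// -(cintZ _ au vb)// -(cintD au vb)//.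
  rewrite -(cintB au vb)//; last exact: cintegrableD.
  by apply: eq_cint => s _; rewrite /G; ring.
have ji : cintegrable (fun s => f s * (y v - y s) + (x u - x s) * g s).
  apply: cintegrableD.
    apply: cintegrableM => //; apply: cbounded_borelB => //.
    exact: cbounded_borel_cst.
  apply: cintegrableMl => //; apply: cbounded_borelB => //.
  exact: cbounded_borel_cst.
rewrite (le_trans (normc_cint au vb ji))//.
have -> : e * rint u v N = 2 * ((e / 2) * rint u v N) by field.
rewrite ler_pM2l// -(rintZ _ au vb)//; apply: (le_rint au vb) => //.
- exact: cintegrable_normc.
- exact: ae_integrableZ.
move=> s /andP[us sv]; rewrite (le_trans (le_normcD _ _))// /N [leRHS]mulrDr lerD//.
  rewrite normcM mulrC ler_wpM2r ?normc_ge0// ltW// H2//.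
  - by rewrite (le_trans au uv).
  - by rewrite (le_trans au us) (le_trans sv).
  - by rewrite ger0_norm ?subr_ge0//; lra.
rewrite normcM ler_wpM2r ?normc_ge0// ltW// H1//.
- by rewrite au (le_trans uv).
- by rewrite (le_trans au us) (le_trans sv).
- by rewrite ler0_norm ?subr_le0//; lra.
Qed.

End complex_integral.

(** * Elementary inequalities for real powers *)

Section power_inequalities.
Context {R : realType}.
Implicit Types x y c p : R.

(* Splits the range of x at c; optimizing c gives Hoelder's inequality up to a
   factor 2. *)
Lemma le_add_powR p c x : 1 <= p -> 0 < c -> 0 <= x ->
  x <= c + c `^ (1 - p) * x `^ p.
Proof.
move=> p1 c0 x0; have [xc|cx] := leP x c.
  by rewrite (le_trans xc)// lerDl mulr_ge0 ?powR_ge0.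
rewrite ler_wpDl ?(ltW c0)//.
have xp : 0 < x by exact: lt_trans cx.
have -> : 1 - p = - (p - 1) by ring.
have -> : x `^ p = x * x `^ (p - 1).
  rewrite -[X in _ = X * _](powRr1 x0) -powRD; first by rewrite addrC subrK.
  by rewrite (gt_eqF xp) implybT.
rewrite powRN mulrCA ler_peMr// mulrC ler_pdivlMr ?powR_gt0// mul1r.
by rewrite ge0_ler_powR ?nnegrE ?subr_ge0 ?(ltW c0) ?(ltW cx).
Qed.

(** [x + y] is at most twice the larger of the two. *)
Lemma powR_add_le p x y : 0 <= p -> 0 <= x -> 0 <= y ->
  (x + y) `^ p <= 2 `^ p * (x `^ p + y `^ p).
Proof.
move=> p0 x0 y0.
have H u v : 0 <= u -> u <= v -> (u + v) `^ p <= 2 `^ p * (u `^ p + v `^ p).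
  move=> u0 uv; have v0 := le_trans u0 uv.
  apply: (@le_trans _ _ ((2 * v) `^ p)).
    rewrite ge0_ler_powR ?nnegrE ?addr_ge0 ?mulr_ge0//.
    by rewrite mulr_natl mulr2n lerD2r.
  by rewrite powRM// ler_wpM2l ?powR_ge0// lerDr powR_ge0.
have [xy|/ltW yx] := leP x y; first exact: H.
by rewrite addrC [X in _ * X]addrC H.
Qed.

Lemma powR_ge_id p x : 1 <= p -> 1 <= x -> x <= x `^ p.
Proof.
move=> p1 x1; rewrite -[leLHS]powRr1 ?(le_trans _ x1)//.
by rewrite ler_powR.
Qed.

End power_inequalities.

(** * Balls of L_p and Hoelder's inequality *)

Section Lp_ball.
Context {R : realType}.
Variables p a b : R.
Hypotheses (p1 : 1 <= p) (ab : a < b).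
Local Notation mu := (@lebesgue_measure R).
Implicit Types (f g x y : R -> R[i]) (t u v w M K : R).

Let p0 : 0 < p. Proof. exact: lt_le_trans p1. Qed.
Let ab' : a <= b. Proof. exact: ltW. Qed.

(** A ball rather than a norm, so that membership and bound travel together. The radius is positive
    even for the zero function, which lets it serve as a divisor and as a scale. *)
Definition lp M x := [/\ 0 < M, ae_borel a b x,
  ae_integrable a b (fun t => normc (x t) `^ p) &
  rint a b (fun t => normc (x t) `^ p) <= M `^ p].

Lemma ae_borel_powR x : ae_borel a b x -> exists2 g : R -> R,
  measurable_fun `[a, b] g &
  {ae mu, forall t, a <= t <= b -> normc (x t) `^ p = g t}.
Proof.
move=> /ae_borel_normc [g mg xg]; exists (fun t => g t `^ p).
  by apply: (@measurableT_comp _ _ _ _ _ _ (fun z : R => z `^ p)).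
by apply: filterS xg => t xg tab; rewrite xg.
Qed.

Lemma lp_le M N x : M <= N -> lp M x -> lp N x.
Proof.
move=> MN [M0 bx ix nx]; split => //; first exact: lt_le_trans MN.
rewrite (le_trans nx)// ge0_ler_powR ?nnegrE ?(ltW p0) ?(ltW M0)//.
by rewrite (le_trans (ltW M0)).
Qed.

Lemma lp_ae_eq M x y : {ae mu, forall t, a <= t <= b -> x t = y t} ->
  lp M x -> lp M y.
Proof.
move=> xy [M0 bx ix nx].
have yx : {ae mu, forall t, a <= t <= b -> y t = x t}.
  by apply: filterS xy => t xy tab; rewrite xy.
have yxp : {ae mu, forall t, a <= t <= b -> normc (y t) `^ p = normc (x t) `^ p}.
  by apply: filterS yx => t yx tab; rewrite yx.
split; [by []|exact: ae_eq_ae_borel bx|exact: ae_eq_ae_integrable ix|].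
by rewrite (ae_eq_rint _ _ yxp).
Qed.

Lemma lp_dom M K x y : 0 < K -> ae_borel a b y ->
  (forall t, a <= t <= b -> normc (y t) <= K * normc (x t)) ->
  lp M x -> lp (K * M) y.
Proof.
move=> K0 my yx [M0 bx ix nx].
have yxp t : a <= t <= b -> normc (y t) `^ p <= K `^ p * normc (x t) `^ p.
  move=> tab; rewrite -powRM ?(ltW K0) ?normc_ge0//.
  by rewrite ge0_ler_powR ?nnegrE ?(ltW p0) ?mulr_ge0 ?normc_ge0 ?(ltW K0)// yx.
have iKx := ae_integrableZ (K `^ p) ix.
have iy : ae_integrable a b (fun t => normc (y t) `^ p).
  apply: (ae_integrable_le (ae_borel_powR my) iKx) => t tab.
  by rewrite ger0_norm ?powR_ge0// yxp.
split => //; first exact: mulr_gt0.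
rewrite (le_trans (le_rint _ _ iy iKx yxp))// (rintZ _ _ _ ix)//.
by rewrite powRM ?(ltW K0) ?(ltW M0)// ler_wpM2l// powR_ge0.
Qed.

(** The added 1 keeps the radius positive for [c = 0]. *)
Lemma lpZ M c x : lp M x -> lp ((normc c + 1) * M) (fun t => c * x t).
Proof.
move=> Mx; have [M0 bx _ _] := Mx; apply: lp_dom Mx.
- by rewrite ltr_wpDl ?normc_ge0.
- by apply: ae_borelM => //; exact: ae_borel_cst.
- by move=> t _; rewrite normcM ler_wpM2r ?normc_ge0// lerDl.
Qed.

Lemma lpD M N x y : lp M x -> lp N y -> lp (4 * (M + N)) (fun t => x t + y t).
Proof.
move=> [M0 bx ix nx] [N0 by_ iy ny].
have MN0 : 0 < M + N by exact: addr_gt0.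
have bxy := ae_borelD bx by_.
have le2 t : a <= t <= b -> normc (x t + y t) `^ p <=
    2 `^ p * (normc (x t) `^ p + normc (y t) `^ p).
  move=> _; apply: (le_trans _ (powR_add_le _ _ _)); rewrite ?normc_ge0 ?(ltW p0)//.
  by rewrite ge0_ler_powR ?nnegrE ?addr_ge0 ?normc_ge0 ?(ltW p0)// le_normcD.
have is_ := ae_integrableD ix iy.
have i2 := ae_integrableZ (2 `^ p) is_.
have ixy : ae_integrable a b (fun t => normc (x t + y t) `^ p).
  apply: (ae_integrable_le (ae_borel_powR bxy) i2) => t tab.
  by rewrite ger0_norm ?powR_ge0// le2.
split => //; first exact: mulr_gt0.
rewrite (le_trans (le_rint _ _ ixy i2 le2))// (rintZ _ _ _ is_)// (rintD _ _ ix iy)//.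
(* One factor 2 comes from [powR_add_le]; the p-th power of the other is at least 2 and absorbs the
   sum of the two p-th powers. *)
have -> : 4 * (M + N) = 2 * (2 * (M + N)) by ring.
rewrite [leRHS]powRM ?mulr_ge0 ?(ltW MN0)// ler_wpM2l ?powR_ge0//.
rewrite powRM ?(ltW MN0)// (le_trans _ (ler_wpM2r _ (powR_ge_id p1 _)))//;
  rewrite ?powR_ge0 ?ler1n//.
rewrite mulr_natl mulr2n lerD//; [rewrite (le_trans nx)//|rewrite (le_trans ny)//].
  by rewrite ge0_ler_powR ?nnegrE ?(ltW p0) ?(ltW M0) ?(ltW MN0)// lerDl ltW.
by rewrite ge0_ler_powR ?nnegrE ?(ltW p0) ?(ltW N0) ?(ltW MN0)// lerDr ltW.
Qed.

(** The p-th power of [1 + (b - a)] is at least the length [b - a], because the base is at least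
    1. *)
Lemma lp_cbounded K x : 0 < K -> cbounded_borel a b x ->
  (forall t, a <= t <= b -> normc (x t) <= K) ->
  lp (K * (1 + (b - a))) x.
Proof.
move=> K0 bx xK; have mx := cbounded_ae_borel bx.
have ba0 : 0 < b - a by rewrite subr_gt0.
have ba1 : 1 <= 1 + (b - a) by rewrite lerDl ltW.
have xKp t : a <= t <= b -> normc (x t) `^ p <= K `^ p.
  by move=> tab; rewrite ge0_ler_powR ?nnegrE ?(ltW p0) ?normc_ge0 ?(ltW K0)// xK.
have iK : ae_integrable a b (fun=> K `^ p).
  exact: ae_integrable_cst.
have ix : ae_integrable a b (fun t => normc (x t) `^ p).
  apply: (ae_integrable_le (ae_borel_powR mx) iK) => t tab.
  by rewrite ger0_norm ?powR_ge0// xKp.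
split => //; first by rewrite mulr_gt0// (lt_le_trans _ ba1).
rewrite (le_trans (le_rint _ _ ix iK xKp))// rint_cst//.
rewrite powRM ?(ltW K0) ?(le_trans _ ba1)// ler_wpM2l ?powR_ge0//.
by rewrite (le_trans _ (powR_ge_id p1 ba1))// lerDr.
Qed.

Lemma lp_cintegrable M x : lp M x -> cintegrable a b x.
Proof.
move=> [M0 bx ix nx].
have i1 : ae_integrable a b (fun t => 1 + 1 `^ (1 - p) * normc (x t) `^ p).
  apply: ae_integrableD; last exact: ae_integrableZ.
  exact: ae_integrable_cst.
by apply: (cintegrable_le bx i1) => t tab; rewrite le_add_powR ?normc_ge0.
Qed.

(** The bound [K] is local to the interval. With [K = M] this is Hoelder's inequality; with small
    [K] on short intervals it is its little-o version. *)
Lemma lp_hoelder_itv M K x u v : lp M x -> a <= u -> u <= v -> v <= b ->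
  0 < K -> rint u v (fun t => normc (x t) `^ p) <= K `^ p ->
  rint u v (fun t => normc (x t)) <= 2 * K * (v - u) `^ (1 - p^-1).
Proof.
move=> Mx au uv vb K0 nK; have ix := cintegrable_normc (lp_cintegrable Mx).
have [vu|uv'] := leP v u.
  have -> : v = u by apply/eqP; rewrite eq_le vu uv.
  by rewrite rint_id mulr_ge0 ?powR_ge0// mulr_ge0// ltW.
have L0 : 0 < v - u by rewrite subr_gt0.
set L := v - u in L0 *; have [M0 _ ixp _] := Mx.
(* This value balances the two terms of [le_add_powR]: after integration over length [L] both equal
   [K] times L^(1 - 1/p). *)
set c := K * L `^ (- p^-1).
have c0 : 0 < c by rewrite mulr_gt0 ?powR_gt0.
have ic : ae_integrable a b (fun=> c).
  exact: ae_integrable_cst.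
have iz := ae_integrableZ (c `^ (1 - p)) ixp.
have := le_rint au vb ix (ae_integrableD ic iz)
  (fun t _ => le_add_powR p1 c0 (normc_ge0 (x t))).
move/le_trans; apply.
rewrite (rintD au vb ic iz) (rintZ _ au vb ixp) rint_cst//.
have cL : c * L = K * L `^ (1 - p^-1).
  rewrite /c -mulrA -[X in _ * (_ * X)]powRr1 ?(ltW L0)//.
  by rewrite -powRD 1?addrC// (gt_eqF L0) implybT.
have cK : c `^ (1 - p) * K `^ p = K * L `^ (1 - p^-1).
  rewrite /c powRM ?(ltW K0) ?powR_ge0// -powRrM mulrAC -powRD; last first.
    by rewrite (gt_eqF K0) implybT.
  rewrite subrK powRr1 ?(ltW K0)//; congr (_ * L `^ _).
  by field; rewrite gt_eqF.
rewrite -/L cL -mulrA mulr_natl mulr2n lerD// -cK.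
by rewrite ler_wpM2l ?powR_ge0.
Qed.

Lemma lp_hoelder M x u v : lp M x -> a <= u -> u <= v -> v <= b ->
  rint u v (fun t => normc (x t)) <= 2 * M * (v - u) `^ (1 - p^-1).
Proof.
move=> Mx au uv vb; have [M0 bx ix nx] := Mx.
apply: (lp_hoelder_itv Mx) => //; rewrite (le_trans _ nx)// (@rint_subset _ a b)//.
by move=> t _; exact: powR_ge0.
Qed.

(** The integral of the p-th power over short intervals tends to 0, so the local bound may be taken
    as [e / 2]. For p = 1 the power of the length is 1 and only this smallness remains. *)
Lemma lp_hoelder_small M x : lp M x -> forall e : R, 0 < e ->
  exists2 d : R, 0 < d & forall u v, a <= u -> u <= v -> v <= b ->
    v - u < d -> rint u v (fun t => normc (x t)) <= e * (v - u) `^ (1 - p^-1).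
Proof.
move=> Mx e e0; have [M0 bx ix nx] := Mx.
have e20 : 0 < e / 2 by rewrite divr_gt0.
have [d d0 H] := rint_small ix (powR_gt0 p e20); exists d => // u v au uv vb vud.
have -> : e = 2 * (e / 2) by field.
apply: (lp_hoelder_itv Mx) => //; rewrite ltW// (le_lt_trans _ (H u v au uv vb vud))//.
rewrite (@eq_rint _ _ _ _ (fun t => `|normc (x t) `^ p|))// => t _.
by rewrite ger0_norm// powR_ge0.
Qed.

End Lp_ball.

(** * Derivatives of complex functions *)

Section derivative_complex.
Context {R : realType}.
Implicit Types (a b t : R) (x y : R -> R[i]) (z : R[i]).

Lemma eq_diff_quotient a b t (h1 h2 : R -> R) :
  (forall s, a <= s <= b -> h1 s = h2 s) -> a <= t <= b ->
  diff_quotient a b t h1 = diff_quotient a b t h2.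
Proof.
move=> h12 tab.
have H h h' : (forall s, a <= s <= b -> h s = h' s) ->
    diff_quotient a b t h `<=` diff_quotient a b t h'.
  move=> hh' A [d /= d0 Hd]; exists d => //= s sd st; rewrite in_itv/= => sab.
  by have := Hd s sd st; rewrite /= in_itv/= hh'// (hh' t)//; apply.
by apply/seteqP; split; apply: H => s sab; rewrite h12.
Qed.

Lemma eq_cderiv a b t x y : (forall s, a <= s <= b -> x s = y s) ->
  a <= t <= b -> cderiv a b x t = cderiv a b y t.
Proof.
move=> xy tab; rewrite /cderiv; congr (lim _ +i* lim _);
  by apply: eq_diff_quotient => // s sab; rewrite xy.
Qed.

Lemma has_cderivE a b t x z : a < b -> a <= t <= b ->
  has_cderiv a b x t z -> cderiv a b x t = z.
Proof.
move=> ab tab [xr xi]; rewrite /cderiv (diff_quotient_lim ab tab xr).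
by rewrite (diff_quotient_lim ab tab xi); case: z {xr xi}.
Qed.

Lemma eq_cderivn a b l t x y : (forall s, a <= s <= b -> x s = y s) ->
  a <= t <= b -> cderivn a b l x t = cderivn a b l y t.
Proof.
elim: l t => [|l IH] t xy tab; first exact: xy.
by rewrite /= -/(cderivn _ _ _ _); apply: eq_cderiv => // s sab; exact: IH.
Qed.

Lemma cderivnSr a b l x : cderivn a b l.+1 x = cderivn a b l (cderiv a b x).
Proof. by rewrite /cderivn iterSr. Qed.

(** Takes the place of [rabs_cont_primitive] for the lower derivatives, of which [sobolev] asserts
    differentiability everywhere instead of absolute continuity. Near each point [r] both [h] and
    the integral of [g] are linear with slope [g r] up to a small relative error, and [cousin] adds
    the errors. *)
Lemma diff_quotient_continuous_primitive a b (h g : R -> R) :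
  ae_integrable a b g ->
  (forall t, a <= t <= b -> forall e : R, 0 < e -> exists2 d : R, 0 < d &
     forall s, a <= s <= b -> `|s - t| < d -> `|g s - g t| <= e) ->
  (forall t, a <= t <= b -> diff_quotient a b t h --> g t) ->
  forall t, a <= t <= b -> h t = h a + rint a t g.
Proof.
move=> ig gc hg t /andP[at_ tb].
suff H (e : R) : 0 < e -> `|h t - h a - rint a t g| <= e * (t - a).
  apply/eqP; rewrite -subr_eq0 opprD addrA -normr_le0.
  apply/ler_addgt0Pr => e e0; rewrite add0r.
  have K1 : 0 < t - a + 1 by rewrite ltr_wpDl// subr_ge0.
  rewrite (le_trans (H _ (divr_gt0 e0 K1)))// mulrAC ler_pdivrMr// ler_pM2l//.
  by rewrite lerDl.
move=> e0; have e20 : 0 < e / 2 by rewrite divr_gt0.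
apply: (@cousin _ (fun u v => `|h v - h u - rint u v g| <= e * (v - u)) a t) => //.
  move=> u v w au uv vw wt Huv Hvw.
  rewrite (@rint_cat _ a b u v w)//; last exact: le_trans tb.
  have -> : h w - h u - (rint u v g + rint v w g) =
      (h v - h u - rint u v g) + (h w - h v - rint v w g) by ring.
  have -> : e * (w - u) = e * (v - u) + e * (w - v) by ring.
  by rewrite (le_trans (ler_normD _ _))// lerD.
move=> r /andP[ar rt]; have rab : a <= r <= b by rewrite ar (le_trans rt).
have /diff_quotientP/(_ _ e20)[d1 d10 H1] := hg _ rab.
have /diff_quotientP/(_ _ e20)[d2 d20 H2] :=
  diff_quotient_rint_continuous ig rab (gc _ rab).
exists (Num.min d1 d2); first by rewrite lt_min d10.
move=> u v au ur rv vt ru vr.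
have W s : a <= s <= b -> `|s - r| < Num.min d1 d2 ->
    `|h s - h r - (rint a s g - rint a r g)| <= e * `|s - r|.
  rewrite lt_min => sab /andP[sr1 sr2].
  have -> : h s - h r - (rint a s g - rint a r g) =
    (h s - h r - g r * (s - r)) - (rint a s g - rint a r g - g r * (s - r)).
    by ring.
  rewrite (le_trans (ler_normB _ _))// [X in _ <= X * _](splitr e) mulrDl lerD//.
    exact: H1.
  exact: H2.
have vab : a <= v <= b by rewrite (le_trans au (le_trans ur rv)) (le_trans vt).
have uab : a <= u <= b by rewrite au (le_trans ur (le_trans rv (le_trans vt tb))).
have Wv : `|h v - h r - (rint a v g - rint a r g)| <= e * (v - r).
  rewrite (le_trans (W _ vab _))//.
    by rewrite ger0_norm ?subr_ge0//; lra.
  by rewrite ger0_norm ?subr_ge0.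
have Wu : `|h u - h r - (rint a u g - rint a r g)| <= e * (r - u).
  rewrite (le_trans (W _ uab _))//.
    by rewrite ler0_norm ?subr_le0//; lra.
  by rewrite ler0_norm ?subr_le0// opprB.
have -> : h v - h u - rint u v g =
    (h v - h r - (rint a v g - rint a r g)) -
    (h u - h r - (rint a u g - rint a r g)).
  by rewrite (@rint_cat _ a b a u v)//; [ring|lra|lra].
have -> : e * (v - u) = e * (v - r) + e * (r - u) by ring.
by rewrite (le_trans (ler_normB _ _))// lerD.
Qed.

End derivative_complex.

(** * Balls of W^n_p: embeddings, linear structure, products *)

Section sobolev_ball.
Context {R : realType}.
Variables p a b : R.
Hypotheses (p1 : 1 <= p) (ab : a < b).
Local Notation mu := (@lebesgue_measure R).
Local Notation D := (cderiv a b).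
Local Notation lp := (lp p a b).
Implicit Types (f g x y : R -> R[i]) (t u v w M N K C : R) (n l : nat).

Let ab' : a <= b. Proof. exact: ltW. Qed.
Let aab : a <= a <= b. Proof. by rewrite lexx ab'. Qed.

(* A ball of W^n_p for the norm built from the values x(a), ..., x^(n-1)(a) and
   the L_p norm of x^(n), equivalent to the usual one. *)
Fixpoint sob n M x : Prop := match n with
  | 0 => lp M x
  | k.+1 => [/\ normc (x a) <= M, sob k M (D x) & primitive_of a b x (D x)]
  end.

Lemma sobSP n M x : sob n.+1 M x ->
  [/\ normc (x a) <= M, sob n M (D x) & primitive_of a b x (D x)].
Proof. by []. Qed.

Definition sob_eq n x y := if n is 0
  then {ae mu, forall t, a <= t <= b -> x t = y t}
  else forall t, a <= t <= b -> x t = y t.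

Lemma sob_eqW n x y : (forall t, a <= t <= b -> x t = y t) -> sob_eq n x y.
Proof. by case: n => //= xy; exact: aeW. Qed.

Lemma sob_eq_ae n x y : sob_eq n x y ->
  {ae mu, forall t, a <= t <= b -> x t = y t}.
Proof. by case: n => //= n xy; exact: aeW. Qed.

Lemma sob_eq_sym n x y : sob_eq n x y -> sob_eq n y x.
Proof.
case: n => [|n] /= xy; last by move=> t tab; rewrite xy.
by apply: filterS xy => t xy tab; rewrite xy.
Qed.

Lemma sob_gt0 n M x : sob n M x -> 0 < M.
Proof. by elim: n x => [x []//|n IH x /sobSP[_ /IH]]. Qed.

Lemma sob_le n M N x : M <= N -> sob n M x -> sob n N x.
Proof.
move=> MN; elim: n x => [x|n IH x /sobSP[xa Dx xD]]; first exact: lp_le.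
by split; [exact: le_trans MN|exact: IH|].
Qed.

Lemma sob_uniform (J : finType) n (F : J -> R -> R[i]) :
  (forall j, exists M, sob n M (F j)) ->
  exists2 M, 0 < M & forall j, sob n M (F j).
Proof.
move=> sF; pose M j := sval (cid (sF j)).
have sM j : sob n (M j) (F j) by exact: svalP (cid (sF j)).
have M0 j : 0 <= M j by exact/ltW/(sob_gt0 (sM j)).
exists (1 + \sum_j M j); first by rewrite ltr_pwDl// sumr_ge0.
move=> j; apply: sob_le (sM j); rewrite (bigD1 j)//= addrCA lerDl addr_ge0//.
by apply: sumr_ge0.
Qed.

Lemma sob_cong n M x y : sob_eq n x y -> sob n M x -> sob n M y.
Proof.
elim: n x y => [x y|n IH x y /= xy]; first exact: lp_ae_eq.
move=> /sobSP[xa Dx xD]; have DD t : a <= t <= b -> D x t = D y t.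
  by move=> tab; exact: eq_cderiv.
split; first by rewrite -xy.
  by apply: IH Dx; exact: sob_eqW.
move=> t tab; have [at_ tb] := andP tab; rewrite -(xy t tab) -(xy a aab) (xD t tab).
rewrite (@eq_cint _ _ _ (D x) (D y))// => s /andP[as_ st].
by apply: DD; rewrite as_ (le_trans st).
Qed.

Lemma sob_cbounded_of n M x : (forall y, sob n M y -> cintegrable a b y) ->
  sob n.+1 M x -> cbounded_borel a b x.
Proof. by move=> H /sobSP[_ /H ix xD]; exact: (primitive_of_cbounded ab' ix xD). Qed.

Lemma sob_cintegrable n M x : sob n M x -> cintegrable a b x.
Proof.
elim: n x => [x|n IH x Mx]; first exact: lp_cintegrable.
exact/cbounded_borel_cintegrable/(sob_cbounded_of IH Mx).
Qed.

Lemma sob_cbounded n M x : sob n.+1 M x -> cbounded_borel a b x.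
Proof. by apply: sob_cbounded_of => y; exact: sob_cintegrable. Qed.

Lemma sob_continuous n M x : sob n.+1 M x -> forall t, a <= t <= b ->
  forall e : R, 0 < e -> exists2 d : R, 0 < d & forall s, a <= s <= b ->
  `|s - t| < d -> normc (x s - x t) <= e.
Proof.
move=> /sobSP[_ Dx xD] t tab e e0.
have [d d0 H] := primitive_of_continuous (sob_cintegrable Dx) xD e0.
by exists d => // s sab st; apply/ltW/H.
Qed.

(** In positive order [g] is continuous, so its integral is differentiable at every point, endpoints
    included; in order 0 only Lebesgue differentiation is available. *)
Lemma primitive_has_cderiv n M x g : sob n M g -> primitive_of a b x g ->
  if n is 0 then {ae mu, forall t, a <= t <= b -> has_cderiv a b x t (g t)}
  else forall t, a <= t <= b -> has_cderiv a b x t (g t).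
Proof.
move=> Mg xg; have [ir ii] := sob_cintegrable Mg.
have xr s : a <= s <= b -> complex.Re (x s) =
    complex.Re (x a) + rint a s (fun t => complex.Re (g t)).
  by move=> sab; rewrite xg// Re_add.
have xi s : a <= s <= b -> complex.Im (x s) =
    complex.Im (x a) + rint a s (fun t => complex.Im (g t)).
  by move=> sab; rewrite xg// Im_add.
have shift (h k : R -> R) (c z : R) t : (forall s, a <= s <= b -> h s = c + k s) ->
    a <= t <= b -> (diff_quotient a b t k --> z) -> diff_quotient a b t h --> z.
  move=> hk tab /diff_quotientP H; apply/diff_quotientP => e /H[d d0 {}H].
  exists d => // s sab st; rewrite !hk// (_ : c + k s - (c + k t) = k s - k t).
    exact: H.
  by ring.
case: n Mg => [|n] Mg.
  apply: filterS2 (diff_quotient_rint ir) (diff_quotient_rint ii).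
  move=> t Hr Hi tab; split.
    exact: (shift _ _ _ _ _ xr tab (Hr tab)).
  exact: (shift _ _ _ _ _ xi tab (Hi tab)).
move=> t tab; split.
  apply: (shift _ _ _ _ _ xr tab).
  apply: diff_quotient_rint_continuous => // e e0.
  have [d d0 H] := sob_continuous Mg tab e0; exists d => // s sab st.
  by rewrite (le_trans _ (H _ sab st))// -Re_opp -Re_add normc_Re.
apply: (shift _ _ _ _ _ xi tab).
apply: diff_quotient_rint_continuous => // e e0.
have [d d0 H] := sob_continuous Mg tab e0; exists d => // s sab st.
by rewrite (le_trans _ (H _ sab st))// -Im_opp -Im_add normc_Im.
Qed.

Lemma primitive_cderiv n M x g : sob n M g -> primitive_of a b x g ->
  sob_eq n (D x) g.
Proof.
move=> Mg xg; have := primitive_has_cderiv Mg xg; case: n Mg => [|n] Mg H /=.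
  by apply: filterS H => t H tab; exact: has_cderivE (H _).
by move=> t tab; exact: has_cderivE (H _ _).
Qed.

(** Introduction rule for [sob]: a function [g] at hand replaces [D x], whose values are limits. The
    two agree in the sense of [sob_eq] by [primitive_cderiv]. *)
Lemma sobS n M x g : normc (x a) <= M -> sob n M g -> primitive_of a b x g ->
  sob n.+1 M x.
Proof.
move=> xa Mg xg; have Dg := primitive_cderiv Mg xg.
split => //; first exact: sob_cong (sob_eq_sym Dg) Mg.
move=> t /andP[at_ tb]; rewrite xg ?at_//; congr (_ + _).
by apply: (@ae_eq_cint _ a b) => //; exact/sob_eq_ae/sob_eq_sym/Dg.
Qed.

Lemma sob_rint n : exists2 C, 0 < C & forall M x, sob n M x ->
  rint a b (fun t => normc (x t)) <= C * M.
Proof.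
have ba0 : 0 < b - a by rewrite subr_gt0.
elim: n => [|n [C C0 H]].
  exists (2 * (b - a) `^ (1 - p^-1)); first by rewrite mulr_gt0 ?powR_gt0.
  move=> M x Mx; rewrite (le_trans (lp_hoelder p1 Mx _ _ _))//.
  by rewrite mulrAC.
exists ((b - a) * (1 + 2 * C)); first by rewrite mulr_gt0// addr_gt0// mulr_gt0.
move=> M x Mx; have [xa Dx xD] := sobSP Mx; have M0 := sob_gt0 Mx.
have ix := sob_cintegrable Mx; have iD := sob_cintegrable Dx.
have -> : (b - a) * (1 + 2 * C) * M = (M + 2 * (C * M)) * (b - a) by ring.
rewrite -rint_cst// (@le_rint _ a b)//; first exact: cintegrable_normc.
  exact: ae_integrable_cst.
move=> t tab; rewrite xD// (le_trans (le_normcD _ _))// lerD//.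
by rewrite (le_trans (normc_cint_le tab iD))// ler_pM2l// H.
Qed.

Lemma sob_sup n : exists2 C, 1 <= C & forall M x, sob n.+1 M x ->
  forall t, a <= t <= b -> normc (x t) <= C * M.
Proof.
have [C C0 H] := sob_rint n; exists (1 + 2 * C).
  by rewrite lerDl mulr_ge0// ltW.
move=> M x /sobSP[xa Dx xD] t tab; have iD := sob_cintegrable Dx.
rewrite xD// (le_trans (le_normcD _ _))// mulrDl mul1r lerD//.
by rewrite (le_trans (normc_cint_le tab iD))// -mulrA ler_pM2l// H.
Qed.

Lemma sob_down n : exists2 C, 1 <= C & forall M x, sob n.+1 M x -> sob n (C * M) x.
Proof.
elim: n => [|n [C C1 H]].
  have [C C1 H] := sob_sup 0; exists (C * (1 + (b - a))).
    by rewrite mulr_ege1// lerDl subr_ge0.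
  move=> M x Mx; have M0 := sob_gt0 Mx; rewrite mulrAC; apply: lp_cbounded => //.
  - by rewrite mulr_gt0// (lt_le_trans _ C1).
  - exact: sob_cbounded Mx.
  - by move=> t tab; exact: H.
exists C => // M x Mx; have M0 := sob_gt0 Mx; have [xa Dx xD] := sobSP Mx; split => //.
  by rewrite (le_trans xa)// ler_peMl// ltW.
exact: H.
Qed.

Lemma sob_downn n k : exists2 C, 1 <= C &
  forall M x, sob (k + n) M x -> sob n (C * M) x.
Proof.
elim: k => [|k [C C1 H]]; first by exists 1 => // M x; rewrite mul1r.
have [C' C'1 H'] := sob_down (k + n); exists (C * C'); first by rewrite mulr_ege1.
by move=> M x /H'/H; rewrite mulrA.
Qed.

Lemma sob_leq n k : (n <= k)%N -> exists2 C, 1 <= C &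
  forall M x, sob k M x -> sob n (C * M) x.
Proof. by move=> nk; have := sob_downn n (k - n); rewrite subnK. Qed.

Lemma sob_cderivn n l M x : (l <= n)%N -> sob n M x ->
  sob (n - l) M (cderivn a b l x).
Proof.
elim: l n x => [n x _|l IH n x]; first by rewrite subn0.
case: n => [|n] ln; first discriminate ln.
by move=> /sobSP[_ Dx _]; rewrite cderivnSr subSS; exact: IH.
Qed.

Lemma sob0 n M : 0 < M -> sob n M (fun=> 0).
Proof.
elim: n => [|n IH] M0.
  split => //; first exact: ae_borel_cst.
    exact: ae_integrable_cst.
  rewrite rint_cst// normc0 powR0 ?mul0r ?powR_ge0// gt_eqF//.
  exact: lt_le_trans p1.
apply: (@sobS _ _ _ (fun=> 0)); [by rewrite normc0 ltW|exact: IH|].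
move=> t tab; rewrite add0r; apply: complex_eqP => /=.
  by rewrite rint_cst ?mul0r//; have /andP[] := tab.
by rewrite rint_cst ?mul0r//; have /andP[] := tab.
Qed.

Lemma sobD n M N x y : sob n M x -> sob n N y ->
  sob n (4 * (M + N)) (fun t => x t + y t).
Proof.
elim: n x y => [x y|n IH x y Mx Ny]; first exact: lpD.
have M0 := sob_gt0 Mx; have N0 := sob_gt0 Ny.
move: Mx Ny => /sobSP[xa Dx xD] /sobSP[ya Dy yD].
apply: sobS (IH _ _ Dx Dy) _.
  rewrite (le_trans (le_normcD _ _))// (le_trans (lerD xa ya))//.
  by rewrite ler_peMl ?ler1n// ltW// addr_gt0.
move=> t /andP[at_ tb]; rewrite xD ?at_// yD ?at_// (@cintD _ a b)//;
  [by ring|exact: sob_cintegrable Dx|exact: sob_cintegrable Dy].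
Qed.

Lemma sobZ n c M x : sob n M x -> sob n ((normc c + 1) * M) (fun t => c * x t).
Proof.
elim: n x => [x|n IH x Mx]; first exact: lpZ.
have M0 := sob_gt0 Mx; have [xa Dx xD] := sobSP Mx.
apply: sobS (IH _ Dx) _.
  rewrite normcM ler_pM ?normc_ge0//.
  by rewrite lerDl.
move=> t /andP[at_ tb]; rewrite xD ?at_// mulrDr (@cintZ _ a b)//.
exact: sob_cintegrable Dx.
Qed.

(** Exact scaling, unlike [sobZ]: it allows functions to be normalized to radius 1. *)
Lemma sobZ_neq0 n c M x : c != 0 -> sob n M x ->
  sob n (normc c * M) (fun t => c * x t).
Proof.
move=> c0; have nc0 : 0 < normc c by rewrite lt_neqAle normc_ge0 andbT eq_sym normc_eq0.
elim: n x => [x Mx|n IH x Mx].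
  apply: lp_dom (Mx) => //.
    by apply: ae_borelM; [exact: ae_borel_cst|have [] := Mx].
  by move=> t _; rewrite normcM.
have [xa Dx xD] := sobSP Mx; apply: sobS (IH _ Dx) _.
  by rewrite normcM ler_wpM2l// ltW.
move=> t /andP[at_ tb]; rewrite xD ?at_// mulrDr (@cintZ _ a b)//.
exact: sob_cintegrable Dx.
Qed.

Lemma sobN n M x : sob n M x -> sob n (2 * M) (fun t => - x t).
Proof.
move=> /(sobZ (-1)); rewrite normcN normc1 => H.
by apply: sob_cong H; apply: sob_eqW => t _; rewrite mulN1r.
Qed.

Lemma sobB n M N x y : sob n M x -> sob n N y ->
  sob n (8 * (M + N)) (fun t => x t - y t).
Proof.
move=> Mx Ny; have M0 := sob_gt0 Mx; have := sobD Mx (sobN Ny).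
by apply: sob_le; lra.
Qed.

(** The order [l] stays strictly below [n], where derivatives are continuous; at order [n] the
    identity would hold only almost everywhere. *)
Lemma cderivn_lin n l c M N x y : sob n M x -> sob n N y -> (l < n)%N ->
  forall t, a <= t <= b ->
  cderivn a b l (fun s => c * x s + y s) t =
  c * cderivn a b l x t + cderivn a b l y t.
Proof.
elim: l n M N x y => [//|l IH n M N x y].
case: n => [//|[//|n]] Mx Ny ln t tab.
rewrite !cderivnSr; have [_ Dx xD] := sobSP Mx; have [_ Dy yD] := sobSP Ny.
have cDx := sobZ c Dx.
have H : primitive_of a b (fun s => c * x s + y s) (fun s => c * D x s + D y s).
  move=> s /andP[as_ sb]; rewrite xD ?as_// yD ?as_// (@cintD _ a b)//.
  - by rewrite (@cintZ _ a b)//; [ring|exact: sob_cintegrable Dx].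
  - exact: sob_cintegrable cDx.
  - exact: sob_cintegrable Dy.
have E := primitive_cderiv (sobD cDx Dy) H.
rewrite -(IH n.+1 _ _ _ _ Dx Dy)//.
by apply: eq_cderivn => // s sab; rewrite E.
Qed.

Lemma sob_primitiveM n M N x y : sob n.+1 M x -> sob n.+1 N y ->
  primitive_of a b (fun t => x t * y t) (fun t => D x t * y t + x t * D y t).
Proof.
move=> /sobSP[_ Dx xD] /sobSP[_ Dy yD].
by apply: primitive_ofM => //; [exact: sob_cintegrable Dx|exact: sob_cintegrable Dy].
Qed.

(** L_p is not an algebra, but multiplication by a bounded function preserves it, and one more
    derivative on [y] supplies the bound; higher orders follow by the product rule. This is the
    situation of a coefficient in W^n_p multiplying a derivative in W^(n+1)_p. *)
Lemma sobM_down n : exists2 C, 1 <= C & forall M N x y, sob n M x -> sob n.+1 N y ->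
  sob n (C * (M * N)) (fun t => x t * y t).
Proof.
elim: n => [|n [C C1 H]].
  have [C C1 H] := sob_sup 0; exists C => // M N x y Mx Ny.
  have M0 := sob_gt0 Mx; have N0 := sob_gt0 Ny.
  rewrite mulrCA mulrC; apply: lp_dom (Mx) => //.
  - by rewrite mulr_gt0// (lt_le_trans _ C1).
  - apply: ae_borelM; first exact/cintegrable_ae_borel/(sob_cintegrable Mx).
    exact/cintegrable_ae_borel/(sob_cintegrable Ny).
  - by move=> t tab; rewrite normcM mulrC ler_wpM2r ?normc_ge0// H.
have [C' C'1 H'] := sob_down n; have [C2 C21 H2] := sob_down n.+1.
exists (4 * (C * C2 + C * C')).
  by have := mulr_ege1 C1 C'1; have := mulr_ege1 C1 C21; lra.
move=> M N x y Mx Ny; have M0 := sob_gt0 Mx; have N0 := sob_gt0 Ny.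
have [xa Dx xD] := sobSP Mx; have [ya Dy yD] := sobSP Ny.
have S1 := H _ _ _ _ Dx (H2 _ _ Ny); have S2 := H _ _ _ _ (H' _ _ Mx) Dy.
have -> : 4 * (C * C2 + C * C') * (M * N) =
    4 * (C * (M * (C2 * N)) + C * (C' * M * N)) by ring.
apply: sobS (sobD S1 S2) _; last exact: sob_primitiveM Mx (H2 _ _ Ny).
rewrite normcM (le_trans (ler_pM _ _ xa ya)) ?normc_ge0//.
have MN : 0 < M * N by exact: mulr_gt0.
have -> : 4 * (C * (M * (C2 * N)) + C * (C' * M * N)) =
  4 * (C * C2 + C * C') * (M * N) by ring.
rewrite ler_peMl// ?(ltW MN)//.
by have := mulr_ege1 C1 C'1; have := mulr_ege1 C1 C21; lra.
Qed.

(** Each of the two terms of the product rule pairs a factor of order [n] with one of order [n.+1],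
    as [sobM_down] requires. *)
Lemma sobM n : exists2 C, 1 <= C & forall M N x y, sob n.+1 M x -> sob n.+1 N y ->
  sob n.+1 (C * (M * N)) (fun t => x t * y t).
Proof.
have [C C1 H] := sobM_down n; exists (4 * (C + C)); first by lra.
move=> M N x y Mx Ny; have M0 := sob_gt0 Mx; have N0 := sob_gt0 Ny.
have [xa Dx xD] := sobSP Mx; have [ya Dy yD] := sobSP Ny.
have S1 := H _ _ _ _ Dx Ny; have S2 := H _ _ _ _ Dy Mx.
have S2' : sob n (C * (M * N)) (fun t => x t * D y t).
  rewrite [M * N]mulrC; apply: sob_cong S2; apply: sob_eqW => t _.
  by rewrite mulrC.
have -> : 4 * (C + C) * (M * N) = 4 * (C * (M * N) + C * (M * N)) by ring.
apply: sobS (sobD S1 S2') _; last exact: sob_primitiveM Mx Ny.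
rewrite normcM (le_trans (ler_pM _ _ xa ya)) ?normc_ge0//.
have -> : 4 * (C * (M * N) + C * (M * N)) = (8 * C) * (M * N) by ring.
by rewrite ler_peMl//; [rewrite mulr_ge0 ?(ltW M0) ?(ltW N0)|lra].
Qed.

Lemma sob1_hoelder M x u v : sob 1 M x -> a <= u -> u <= v -> v <= b ->
  normc (x v - x u) <= 4 * M * (v - u) `^ (1 - p^-1).
Proof.
move=> /sobSP[_ Dx xD] au uv vb; have iD := sob_cintegrable Dx.
rewrite (primitive_of_sub iD xD)// (le_trans (normc_cint _ _ iD))//.
have -> : 4 * M * (v - u) `^ (1 - p^-1) = 2 * (2 * M * (v - u) `^ (1 - p^-1)).
  by ring.
by rewrite ler_pM2l//; exact: (lp_hoelder p1 Dx).
Qed.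

Lemma sob1_hoelder_small M x : sob 1 M x -> forall e : R, 0 < e ->
  exists2 d : R, 0 < d & forall u v, a <= u -> u <= v -> v <= b ->
    v - u < d -> normc (x v - x u) <= e * (v - u) `^ (1 - p^-1).
Proof.
move=> /sobSP[_ Dx xD] e e0; have iD := sob_cintegrable Dx.
have [d d0 H] := lp_hoelder_small p1 Dx (divr_gt0 e0 (ltr0Sn _ 1)).
exists d => // u v au uv vb vud.
rewrite (primitive_of_sub iD xD)// (le_trans (normc_cint _ _ iD))//.
have -> : e * (v - u) `^ (1 - p^-1) = 2 * (e / 2 * (v - u) `^ (1 - p^-1)) by field.
by rewrite ler_pM2l//; exact: H.
Qed.

Lemma sob2_lipschitz n : exists2 C, 1 <= C & forall M x, sob n.+2 M x ->
  forall u v, a <= u -> u <= v -> v <= b -> normc (x v - x u) <= C * M * (v - u).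
Proof.
have [C C1 H] := sob_sup n; exists (2 * C); first by lra.
move=> M x /sobSP[_ Dx xD] u v au uv vb; have iD := sob_cintegrable Dx.
rewrite (primitive_of_sub iD xD)// (le_trans (normc_cint _ _ iD))//.
rewrite -!mulrA ler_pM2l// [leRHS]mulrA -rint_cst// (@le_rint _ a b)//.
- exact: cintegrable_normc.
- exact: ae_integrable_cst.
- by move=> t /andP[ut tv]; apply: H => //; rewrite (le_trans au ut) (le_trans tv).
Qed.

End sobolev_ball.

(** * Equivalence of the balls with the Sobolev norm *)

Section sobolev_equivalence.
Context {R : realType}.
Variables p a b : R.
Hypotheses (p1 : 1 <= p) (ab : a < b).
Local Notation mu := (@lebesgue_measure R).
Local Notation D := (cderiv a b).
Local Notation lp := (lp p a b).
Local Notation sob := (sob p a b).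
Implicit Types (f g x y : R -> R[i]) (t u v w M N K C : R) (n l : nat).

Let p0 : 0 < p. Proof. exact: lt_le_trans p1. Qed.
Let ab' : a <= b. Proof. exact: ltW. Qed.
Let aab : a <= a <= b. Proof. by rewrite lexx ab'. Qed.

Let integral_powR x : ae_integrable a b (fun t => normc (x t) `^ p) ->
  (\int[mu]_(t in `[a, b]) (normc (x t) `^ p)%:E)%E =
  (rint a b (fun t => normc (x t) `^ p))%:E.
Proof.
move=> [g ig xg]; rewrite /rint /Rintegral.
have E : (\int[mu]_(t in `[a, b]) (normc (x t) `^ p)%:E =
    \int[mu]_(t in `[a, b]) (g t)%:E)%E.
  apply: ae_eq_integral_any; apply: filterS xg => t xg /=.
  by rewrite in_itv/= => tab; rewrite xg.
by rewrite E fineK//; exact: integrable_fin_num.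
Qed.

Lemma ae_borel_powR_integrable x : ae_borel a b x ->
  (\int[mu]_(t in `[a, b]) (normc (x t) `^ p)%:E < +oo)%E ->
  ae_integrable a b (fun t => normc (x t) `^ p).
Proof.
move=> [g [mr mi] xg] xoo; exists (fun t => normc (g t) `^ p); last first.
  by apply: filterS xg => t xg tab; rewrite xg.
have mg : measurable_fun `[a, b] (fun t => normc (g t) `^ p).
  apply: (@measurableT_comp _ _ _ _ _ _ (fun z : R => z `^ p)) => //.
  exact: measurable_normc.
apply/integrableP; split; first exact/measurable_EFinP.
apply: le_lt_trans xoo; rewrite le_eqVlt; apply/orP; left; apply/eqP.
apply: ae_eq_integral_any; apply: filterS xg => t xg /=.
by rewrite in_itv/= => tab; rewrite xg// ger0_norm// powR_ge0.
Qed.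

Lemma lpP M x : ae_borel a b x -> 0 < M ->
  (\int[mu]_(t in `[a, b]) (normc (x t) `^ p)%:E <= (M `^ p)%:E)%E -> lp M x.
Proof.
move=> bx M0 xM; have ix := ae_borel_powR_integrable bx (le_lt_trans xM (ltry _)).
by split => //; rewrite -lee_fin -integral_powR.
Qed.

Lemma lp_integral M x : lp M x ->
  (\int[mu]_(t in `[a, b]) (normc (x t) `^ p)%:E <= (M `^ p)%:E)%E.
Proof. by move=> [M0 bx ix nx]; rewrite integral_powR// lee_fin. Qed.

Lemma Lp_borel_lp g : Lp_borel p a b g -> exists M, lp M g.
Proof.
move=> [mr mi goo].
have bg : ae_borel a b g by exists g => //; exact: aeW.
have ig := ae_borel_powR_integrable bg goo.
exists (1 + rint a b (fun t => normc (g t) `^ p)).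
have r0 : 0 <= rint a b (fun t => normc (g t) `^ p).
  by apply: rint_ge0 => t _; exact: powR_ge0.
split => //; first by rewrite ltr_pwDl.
by rewrite (le_trans _ (powR_ge_id p1 _)) ?lerDl ?lerDr.
Qed.

Lemma lp_Lp_borel M x : lp M x -> exists2 g, Lp_borel p a b g &
  {ae mu, forall t, a <= t <= b -> x t = g t}.
Proof.
move=> Mx; have [M0 [g [mr mi] xg] ix nx] := Mx; exists g => //; split => //.
by have /lp_integral/le_lt_trans := lp_ae_eq xg Mx; apply; exact: ltry.
Qed.

Lemma cabs_cont_Re_Im x : abs_cont a b x ->
  rabs_cont a b (fun t => complex.Re (x t)) /\
  rabs_cont a b (fun t => complex.Im (x t)).
Proof.
move=> H; split=> e /H[d d0 {}H]; exists d => // N u v uv vu s.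
  apply: le_lt_trans (H N u v uv vu s); apply: ler_sum => i _.
  by rewrite -Re_opp -Re_add normc_Re.
apply: le_lt_trans (H N u v uv vu s); apply: ler_sum => i _.
by rewrite -Im_opp -Im_add normc_Im.
Qed.

Lemma abs_cont_primitive x g : cintegrable a b g -> primitive_of a b x g ->
  abs_cont a b x.
Proof.
move=> ig xg e e0; have e20 : 0 < e / 2 by rewrite divr_gt0.
have [d d0 H] := rint_abs_cont (cintegrable_normc ig) e20.
exists d => // N u v uv vu s; have {}H := H N u v uv vu s.
have -> : e = 2 * (e / 2) by field.
apply: (@le_lt_trans _ _
  (2 * \sum_(i < N) rint (u i) (v i) (fun t => `|normc (g t)|))).
  rewrite mulr_sumr; apply: ler_sum => i _.
  have [aui uvi vbi] := uv i (ltn_ord i).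
  rewrite (primitive_of_sub ig xg)// (le_trans (normc_cint _ _ ig))//.
  rewrite ler_pM2l// le_eqVlt; apply/orP; left; apply/eqP.
  by apply: eq_rint => t _; rewrite ger0_norm// normc_ge0.
by rewrite ltr_pM2l.
Qed.

(** Absolute continuity is given for the derivative of order [n - 1] alone. For [n = 1] it yields
    the integral representation directly; for larger [n] the function [x] is differentiable
    everywhere and its derivative is continuous by induction. *)
Lemma sobolev_sob n x : sobolev n p a b x -> exists M, sob n M x.
Proof.
elim: n x => [x [g Lg xg]|[_ x|n IH x]].
- have [M Mg] := Lp_borel_lp Lg; exists M; apply: lp_ae_eq Mg.
  by apply: filterS xg => t xg tab; rewrite xg// in_itv.
- move=> [_ ax [g Lg xg]].
  have [M Mg] := Lp_borel_lp Lg; have ig := lp_cintegrable p1 Mg.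
  have xg' : {ae mu, forall t, a <= t <= b -> has_cderiv a b x t (g t)}.
    by apply: filterS xg => t H tab; apply: H; rewrite in_itv.
  have [ar ai] := cabs_cont_Re_Im ax; have [ir ii] := ig.
  have px : primitive_of a b x g.
    move=> t tab; apply: complex_eqP; rewrite ?Re_add ?Im_add/=.
      apply: (rabs_cont_primitive ar ir) => //.
      by apply: filterS xg' => s H sab; exact: (H sab).1.
    apply: (rabs_cont_primitive ai ii) => //.
    by apply: filterS xg' => s H sab; exact: (H sab).2.
  exists (Num.max M (normc (x a))).
  apply: (@sobS _ _ _ _ p1 ab _ _ _ g _ _ px); first by rewrite le_max lexx orbT.
  by apply: (lp_le p1 _ Mg); rewrite le_max lexx.
move=> [dx ax hx].
have [M Mx] : exists M, sob n.+1 M (D x).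
  apply: IH; split; last first.
  - by have [g Lg xg] := hx; exists g => //; rewrite -cderivnSr.
  - by rewrite -cderivnSr.
  - by move=> j jn t tab; rewrite -cderivnSr; exact: dx.
have hD t : a <= t <= b -> has_cderiv a b x t (D x t).
  move=> tab; have [|z hz] := dx 0%N (ltn0Sn _) t; first by rewrite in_itv.
  by rewrite (has_cderivE _ _ hz).
have ig := sob_cintegrable p1 ab Mx; have [ir ii] := ig.
have cD := sob_continuous p1 ab Mx.
have px : primitive_of a b x (D x).
  move=> t tab; apply: complex_eqP; rewrite ?Re_add ?Im_add/=.
    apply: (@diff_quotient_continuous_primitive R a b (fun s => complex.Re (x s))
      (fun s => complex.Re (D x s)) ir _ _ t tab).
      move=> s sab e e0; have [d d0 H] := cD _ sab _ e0; exists d => // r rab rs.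
      by rewrite (le_trans _ (H _ rab rs))// -Re_opp -Re_add normc_Re.
    by move=> s sab; exact: (hD _ sab).1.
  apply: (@diff_quotient_continuous_primitive R a b (fun s => complex.Im (x s))
    (fun s => complex.Im (D x s)) ii _ _ t tab).
    move=> s sab e e0; have [d d0 H] := cD _ sab _ e0; exists d => // r rab rs.
    by rewrite (le_trans _ (H _ rab rs))// -Im_opp -Im_add normc_Im.
  by move=> s sab; exact: (hD _ sab).2.
exists (Num.max M (normc (x a))).
apply: (@sobS _ _ _ _ p1 ab _ _ _ (D x) _ _ px); first by rewrite le_max lexx orbT.
by apply: (sob_le p1 _ Mx); rewrite le_max lexx.
Qed.

Lemma sob_sobolev n M x : sob n M x -> sobolev n p a b x.
Proof.
elim: n x => [x|[_ x|n IH x]].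
- move=> /lp_Lp_borel[g Lg xg]; exists g; first by [].
  by apply: filterS xg => t H; rewrite in_itv/= => tab; exact: H.
- move=> /sobSP[_ Dx xD]; split => //.
    exact: (abs_cont_primitive (sob_cintegrable p1 ab Dx) xD).
  have [g Lg xg] := lp_Lp_borel Dx; exists g => //.
  have H := primitive_has_cderiv p1 ab Dx xD.
  by apply: filterS2 (xg) H => t xg' H; rewrite in_itv/= => tab; rewrite -xg'//; exact: H.
move=> /sobSP[_ Dx xD]; have [dx ax hx] := IH _ Dx.
have H := primitive_has_cderiv p1 ab Dx xD.
split; last first.
- by have [g Lg xg] := hx; exists g => //; rewrite cderivnSr.
- by rewrite cderivnSr.
- move=> [_ t tab|j jn t tab]; last by rewrite cderivnSr; exact: dx.
  by exists (D x t); apply: H; rewrite in_itv/= in tab.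
Qed.

Lemma sobolev_norm_le n : exists2 C, 1 <= C & forall M x, sob n M x ->
  (sobolev_norm n p a b x <= (C * M)%:E)%E.
Proof.
have [C C1 HC] : exists2 C, 1 <= C & forall j M x, (j <= n)%N -> sob n M x ->
    lp (C * M) (cderivn a b j x).
  suff [C C1 HC] : exists2 C, 1 <= C & forall k M x, (k <= n)%N -> sob k M x ->
      lp (C * M) x.
    exists C => // j M x jn Mx; apply: (HC (n - j)%N); first exact: leq_subr.
    exact: sob_cderivn.
  elim: n => [|n [C C1 H]].
    by exists 1 => // -[|//] M x _ Mx; rewrite mul1r.
  have [C' C'1 H'] := sob_leq p1 ab (leq0n n.+1).
  exists (C + C'); first by rewrite ler_wpDr// (le_trans _ C'1).
  move=> k M x; rewrite leq_eqVlt => /predU1P[->|kn] Mx.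
    apply: (lp_le p1 _ (H' _ _ Mx)); rewrite ler_wpM2r ?(ltW (sob_gt0 Mx))//.
    by rewrite lerDr (le_trans _ C1).
  apply: (lp_le p1 _ (H _ _ _ kn Mx)); rewrite ler_wpM2r ?(ltW (sob_gt0 Mx))//.
  by rewrite lerDl (le_trans _ C'1).
(* The sum has [n.+1] terms, each at most the p-th power of [C * M], and [n.+1] is at most its own
   p-th power. *)
exists (n.+1%:R * C); first by rewrite mulr_ege1// ler1n.
move=> M x Mx; have M0 := sob_gt0 Mx.
have CM0 : 0 < C * M by rewrite mulr_gt0// (lt_le_trans _ C1).
have n1 : 1 <= n.+1%:R :> R by rewrite ler1n.
have nCM0 : 0 <= n.+1%:R * C * M by rewrite -mulrA mulr_ge0// ltW.
rewrite /sobolev_norm.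
have -> : ((n.+1%:R * C * M)%:E = ((n.+1%:R * C * M) `^ p)%:E `^ p^-1)%E.
  by rewrite poweR_EFin -powRrM divff ?gt_eqF// powRr1.
apply: gt0_ler_poweR.
- by rewrite invr_ge0 ltW.
- rewrite in_itv/= leey andbT; apply: sume_ge0 => j _.
  by apply: integral_ge0 => t _; rewrite lee_fin powR_ge0.
- by rewrite in_itv/= leey andbT lee_fin powR_ge0.
apply: (@le_trans _ _ (\sum_(0 <= j < n.+1) ((C * M) `^ p)%:E)%E).
  rewrite big_nat [leRHS]big_nat; apply: lee_sum => j /andP[_ jn].
  exact/lp_integral/HC.
rewrite sumEFin lee_fin sumr_const_nat subn0 -mulrA [leRHS]powRM ?(ltW CM0)//.
by rewrite -[leLHS]mulr_natl ler_wpM2r ?powR_ge0// powR_ge_id.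
Qed.

(** The value at [a] has to be recovered from L_p norms: |x(a)| is at most |x(t)| plus twice the
    integral of |x'|, and averaging over [t] turns |x(t)| into an L_1 norm, bounded by Hoelder's
    inequality. The radius [M] records membership only and leaves no trace in the result. *)
Lemma sob_of_lp n : exists2 C, 1 <= C & forall M N x, sob n M x ->
  (forall j, (j <= n)%N -> lp N (cderivn a b j x)) -> sob n (C * N) x.
Proof.
elim: n => [|n [C C1 H]].
  by exists 1 => // M N x _ /(_ _ (leqnn _)); rewrite mul1r.
have [K K0 HK] := sob_rint p1 ab n.
have ba0 : 0 < b - a by rewrite subr_gt0.
set q := (b - a) `^ (1 - p^-1).
have q0 : 0 < q by rewrite powR_gt0.
pose C' := 2 * q / (b - a) + 2 * (K * C) + C.
exists C'.
  rewrite /C' ler_wpDl//; apply: addr_ge0.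
    by rewrite divr_ge0 ?mulr_ge0 ?ltW.
  by rewrite mulr_ge0// mulr_ge0 ?ltW// (lt_le_trans _ C1).
move=> M N x Mx lx; have [xa Dx xD] := sobSP Mx.
have iD := sob_cintegrable p1 ab Dx.
have lx0 := lx 0%N (leq0n _); have [N0 _ _ _] := lx0.
have SD : sob n (C * N) (D x).
  by apply: (H _ _ _ Dx) => j jn; rewrite -cderivnSr; exact: lx.
apply: (@sobS _ _ _ _ p1 ab _ _ _ (D x) _ _ xD); last first.
  apply: (sob_le p1 _ SD); rewrite ler_wpM2r ?(ltW N0)// /C' lerDr.
  by rewrite addr_ge0// ?divr_ge0 ?mulr_ge0 ?ltW// (lt_le_trans _ C1).
have ix := sob_cintegrable p1 ab Mx.
have S1 t : a <= t <= b -> normc (x a) <= normc (x t) + 2 * (K * (C * N)).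
  move=> tab; have -> : x a = x t - cint a t (D x) by rewrite (xD t tab); ring.
  rewrite (le_trans (le_normcD _ _))// normcN lerD2l.
  by rewrite (le_trans (normc_cint_le tab iD))// ler_pM2l//; exact: HK.
have ci := ae_integrable_cst a b.
have := @le_rint _ a b a b _ _ (lexx _) (lexx _) (ci (normc (x a)))
  (ae_integrableD (cintegrable_normc ix) (ci (2 * (K * (C * N))))) S1.
rewrite (@rintD _ a b)//; last exact: cintegrable_normc.
rewrite !rint_cst// -ler_pdivlMr// => /le_trans; apply.
have := lp_hoelder p1 lx0 (lexx _) ab' (lexx _); rewrite -/q => hx.
rewrite mulrDl mulfK ?gt_eqF//.
have -> : C' * N = 2 * N * q / (b - a) + 2 * (K * (C * N)) + C * N.
  by rewrite /C'; ring.
rewrite -addrA lerD//; first by rewrite ler_pM2r ?invr_gt0.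
by rewrite lerDl mulr_ge0 ?(ltW N0)// (le_trans _ C1).
Qed.

Lemma sob_sobolev_norm n : exists2 C, 1 <= C & forall N x, sobolev n p a b x ->
  0 < N -> (sobolev_norm n p a b x <= N%:E)%E -> sob n (C * N) x.
Proof.
have [C C1 H] := sob_of_lp n; exists C => // N x /sobolev_sob[M Mx] N0 xN.
apply: (H _ _ _ Mx) => j jn.
have bx : ae_borel a b (cderivn a b j x).
  exact/cintegrable_ae_borel/(sob_cintegrable p1 ab)/(sob_cderivn jn Mx).
apply: lpP => //.
have I0 k : (0 <= \int[mu]_(t in `[a, b]) (normc (cderivn a b k x t) `^ p)%:E)%E.
  by apply: integral_ge0 => t _; rewrite lee_fin powR_ge0.
have -> : ((N `^ p)%:E = N%:E `^ p)%E by rewrite poweR_EFin.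
have S0 : (0 <= \sum_(0 <= j < n.+1)
    \int[mu]_(t in `[a, b]) (normc (cderivn a b j x t) `^ p)%:E)%E.
  by apply: sume_ge0 => k _; exact: I0.
apply: (@le_trans _ _ (sobolev_norm n p a b x `^ p)%E); last first.
  apply: gt0_ler_poweR => //; first exact: ltW.
    by rewrite in_itv/= leey andbT poweR_ge0.
  by rewrite in_itv/= leey andbT lee_fin ltW.
rewrite /sobolev_norm -poweRrM mulVf ?gt_eqF// poweRe1//.
rewrite (bigD1_seq j) ?mem_index_iota ?iota_uniq//=.
by rewrite leeDl//; apply: sume_ge0 => k _; exact: I0.
Qed.

End sobolev_equivalence.

(** * Sequences with geometrically small increments *)

Section geometric_sequences.
Context {R : realType}.
Implicit Types (K e x y : R) (u : nat -> R).

Lemma geometric_small K e : 0 < e -> exists k : nat, K * 2^-1 ^+ k < e.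
Proof.
move=> e0; have h : `|2^-1 : R| < 1 by rewrite ger0_norm ?invr_ge0// invf_lt1// ltr1n.
have /cvgrPdist_lt/(_ _ e0)[k _ H] := cvg_geometric K h.
exists k; have := H k (leqnn k); rewrite sub0r normrN; apply: le_lt_trans.
exact: ler_norm.
Qed.

Lemma le_geometric K x y : (forall k : nat, x <= y + K * 2^-1 ^+ k) -> x <= y.
Proof.
move=> H; apply/ler_addgt0Pr => e /(geometric_small K)[k Hk].
by rewrite (le_trans (H k))// lerD2l ltW.
Qed.

(** The intervals of radius [2 * K * 2^-1 ^+ k] around [u k] are nested, so the supremum of their
    left ends lies in all of them; the rate of convergence comes for free. *)
Lemma geometric_limit K u : 0 <= K ->
  (forall k, `|u k.+1 - u k| <= K * 2^-1 ^+ k) ->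
  exists l, forall k, `|u k - l| <= 2 * K * 2^-1 ^+ k.
Proof.
move=> K0 Hu; pose r k := 2 * K * 2^-1 ^+ k.
have rS k : r k = r k.+1 + K * 2^-1 ^+ k by rewrite /r exprS; field.
have r0 k : 0 <= r k by rewrite mulr_ge0 ?exprn_ge0 ?mulr_ge0 ?invr_ge0.
have lo m k : u k - r k <= u (k + m)%N - r (k + m)%N.
  elim: m => [|m IH]; first by rewrite addn0.
  rewrite (le_trans IH)// addnS; have := Hu (k + m)%N.
  by rewrite rS ler_norml => /andP[? ?]; lra.
have up m k : u (k + m)%N + r (k + m)%N <= u k + r k.
  elim: m => [|m IH]; first by rewrite addn0.
  rewrite (le_trans _ IH)// addnS; have := Hu (k + m)%N.
  by rewrite [r (k + m)%N]rS ler_norml => /andP[? ?]; lra.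
have lu j k : u j - r j <= u k + r k.
  have h1 := lo k j; have h2 := up j k; have := r0 (j + k)%N.
  by rewrite addnC in h2; lra.
pose S := range (fun k => u k - r k).
have Sub k : ubound S (u k + r k) by move=> _ [j _ <-]; exact: lu.
have S0 : S !=set0 by exists (u 0%N - r 0%N); exists 0%N.
have supS : has_sup S by split => //; exists (u 0%N + r 0%N).
exists (sup S) => k; rewrite -/(r k) ler_norml.
have h1 : u k - r k <= sup S by apply: ub_le_sup supS.2 _ _; exists k.
have h2 : sup S <= u k + r k by apply: ge_sup.
by apply/andP; split; lra.
Qed.

End geometric_sequences.

(** * Exponential weights *)

Section exponential_weight.
Context {R : realType}.
Implicit Types (a b t u v x : R) (f : R -> R).

Lemma expR_increment x : 0 <= x -> x <= 16^-1 ->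
  1 + 8 * x <= expR (8 * x) <= 2.
Proof.
move=> x0 x16; have E1 : 1 + 8 * x <= expR (8 * x) by exact: expR_ge1Dx.
have E2 : 1 - 8 * x <= expR (- (8 * x)) by rewrite expR_ge1Dx.
have E3 : expR (8 * x) * expR (- (8 * x)) = 1 by rewrite expRxMexpNx_1.
rewrite E1/=; have y0 : 0 <= expR (8 * x) by exact: expR_ge0.
move: (expR (8 * x)) (expR (- (8 * x))) E1 E2 E3 y0 => y z E1 E2 E3 y0.
have h : 2^-1 <= z by lra.
by have := ler_wpM2l y0 h; rewrite E3 ler_pdivrMr// mul1r.
Qed.

(* The weight w = exp (8 int_a^t f) makes Volterra operators with kernel bounded
   by f contractions in the norm sup |u| / w. *)
Lemma exponential_weight a b f : a <= b -> ae_integrable a b f ->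
  (forall t, 0 <= f t) ->
  exists w : R -> R, [/\ bounded_borel a b w, w b = expR (8 * rint a b f),
    forall t, a <= t <= b -> 1 <= w t <= w b &
    forall t, a <= t <= b -> rint a t (fun s => f s * w s) <= w t / 4].
Proof.
move=> ab fi f0; pose L t := rint a t f.
have L_nd u v : a <= u -> u <= v -> v <= b -> L u <= L v.
  by move=> au uv vb; apply: (@rint_subset _ a b).
have La : L a = 0 by exact: rint_id.
have [w [wb w1 wE mw]] : exists w : R -> R, [/\ w b = expR (8 * rint a b f),
    w a = 1,
    forall u v, w v = w u * expR (8 * (L v - L u)) &
    bounded_borel a b (fun t => 8 * L t) -> bounded_borel a b w].
  exists (fun t => expR (8 * L t)); split => //.
  - by rewrite La mulr0 expR0.
  - by move=> u v; rewrite -expRD; congr expR; ring.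
  - move=> [mL [K LK]]; split.
      exact: (@measurableT_comp _ _ _ _ _ _ (@expR R)).
    exists (expR K) => t tab; rewrite ger0_norm ?expR_ge0// ler_expR.
    by rewrite (le_trans (ler_norm _))// LK.
have bL : bounded_borel a b (fun t => 8 * L t).
  by apply: bounded_borelM; [exact: bounded_borel_cst|exact: bounded_borel_rint].
have {mw bL} bw := mw bL.
have w_nd u v : a <= u -> u <= v -> v <= b -> 0 <= w u -> w u <= w v.
  move=> au uv vb wu; rewrite (wE u v) ler_peMr// -expR0 ler_expR mulr_ge0//.
  by rewrite subr_ge0 L_nd.
have w_ge1 t : a <= t <= b -> 1 <= w t.
  by move=> /andP[at_ tb]; rewrite -w1 w_nd// w1.
have wle t : a <= t <= b -> 1 <= w t <= w b.
  move=> /[dup] tab /andP[at_ tb]; rewrite w_ge1//=; apply: w_nd => //.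
  exact: le_trans (w_ge1 t tab).
(* An increment of [L] by at most 1/16 at most doubles the weight, while the weight grows by at
   least [8 * (L v - L u) * w u]; the quotient of 2 and 8 is the quarter in the conclusion. *)
have step u v : a <= u -> u <= v -> v <= b -> L v - L u <= 16^-1 ->
    (L v - L u) * w v <= (w v - w u) / 4.
  move=> au uv vb dL; have dL0 : 0 <= L v - L u by rewrite subr_ge0 L_nd.
  have wu : 1 <= w u by apply: w_ge1; rewrite au (le_trans uv).
  have /andP[] := expR_increment dL0 dL; rewrite (wE u v).
  move: (expR (8 * (L v - L u))) => y.
  move: (L v - L u) (w u) dL0 wu {dL} => x z x0 z1 y1 y2.
  have -> : (z * y - z) / 4 = z * ((y - 1) / 4) by ring.
  rewrite mulrCA ler_wpM2l ?(le_trans ler01)//.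
  have := ler_wpM2l x0 y2; lra.
exists w; split=> // t /andP[at_ tb].
have ifw := ae_integrableM fi bw.
have wa : (w t - w a) / 4 <= w t / 4 by rewrite w1; lra.
apply: le_trans wa.
have f_small := rint_small fi.
have LE u v : a <= u -> u <= v -> v <= b ->
    L v - L u = rint u v (fun s => `|f s|).
  move=> au uv vb; rewrite /L (@rint_cat _ a b a u v _ (lexx a) au uv vb fi).
  rewrite addrC addKr; apply: eq_rint => s _; rewrite ger0_norm//.
pose J u v := rint u v (fun s => f s * w s); rewrite -/(J a t).
have le_J u v : a <= u -> u <= v -> v <= b -> J u v <= (L v - L u) * w v.
  move=> au uv vb; rewrite /J LE// mulrC -(@rintZ _ a b)//; last first.
    exact: ae_integrable_norm.
  apply: (@le_rint _ a b) => //; first exact/ae_integrableZ/ae_integrable_norm.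
  move=> s /andP[us sv]; rewrite mulrC ger0_norm// ler_wpM2r//.
  have as_ := le_trans au us; have sb := le_trans sv vb.
  by apply: w_nd => //; rewrite (le_trans ler01)// w_ge1// as_.
have J_cat u v r : a <= u -> u <= v -> v <= r -> r <= b ->
    J u r = J u v + J v r.
  by move=> *; exact: (@rint_cat _ a b).
clearbody J.
apply: (@cousin _ (fun u v => J u v <= (w v - w u) / 4) a t at_).
  move=> u v r au uv vr rt Huv Hvr.
  rewrite (J_cat u v r au uv vr (le_trans rt tb)) (_ : (w r - w u) / 4 =
    (w v - w u) / 4 + (w r - w v) / 4); last by ring.
  exact: lerD Huv Hvr.
move=> r /andP[ar rt]; have [|d d0 H] := f_small 16^-1; first by rewrite invr_gt0.
exists (d / 2); first by rewrite divr_gt0.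
move=> u v au ur rv vt ru vr; have uv := le_trans ur rv; have vb := le_trans vt tb.
apply: (le_trans (le_J u v au uv vb)); apply: step => //.
by rewrite LE// ltW// H//; lra.
Qed.

End exponential_weight.

(** * Linear Volterra systems with integrable kernels *)

Section linear_volterra.
Context {R : realType}.
Variables (a b : R) (I : finType) (P : I -> I -> R -> R[i]).
Hypotheses (ab : a < b) (iP : forall i k, cintegrable a b (P i k)).
Implicit Types (G u v : I -> R -> R[i]) (t s K gamma : R).

Let ab' : a <= b. Proof. exact: ltW. Qed.

Definition volterra_solution G u := forall i t, a <= t <= b ->
  u i t = G i t + cint a t (fun s => \sum_k P i k s * u k s).

Definition coef_norm t : R := \sum_i \sum_k normc (P i k t).

Lemma coef_norm_ge0 t : 0 <= coef_norm t.
Proof. by apply: sumr_ge0 => i _; apply: sumr_ge0 => k _; exact: normc_ge0. Qed.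

Lemma coef_norm_integrable : ae_integrable a b coef_norm.
Proof.
apply: ae_integrable_sum => i; apply: ae_integrable_sum => k.
exact: cintegrable_normc.
Qed.

Let weightP := exponential_weight ab' coef_norm_integrable coef_norm_ge0.
Let weight := sval (cid weightP).

Let weight_bounded_borel : bounded_borel a b weight.
Proof. by rewrite /weight; case: cid => w []. Qed.

Let weight_b : weight b = expR (8 * rint a b coef_norm).
Proof. by rewrite /weight; case: cid => w []. Qed.

Let weight_bounds t : a <= t <= b -> 1 <= weight t <= weight b.
Proof. by rewrite /weight; case: cid => w [? ? H ?]; exact: H. Qed.

Let rint_weight t : a <= t <= b ->
  rint a t (fun s => coef_norm s * weight s) <= weight t / 4.
Proof. by rewrite /weight; case: cid => w [? ? ? H]; exact: H. Qed.

Let weight_ge1 t : a <= t <= b -> 1 <= weight t.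
Proof. by move=> /weight_bounds/andP[]. Qed.

Let weight_ge0 t : a <= t <= b -> 0 <= weight t.
Proof. by move=> /weight_ge1; exact: le_trans. Qed.

Let weight_le t : a <= t <= b -> weight t <= weight b.
Proof. by move=> /weight_bounds/andP[]. Qed.

Let ilw : ae_integrable a b (fun t => coef_norm t * weight t).
Proof. exact: ae_integrableM coef_norm_integrable weight_bounded_borel. Qed.

Let Pv v i : (forall k, cbounded_borel a b (v k)) ->
  cintegrable a b (fun s => \sum_k P i k s * v k s).
Proof.
move=> bv; apply: cintegrable_sum => k; exact: cintegrableM.
Qed.

(** The factor 2 of [normc_cint] times the quarter gained from the weight gives the contraction
    factor one half. *)
Let volterra_contract K v i t : 0 <= K ->
  (forall k, cbounded_borel a b (v k)) ->
  (forall k s, a <= s <= b -> normc (v k s) <= K * weight s) -> a <= t <= b ->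
  normc (cint a t (fun s => \sum_k P i k s * v k s)) <= K * weight t / 2.
Proof.
move=> K0 bv vK /[dup] tab /andP[at_ tb].
have iPv := Pv i bv; rewrite (le_trans (normc_cint _ _ iPv))//.
have -> : K * weight t / 2 = 2 * (K * (weight t / 4)) by field.
rewrite ler_pM2l// (le_trans _ (ler_wpM2l K0 (rint_weight tab)))//.
rewrite -(@rintZ _ a b)//; apply: (@le_rint _ a b) => //.
- exact: cintegrable_normc.
- exact: ae_integrableZ.
move=> s /andP[as_ st]; have sab : a <= s <= b by rewrite as_ (le_trans st).
rewrite (le_trans (normc_sum _ _ _))// mulrCA.
have W0 : 0 <= K * weight s by rewrite mulr_ge0// weight_ge0.
apply: (@le_trans _ _ ((\sum_k normc (P i k s)) * (K * weight s))).
  rewrite mulr_suml; apply: ler_sum => k _.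
  by rewrite normcM ler_wpM2l ?normc_ge0// vK.
rewrite ler_wpM2r// /coef_norm [leRHS](bigD1 i)//= lerDl.
by apply: sumr_ge0 => j _; apply: sumr_ge0 => k _; exact: normc_ge0.
Qed.

Let uniform_bound v : (forall k, cbounded_borel a b (v k)) ->
  exists2 K : R, 0 <= K & forall k t, a <= t <= b -> normc (v k t) <= K.
Proof.
move=> bv; have H k : {K : R | 0 < K /\
    forall t, a <= t <= b -> normc (v k t) <= K}.
  by apply: cid; have [K K0 HK] := cbounded_borelP (bv k); exists K.
exists (\sum_k sval (H k)).
  by apply: sumr_ge0 => k _; have [/ltW] := svalP (H k).
move=> k t tab; have [_ /(_ t tab)/le_trans] := svalP (H k); apply.
rewrite (bigD1 k)//= lerDl; apply: sumr_ge0 => j _.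
by have [/ltW] := svalP (H j).
Qed.

(** Starting from any bound [K] of [u], each use of the contraction halves the excess over
    [2 * gamma]. In the limit [K] disappears, and the constant depends on the kernel only through
    the integral of [coef_norm]. *)
Lemma volterra_bound gamma G u : 0 <= gamma ->
  (forall k, cbounded_borel a b (u k)) -> volterra_solution G u ->
  (forall i t, a <= t <= b -> normc (G i t) <= gamma) ->
  forall i t, a <= t <= b -> normc (u i t) <= 2 * gamma * expR (8 * rint a b coef_norm).
Proof.
move=> g0 bu uG Gg; have [K K0 uK] := uniform_bound bu.
have H n : forall i t, a <= t <= b ->
    normc (u i t) <= (2 * gamma + K * 2^-1 ^+ n) * weight t.
  elim: n => [|n IH] i t tab; have w1 := weight_ge1 tab.
    have w0 := le_trans ler01 w1.
    rewrite expr0 mulr1 (le_trans (uK i t tab))// (@le_trans _ _ (K * weight t))//.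
      by rewrite ler_peMr.
    by rewrite ler_wpM2r// lerDr mulr_ge0.
  have K'0 : 0 <= 2 * gamma + K * 2^-1 ^+ n.
    by rewrite addr_ge0 ?mulr_ge0 ?exprn_ge0 ?invr_ge0.
  rewrite uG// (le_trans (le_normcD _ _))//.
  rewrite (le_trans (lerD (Gg i t tab) (volterra_contract i K'0 bu IH tab)))//.
  rewrite exprS; set q := 2^-1 ^+ n.
  have := ler_wpM2l g0 w1; lra.
move=> i t tab; rewrite -weight_b (@le_trans _ _ (2 * gamma * weight t))//; last first.
  by rewrite ler_wpM2l ?weight_le// mulr_ge0.
apply: (@le_geometric _ (K * weight t)) => n.
by have := H n i t tab; rewrite mulrDl (mulrAC K).
Qed.

(** Picard iteration: in the weighted norm consecutive iterates differ by at most [K * 2^-1 ^+ n],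
    so they converge uniformly, and the limit is Borel as a pointwise limit. *)
Theorem volterra_exists G : (forall i, cbounded_borel a b (G i)) ->
  exists2 u, (forall i, cbounded_borel a b (u i)) & volterra_solution G u.
Proof.
move=> bG.
pose F u i t := G i t + cint a t (fun s => \sum_k P i k s * u k s).
pose U n := iter n F G.
have bU n i : cbounded_borel a b (U n i).
  elim: n i => [//|n IH] i; apply: cbounded_borelD => //.
  by apply: cbounded_borel_cint => //; exact: Pv.
have bB u v : (forall i, cbounded_borel a b (u i)) ->
    (forall i, cbounded_borel a b (v i)) ->
    forall i, cbounded_borel a b (fun t => u i t - v i t).
  by move=> bu bv i; exact: cbounded_borelB.
have FB u v i t : (forall i, cbounded_borel a b (u i)) ->
    (forall i, cbounded_borel a b (v i)) -> a <= t <= b ->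
    F u i t - F v i t = cint a t (fun s => \sum_k P i k s * (u k s - v k s)).
  move=> bu bv /andP[at_ tb]; rewrite /F.
  rewrite (_ : G i t + _ - _ = cint a t (fun s => \sum_k P i k s * u k s) -
     cint a t (fun s => \sum_k P i k s * v k s)); last by ring.
  rewrite -(@cintB _ a b)//; try exact: Pv.
  apply: eq_cint => s _; rewrite -sumrB; apply: eq_bigr => k _.
  by rewrite mulrBr.
have [K K0 UK] := uniform_bound (bB _ _ (bU 1%N) (bU 0%N)).
have dU n i t : a <= t <= b ->
    normc (U n.+1 i t - U n i t) <= K * 2^-1 ^+ n * weight t.
  elim: n i t => [|n IH] i t tab.
    by rewrite expr0 mulr1 (le_trans (UK i t tab))// ler_peMr// weight_ge1.
  rewrite (FB _ _ i t (bU n.+1) (bU n) tab : U n.+2 i t - U n.+1 i t = _).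
  have Kn : 0 <= K * 2^-1 ^+ n by rewrite mulr_ge0 ?exprn_ge0 ?invr_ge0.
  have := volterra_contract i Kn (bB _ _ (bU n.+1) (bU n)) IH tab.
  by move/le_trans; apply; rewrite exprS; lra.
pose C := K * weight b.
have C0 : 0 <= C by rewrite mulr_ge0// weight_ge0// lexx ab'.
have dUC n i t : a <= t <= b -> normc (U n.+1 i t - U n i t) <= C * 2^-1 ^+ n.
  move=> tab; rewrite (le_trans (dU n i t tab))// mulrAC ler_wpM2r//.
  by rewrite ler_wpM2l ?weight_le.
(* The condition on [t] sits inside the existential, so that the choice of limits gives a total
   function; outside the interval its value is a default. *)
have lim i t : exists l : R[i], a <= t <= b -> forall n,
    `|complex.Re (U n i t) - complex.Re l| <= 2 * C * 2^-1 ^+ n /\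
    `|complex.Im (U n i t) - complex.Im l| <= 2 * C * 2^-1 ^+ n.
  have [tab|] := boolP (a <= t <= b); last by exists 0.
  have [r Hr] : exists r, forall n,
      `|complex.Re (U n i t) - r| <= 2 * C * 2^-1 ^+ n.
    apply: (geometric_limit C0) => n.
    by rewrite (le_trans _ (dUC n i t tab))// -Re_opp -Re_add normc_Re.
  have [j Hj] : exists r, forall n,
      `|complex.Im (U n i t) - r| <= 2 * C * 2^-1 ^+ n.
    apply: (geometric_limit C0) => n.
    by rewrite (le_trans _ (dUC n i t tab))// -Im_opp -Im_add normc_Im.
  by exists (r +i* j).
pose u i t := sval (cid (lim i t)).
have Hu i t : a <= t <= b -> forall n,
    `|complex.Re (U n i t) - complex.Re (u i t)| <= 2 * C * 2^-1 ^+ n /\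
    `|complex.Im (U n i t) - complex.Im (u i t)| <= 2 * C * 2^-1 ^+ n.
  exact: (svalP (cid (lim i t))).
have Un n i t : a <= t <= b -> normc (U n i t - u i t) <= 4 * C * 2^-1 ^+ n.
  move=> tab; have [h1 h2] := Hu i t tab n.
  rewrite (le_trans (le_normc_ReIm _))// Re_add Im_add Re_opp Im_opp.
  by rewrite (le_trans (lerD h1 h2))//; lra.
have cvg_of (h : R -> R) (hn : nat -> R -> R) :
    (forall n, bounded_borel a b (hn n)) ->
    (forall t, a <= t <= b -> forall n, `|hn n t - h t| <= 2 * C * 2^-1 ^+ n) ->
    bounded_borel a b h.
  move=> bh Hh; have [_ [M HM]] := bh 0%N; split.
    apply: (@measurable_fun_cvg _ _ _ `[a, b]%classic (fun n => hn n) h) => //.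
      by move=> n; have [] := bh n.
    move=> t /=; rewrite in_itv/= => tab; apply/cvgrPdist_lt => e e0.
    have h2 : `|2^-1 : R| < 1.
      by rewrite ger0_norm ?invr_ge0// invf_lt1// ltr1n.
    have /cvgrPdist_lt/(_ _ e0)[k _ Hk] := cvg_geometric (2 * C) h2.
    exists k => // n /= kn; have := Hk n kn; rewrite sub0r normrN.
    apply: le_lt_trans; rewrite distrC (le_trans (Hh t tab n))//.
    exact: ler_norm.
  exists (M + 2 * C) => t tab; have := Hh t tab 0%N; rewrite expr0 mulr1 => h0.
  rewrite -[h t](subrK (hn 0%N t)) addrC (le_trans (ler_normD _ _))// lerD//.
    exact: HM.
  by rewrite distrC.
have bu i : cbounded_borel a b (u i).
  split.
    apply: (cvg_of _ (fun n t => complex.Re (U n i t))).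
      by move=> n; have [] := bU n i.
    by move=> t tab n; have [] := Hu i t tab n.
  apply: (cvg_of _ (fun n t => complex.Im (U n i t))).
    by move=> n; have [] := bU n i.
  by move=> t tab n; have [] := Hu i t tab n.
exists u => // i t tab; apply/eqP; rewrite -subr_eq0 -normc_eq0 eq_le normc_ge0 andbT.
(* Both [u] and [F u] are compared with iterate [n.+1]. The distance to [u] gives the summand
   [2 * C]; the contraction applied to [u] minus iterate [n] gives the one with the weight. *)
apply: (@le_geometric _ (2 * C + 2 * C * weight t)) => n; rewrite add0r.
rewrite -/(F u i t) normcB.
rewrite (le_trans (le_normcDl _ (U n.+1 i t) _))//.
have h1 := Un n.+1 i t tab.
have Cn : 0 <= 4 * C * 2^-1 ^+ n.
  by apply: mulr_ge0; [apply: mulr_ge0|apply: exprn_ge0; rewrite invr_ge0].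
have h2 : normc (F u i t - U n.+1 i t) <= 4 * C * 2^-1 ^+ n * weight t / 2.
  rewrite (FB _ _ i t bu (bU n) tab : F u i t - U n.+1 i t = _).
  apply: (volterra_contract i Cn (bB _ _ bu (bU n))) => // k s sab.
  rewrite normcB (le_trans (Un n k s sab))// ler_peMr//.
  exact: weight_ge1.
rewrite (le_trans (lerD h2 h1))// exprS.
set q := 2^-1 ^+ n; lra.
Qed.

End linear_volterra.

(** * Linear differential systems of order q+1 *)

Section linear_systems.
Context {R : realType}.
Variables p a b : R.
Hypotheses (p1 : 1 <= p) (ab : a < b).
Variables q m : nat.
Local Notation D := (cderiv a b).
Local Notation sob := (sob p a b).
Implicit Types (t s M N K C : R) (n l : nat) (i k : 'I_m).
Implicit Types (A : nat -> 'I_m -> 'I_m -> R -> R[i]).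
Implicit Types (x y : R -> R[i]) (h z : 'I_m -> R -> R[i]) (U : 'I_m -> nat -> R -> R[i]).

Let ab' : a <= b. Proof. exact: ltW. Qed.
Let aab : a <= a <= b. Proof. by rewrite lexx ab'. Qed.

Lemma sob_sum (J : finType) n : exists2 C, 1 <= C &
  forall M (F : J -> R -> R[i]), 0 < M -> (forall j, sob n M (F j)) ->
  sob n (C * M) (fun t => \sum_j F j t).
Proof.
suff [C C1 H] : exists2 C, 1 <= C & forall M (F : J -> R -> R[i]), 0 < M ->
    (forall j, sob n M (F j)) -> sob n (C * M) (fun t => \sum_(j <- enum J) F j t).
  exists C => // M F M0 FM; have := H M F M0 FM; apply: sob_cong => //.
  by apply: sob_eqW => t _; rewrite big_enum.
elim: (enum J) => [|j s [C C1 H]].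
  exists 1 => // M F M0 _; rewrite mul1r.
  apply: (sob_cong ab _ (sob0 p1 ab n M0)).
  by apply: sob_eqW => t _; rewrite big_nil.
exists (4 * (1 + C)); first by lra.
move=> M F M0 FM; have := sobD p1 ab (FM j) (H M F M0 FM).
rewrite -[M in M + _]mul1r -mulrDl mulrA; apply: (sob_cong ab).
by apply: sob_eqW => t _; rewrite big_cons.
Qed.

Definition rhs A h U i s : R[i] :=
  h i s - \sum_(l < q.+1) \sum_k A l i k s * U k l s.

(* U i l stands for the l-th derivative of the i-th unknown. *)
Definition tower A h U := forall i,
  (forall l, (l < q)%N -> primitive_of a b (U i l) (U i l.+1)) /\
  primitive_of a b (U i q) (rhs A h U i).

(** The equation of order [q.+1] integrated once. The highest derivative does not appear, and the
    meaning is the same for [n = 0] and [n > 0]. *)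
Definition ode A h z := forall i, primitive_of a b (cderivn a b q (z i))
  (rhs A h (fun k l => cderivn a b l (z k)) i).

Local Notation I := ('I_q.+1 * 'I_m)%type.

(** The block companion matrix of the equivalent first-order system, with unknowns indexed by order
    of derivative and component. *)
Definition system_mx A (x y : I) s : R[i] :=
  if (x.1.+1 < q.+1)%N then ((nat_of_ord y.1 == x.1.+1) && (y.2 == x.2))%:R
  else - A y.1 x.2 y.2 s.

Definition system_rhs h (c : I -> R[i]) (x : I) t : R[i] :=
  c x + (if (x.1.+1 < q.+1)%N then 0 else cint a t (h x.2)).

Lemma system_mxE A U (x : I) s :
  \sum_(y : I) system_mx A x y s * U y.2 y.1 s =
  if (x.1.+1 < q.+1)%N then U x.2 x.1.+1 s
  else - \sum_(l < q.+1) \sum_k A l x.2 k s * U k l s.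
Proof.
case: ifPn => xq.
  rewrite (bigD1 (Ordinal xq, x.2))//= big1 ?addr0; last first.
    move=> [l k] /= lk; rewrite /system_mx xq/=.
    case: eqP => [lx|]; last by rewrite mul0r.
    case: eqP => [kx|]; last by rewrite mul0r.
    by move/negP: lk; case; rewrite kx; apply/eqP; congr pair; apply: val_inj.
  by rewrite /system_mx xq/= !eqxx mul1r.
rewrite pair_bigA/= -sumrN; apply: eq_bigr => y _.
by rewrite /system_mx (negbTE xq) mulNr.
Qed.

Section coefficients.
Variables (n : nat) (MA : R) (A : nat -> 'I_m -> 'I_m -> R -> R[i]).
Hypothesis sA : forall l i k, (l < q.+1)%N -> sob n MA (A l i k).

Lemma system_mx_integrable (x y : I) : cintegrable a b (system_mx A x y).
Proof.
rewrite /system_mx; case: (x.1.+1 < q.+1)%N.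
  exact/cbounded_borel_cintegrable/cbounded_borel_cst.
by apply: cintegrableN; apply: (sob_cintegrable p1 ab (sA _ _ (ltn_ord _))).
Qed.

Lemma sum_integrable U i : (forall k l, (l <= q)%N -> cbounded_borel a b (U k l)) ->
  cintegrable a b (fun s => \sum_(l < q.+1) \sum_k A l i k s * U k l s).
Proof.
move=> bU; apply: cintegrable_sum => l; apply: cintegrable_sum => k.
apply: cintegrableM; first exact: (sob_cintegrable p1 ab (sA _ _ (ltn_ord l))).
by apply: bU; rewrite -ltnS.
Qed.

Lemma rhs_integrable h U i N : sob n N (h i) ->
  (forall k l, (l <= q)%N -> cbounded_borel a b (U k l)) ->
  cintegrable a b (rhs A h U i).
Proof.
move=> sh bU; apply: cintegrableB; first exact: (sob_cintegrable p1 ab sh).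
exact: sum_integrable.
Qed.

Lemma tower_volterra h N U : (forall i, sob n N (h i)) ->
  (forall k l, (l <= q)%N -> cbounded_borel a b (U k l)) ->
  tower A h U <-> volterra_solution a b (system_mx A)
    (system_rhs h (fun x : I => U x.2 x.1 a)) (fun x : I => U x.2 x.1).
Proof.
move=> sh bU.
have E (x : I) t : a <= t <= b -> ~~ (x.1.+1 < q.+1)%N ->
   cint a t (rhs A h U x.2) = cint a t (h x.2) +
   cint a t (fun s => \sum_(y : I) system_mx A x y s * U y.2 y.1 s).
  move=> /andP[at_ tb] xq; rewrite /rhs (@cintD _ a b)//; last 2 first.
  - exact: (sob_cintegrable p1 ab (sh _)).
  - by apply: cintegrableN; exact: sum_integrable.
  congr (_ + _); apply: eq_cint => s _.
  by rewrite (system_mxE A U) (negbTE xq).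
split=> [T [l i] t tab|T i].
  have [T1 T2] := T i; rewrite /system_rhs/=; case: ifPn => lq.
    rewrite addr0 (T1 l lq t tab); congr (_ + _); apply: eq_cint => s _.
    by rewrite (system_mxE A U (l, i)) lq.
  have -> : l = ord_max.
    by apply/val_inj/eqP; rewrite eqn_leq -ltnS ltn_ord/= leqNgt -ltnS.
  by rewrite (T2 t tab) (E (ord_max, i))//= ?ltnn// addrA.
split=> [l lq t tab|t tab].
  have lq' : (l < q.+1)%N by exact: ltnW.
  have := T (Ordinal lq', i) t tab; rewrite /system_rhs/= ltnS lq addr0 => ->.
  congr (_ + _); apply: eq_cint => s _.
  by rewrite (system_mxE A U (Ordinal lq', i))/= ltnS lq.
have := T (ord_max, i) t tab; rewrite /system_rhs/= ltnn => ->.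
by rewrite (E (ord_max, i))//= ?ltnn// addrA.
Qed.

End coefficients.

(** The constant is fixed before [A], [h] and [U] and knows the coefficients only through the radius
    [MA], which makes it uniform along the perturbation. *)
Lemma tower_sup n MA : 0 < MA -> exists2 C, 1 <= C & forall A h U M,
  (forall l i k, (l < q.+1)%N -> sob n MA (A l i k)) ->
  (forall i, sob n M (h i)) ->
  (forall k l, (l <= q)%N -> cbounded_borel a b (U k l)) -> tower A h U ->
  (forall k l, (l <= q)%N -> normc (U k l a) <= M) ->
  forall k l t, (l <= q)%N -> a <= t <= b -> normc (U k l t) <= C * M.
Proof.
move=> MA0; have [c c0 Hc] := sob_rint p1 ab n.
(* An upper bound for the integral of [coef_norm]: an entry of the companion matrix is a constant 0
   or 1, with integral at most [b - a], or a coefficient, with integral at most [c * MA]. *)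
pose J : R := \sum_(x : I) \sum_(y : I) ((b - a) + c * MA).
exists (2 * (1 + 2 * c) * expR (8 * J)).
  have J0 : 0 <= J.
    apply: sumr_ge0 => x _; apply: sumr_ge0 => y _.
    by rewrite addr_ge0 ?subr_ge0// mulr_ge0 ?ltW.
  have : 1 <= expR (8 * J) by rewrite -expR0 ler_expR mulr_ge0.
  move: (expR _) => e e1; rewrite mulr_ege1//; lra.
move=> A h U M sA sh bU T Ua k l t lq tab.
have M0 : 0 < M by exact: sob_gt0 (sh k).
have [TV _] := tower_volterra sA sh bU; have {TV}V := TV T.
have iP := system_mx_integrable sA.
have lq' : (l < q.+1)%N by rewrite ltnS.
have M20 : 0 <= M + 2 * (c * M) by rewrite addr_ge0 ?mulr_ge0 ?ltW.
have bUI (x : I) : cbounded_borel a b (U x.2 x.1) by apply: bU; rewrite -ltnS.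
have Gb (x : I) s : a <= s <= b ->
    normc (system_rhs h (fun x : I => U x.2 x.1 a) x s) <= M + 2 * (c * M).
  move=> sab; rewrite /system_rhs (le_trans (le_normcD _ _))//.
  rewrite lerD//; first by rewrite Ua// -ltnS.
  case: ifPn => _; first by rewrite normc0 !mulr_ge0 ?ltW.
  have ih := sob_cintegrable p1 ab (sh x.2).
  by rewrite (le_trans (normc_cint_le sab ih))// ler_pM2l//; exact: (Hc _ _ (sh x.2)).
have := volterra_bound ab iP M20 bUI V Gb (Ordinal lq', k) tab => /=.
move/le_trans; apply.
have -> : 2 * (1 + 2 * c) * expR (8 * J) * M = 2 * (M + 2 * (c * M)) * expR (8 * J).
  by ring.
rewrite ler_wpM2l//; first by rewrite mulr_ge0.
rewrite ler_expR ler_pM2l// /coef_norm.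
have iN (x y : I) : ae_integrable a b (fun s => normc (system_mx A x y s)).
  by apply: cintegrable_normc; exact: iP.
rewrite (@rint_sum _ a b)//; last by move=> x; exact: ae_integrable_sum.
apply: ler_sum => x _; rewrite (@rint_sum _ a b)//.
apply: ler_sum => y _; rewrite /system_mx; case: (x.1.+1 < q.+1)%N.
  rewrite rint_cst// (@le_trans _ _ (b - a))//; last first.
    by rewrite lerDl mulr_ge0 ?(ltW c0) ?(ltW MA0).
  rewrite ler_piMl ?subr_ge0//.
  by case: (_ && _); rewrite ?normc1 ?normc0.
rewrite ler_wpDl ?subr_ge0// (le_trans _ (Hc _ _ (sA y.1 x.2 y.2 (ltn_ord _))))//.
by rewrite le_eqVlt; apply/orP; left; apply/eqP; apply: eq_rint => s _; rewrite normcN.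
Qed.

(** Regularity of the top member is integrated down the chain. Since that member has order at least
    1, the derivatives exist at every point and coincide there with the members of the chain. *)
Lemma sob_tower (V : nat -> R -> R[i]) q' n M :
  (forall l, (l < q')%N -> primitive_of a b (V l) (V l.+1)) ->
  (forall l, (l < q')%N -> normc (V l a) <= M) -> sob n.+1 M (V q') ->
  sob (q' + n.+1) M (V 0%N) /\
  forall l t, (l <= q')%N -> a <= t <= b -> cderivn a b l (V 0%N) t = V l t.
Proof.
elim: q' V => [V _ _ sV|q' IH V pV Va sV]; first by split => // -[|//].
have [S1 S2] := IH (fun l => V l.+1) (fun l => pV l.+1) (fun l => Va l.+1) sV.
have pV0 := pV 0%N (ltn0Sn _).
split; first by rewrite addSn; exact: (sobS p1 ab (Va 0%N (ltn0Sn _)) S1 pV0).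
move=> [//|l] t lq tab; rewrite cderivnSr -(S2 l t)//.
apply: eq_cderivn => // s sab.
by have := primitive_cderiv p1 ab S1 pV0; rewrite addnS; exact.
Qed.

Lemma sob_cderivn_down n : exists2 f, 1 <= f & forall l M x, (l <= q)%N ->
  sob (q.+1 + n) M x -> sob n.+1 (f * M) (cderivn a b l x).
Proof.
have G l : {f : R | 1 <= f /\ forall M x, (l <= q)%N ->
    sob (q.+1 + n) M x -> sob n.+1 (f * M) (cderivn a b l x)}.
  apply: cid; have [lq|lq] := leqP l q; last first.
    by exists 1; split=> [|M x lq']; [exact: lexx|discriminate lq'].
  have nl : (n.+1 <= q.+1 + n - l)%N.
    by rewrite -addnBAC ?(leq_trans lq)// subSn// addSn ltnS leq_addl.
  have [f f1 Hf] := sob_leq p1 ab nl; exists f; split; first exact: f1.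
  move=> M x _ sx; apply/Hf/sob_cderivn; last exact: sx.
  by rewrite (leq_trans lq)// (leq_trans (leqnSn q))// leq_addr.
have g1 l := (svalP (G l)).1.
have g0 l : 0 <= sval (G l) by exact: le_trans (g1 l).
exists (\sum_(l < q.+1) sval (G l)).
  by rewrite (bigD1 ord0)//= (le_trans (g1 0%N))// lerDl; apply: sumr_ge0.
move=> l M x lq sx; have M0 := sob_gt0 sx.
apply: (sob_le p1 _ ((svalP (G l)).2 M x lq sx)).
rewrite ler_wpM2r ?(ltW M0)//; have lq' : (l < q.+1)%N by rewrite ltnS.
by rewrite (bigD1 (Ordinal lq'))//= lerDl; apply: sumr_ge0.
Qed.

(** Bootstrap on [n]. If the lower derivatives are bounded, the right-hand side is in L_p. Once the
    case [n] has placed them in W^(n+1)_p, their products with coefficients stay there because this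
    space is an algebra, and the top member gains one order by integration. *)
Lemma tower_regularity n MA : 0 < MA -> exists2 C, 1 <= C & forall A h U M,
  (forall l i k, (l < q.+1)%N -> sob n MA (A l i k)) ->
  (forall i, sob n M (h i)) ->
  (forall k l, (l <= q)%N -> cbounded_borel a b (U k l)) -> tower A h U ->
  (forall k l t, (l <= q)%N -> a <= t <= b -> normc (U k l t) <= M) ->
  forall i, sob (q.+1 + n) (C * M) (U i 0%N) /\
    forall l t, (l <= q)%N -> a <= t <= b -> cderivn a b l (U i 0%N) t = U i l t.
Proof.
elim: n MA => [|n IH] MA MA0.
  have [c1 c11 H1] := sob_sum 'I_m 0; have [c2 c21 H2] := sob_sum 'I_q.+1 0.
  pose C := 8 * (1 + c2 * (c1 * MA)).
  have C1 : 1 <= C.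
    have : 0 <= c2 * (c1 * MA).
      by rewrite mulr_ge0 ?mulr_ge0 ?(ltW MA0) ?(le_trans ler01 c11)
        ?(le_trans ler01 c21).
    by rewrite /C; lra.
  exists C => // A h U M sA sh bU T UM i; have M0 := sob_gt0 (sh i).
  have CM : M <= C * M by rewrite ler_peMl// ltW.
  have [T1 T2] := T i.
  have sR : sob 0 (C * M) (rhs A h U i).
    have := sobB p1 ab (sh i) (H2 (c1 * (MA * M)) _ _ _).
    have -> : 8 * (M + c2 * (c1 * (MA * M))) = C * M by rewrite /C; ring.
    apply; first by rewrite !mulr_gt0// (lt_le_trans ltr01).
    move=> l; apply: H1 => [|k]; first by rewrite mulr_gt0.
    have lq : (l <= q)%N by rewrite -ltnS.
    rewrite mulrC; apply: (lp_dom p1 M0 _ _ (sA l i k (ltn_ord l))).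
      apply: ae_borelM.
        exact/cintegrable_ae_borel/(sob_cintegrable p1 ab (sA l i k (ltn_ord l))).
      exact/cbounded_ae_borel/bU.
    by move=> t tab; rewrite normcM mulrC ler_wpM2r ?normc_ge0// UM.
  have Ua l : (l <= q)%N -> normc (U i l a) <= C * M.
    by move=> lq; rewrite (le_trans _ CM)// UM.
  have sq : sob 1 (C * M) (U i q) by exact: (sobS p1 ab (Ua q (leqnn _)) sR T2).
  have [S1 S2] := sob_tower T1 (fun l lq => Ua l (ltnW lq)) sq.
  by split; [rewrite addn0 -addn1|exact: S2].
(* The induction hypothesis lives one order lower, so coefficients and data first pass to balls
   enlarged by [e]; hence the product [c0 * e] in [K]. *)
have [e e1 He] := sob_down p1 ab n.
have MA'0 : 0 < e * MA by rewrite mulr_gt0// (lt_le_trans ltr01).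
have [c0 c01 H0] := IH _ MA'0.
have [c1 c11 H1] := sob_sum 'I_m n.+1; have [c2 c21 H2] := sob_sum 'I_q.+1 n.+1.
have [c3 c31 H3] := sobM p1 ab n.
have [f f1 Hf] := sob_cderivn_down n.
pose K := c3 * (MA * (f * (c0 * e))).
have K0 : 0 <= K.
  by rewrite !mulr_ge0 ?(ltW MA0) ?(le_trans ler01 c31) ?(le_trans ler01 f1)
    ?(le_trans ler01 c01) ?(le_trans ler01 e1).
pose C := 8 * (1 + c2 * (c1 * K)).
have C1 : 1 <= C.
  have : 0 <= c2 * (c1 * K).
    apply: mulr_ge0; first exact: le_trans ler01 c21.
    by apply: mulr_ge0 K0; exact: le_trans ler01 c11.
  by rewrite /C; lra.
have e0 : 0 <= e by exact: le_trans ler01 e1.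
exists C => // A h U M sA sh bU T UM.
have SU i : sob (q.+1 + n) (c0 * (e * M)) (U i 0%N) /\
    forall l t, (l <= q)%N -> a <= t <= b -> cderivn a b l (U i 0%N) t = U i l t.
  have M0 := sob_gt0 (sh i).
  apply: (H0 A h U (e * M)) => //.
  - by move=> l j k lq; exact/He/sA.
  - by move=> j; exact: He.
  - by move=> k l t lq tab; rewrite (le_trans (UM k l t lq tab))// ler_peMl// ltW.
have SUl i l : (l <= q)%N -> sob n.+1 (f * (c0 * (e * M))) (U i l).
  move=> lq; have [S1 S2] := SU i; apply: (sob_cong ab _ (Hf l _ _ lq S1)) => t tab.
  exact: S2.
move=> i; have M0 := sob_gt0 (sh i).
have CM : M <= C * M by rewrite ler_peMl// ltW.
have [T1 T2] := T i.
have KM : 0 < K * M.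
  by rewrite !mulr_gt0 ?(lt_le_trans ltr01 c31) ?(lt_le_trans ltr01 f1)
    ?(lt_le_trans ltr01 c01) ?(lt_le_trans ltr01 e1).
have sR : sob n.+1 (C * M) (rhs A h U i).
  have := sobB p1 ab (sh i) (H2 (c1 * (K * M)) _ _ _).
  have -> : 8 * (M + c2 * (c1 * (K * M))) = C * M by rewrite /C; ring.
  apply; first by rewrite mulr_gt0// (lt_le_trans ltr01 c11).
  move=> l; apply: H1 => [//|k]; have lq : (l <= q)%N by rewrite -ltnS.
  have -> : K * M = c3 * (MA * (f * (c0 * (e * M)))) by rewrite /K; ring.
  by apply: H3; [exact: sA|exact: SUl].
have Ua l : (l <= q)%N -> normc (U i l a) <= C * M.
  by move=> lq; rewrite (le_trans _ CM)// UM.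
have sq : sob n.+2 (C * M) (U i q) by exact: (sobS p1 ab (Ua q (leqnn _)) sR T2).
have [S1 S2] := sob_tower T1 (fun l lq => Ua l (ltnW lq)) sq.
by split; [rewrite addSnnS|exact: S2].
Qed.

Lemma sob_primitive_cderivn (N l : nat) M x : (l < N)%N -> sob N M x ->
  primitive_of a b (cderivn a b l x) (cderivn a b l.+1 x).
Proof.
move=> lN sx; have := sob_cderivn (ltnW lN) sx.
by rewrite -subnSK// => /sobSP[].
Qed.

Lemma sob_cbounded_cderivn (N l : nat) M x : (l < N)%N -> sob N M x ->
  cbounded_borel a b (cderivn a b l x).
Proof.
move=> lN sx; have := sob_cderivn (ltnW lN) sx.
by rewrite -subnSK//; exact: sob_cbounded.
Qed.

Theorem ode_apriori n MA : 0 < MA -> exists2 C, 1 <= C & forall A h z M,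
  (forall l i k, (l < q.+1)%N -> sob n MA (A l i k)) ->
  (forall i, sob n M (h i)) -> (forall i, exists N, sob (q.+1 + n) N (z i)) ->
  ode A h z -> (forall i l, (l <= q)%N -> normc (cderivn a b l (z i) a) <= M) ->
  forall i, sob (q.+1 + n) (C * M) (z i).
Proof.
move=> MA0; have [c1 c11 H1] := tower_sup n MA0.
have [c2 c21 H2] := tower_regularity n MA0.
exists (c2 * c1); first by rewrite mulr_ege1.
move=> A h z M sA sh sz E za i; have M0 := sob_gt0 (sh i).
have bz k l : (l <= q)%N -> cbounded_borel a b (cderivn a b l (z k)).
  move=> lq; have [N sN] := sz k; apply: (sob_cbounded_cderivn _ sN).
  by rewrite addSn ltnS (leq_trans lq)// leq_addr.
have T : tower A h (fun i l => cderivn a b l (z i)).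
  move=> k; split; last exact: E.
  move=> l lq; have [N sN] := sz k; apply: (sob_primitive_cderivn _ sN).
  by rewrite addSn ltnS (leq_trans (ltnW lq))// leq_addr.
have M1 : M <= c1 * M by rewrite ler_peMl// ltW.
have sh' j : sob n (c1 * M) (h j) by exact: (sob_le p1 M1 (sh j)).
have [] := H2 A h _ (c1 * M) sA sh' bz T (H1 A h _ M sA sh bz T za) i.
by rewrite mulrA.
Qed.

(** The Volterra system provides a solution that is merely bounded and Borel; [tower_regularity]
    then places it in the Sobolev space. *)
Theorem cauchy_problem n MA A h N (c : 'I_m -> nat -> R[i]) :
  (forall l i k, (l < q.+1)%N -> sob n MA (A l i k)) ->
  (forall i, sob n N (h i)) -> exists z,
  [/\ forall i, exists M, sob (q.+1 + n) M (z i), ode A h z &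
      forall i l, (l <= q)%N -> cderivn a b l (z i) a = c i l].
Proof.
move=> sA sh; have iP := system_mx_integrable sA.
have bG (x : I) : cbounded_borel a b (system_rhs h (fun x : I => c x.2 x.1) x).
  apply: cbounded_borelD; first exact: cbounded_borel_cst.
  case: (x.1.+1 < q.+1)%N; first exact: cbounded_borel_cst.
  by apply: cbounded_borel_cint => //; exact: (sob_cintegrable p1 ab (sh _)).
have [u bu V] := volterra_exists ab iP bG.
(* For [l > q] the index [inord l] is a default; [tower] consults only orders up to [q]. *)
pose U i l := u (inord l, i).
have UE : (fun x : I => U x.2 x.1) = u.
  by apply/funext => -[l i]; rewrite /U/= inord_val.
have Ua (x : I) : U x.2 x.1 a = c x.2 x.1.
  rewrite -[LHS]/((fun x : I => U x.2 x.1) x a) UE V// cint_id addr0.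
  by rewrite /system_rhs; case: ifPn => _; rewrite ?cint_id addr0.
have bU k l : (l <= q)%N -> cbounded_borel a b (U k l) by move=> _; exact: bu.
have T : tower A h U.
  apply/(tower_volterra sA sh bU); rewrite UE.
  by rewrite (_ : (fun x : I => U x.2 x.1 a) = (fun x : I => c x.2 x.1))//;
    apply/funext => x; exact: Ua.
have [K K0 HK] : exists2 K, 0 < K & forall k l t, (l <= q)%N -> a <= t <= b ->
    normc (U k l t) <= K.
  have Hx (x : I) : {K : R | 0 < K /\ forall t, a <= t <= b -> normc (u x t) <= K}.
    by apply: cid; have [K K0 HK] := cbounded_borelP (bu x); exists K.
  exists (1 + \sum_x sval (Hx x)).
    by rewrite ltr_pwDl// sumr_ge0// => x _; have [/ltW] := svalP (Hx x).
  move=> k l t _ tab; rewrite /U; set x := (_, _).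
  have [_ /(_ t tab)/le_trans] := svalP (Hx x); apply.
  rewrite ler_wpDl// (bigD1 x)//= lerDl; apply: sumr_ge0 => y _.
  by have [/ltW] := svalP (Hx y).
have MA1 : 0 < `|MA| + 1 by rewrite ltr_wpDl.
have sA' l i k : (l < q.+1)%N -> sob n (`|MA| + 1) (A l i k).
  by move=> lq; apply: (sob_le p1 _ (sA l i k lq)); rewrite ler_wpDr// ler_norm.
have [C C1 H] := tower_regularity n MA1.
have sh' i : sob n (Num.max N K) (h i).
  by apply: (sob_le p1 _ (sh i)); rewrite le_max lexx.
have HK' k l t : (l <= q)%N -> a <= t <= b -> normc (U k l t) <= Num.max N K.
  by move=> lq tab; rewrite (le_trans (HK k l t lq tab))// le_max lexx orbT.
have S := H A h U _ sA' sh' bU T HK'.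
exists (fun i => U i 0%N); split.
- by move=> i; have [S1 _] := S i; exists (C * Num.max N K).
- move=> i t tab; have [T1 T2] := T i; have [_ S2] := S i.
  rewrite !S2// (T2 t tab); congr (_ + _); apply: eq_cint => s /andP[as_ st].
  have sab : a <= s <= b by rewrite as_ (le_trans st)//; case/andP: tab.
  rewrite /rhs; congr (_ - _); apply: eq_bigr => l _; apply: eq_bigr => k _.
  by have [_ ->] := S k; rewrite // -ltnS.
- move=> i l lq; have [_ ->] := S i => //.
  by have := Ua (inord l, i); rewrite /= inordK.
Qed.

End linear_systems.

(** * The entrywise norm of matrices *)

Section matrix_norm.
Context {R : realType}.
Implicit Types (d e m : nat).

Lemma mxnorm1_ge0 d e (M : 'M[R[i]]_(d, e)) : 0 <= mxnorm1 M.
Proof. by apply: sumr_ge0 => i _; apply: sumr_ge0 => j _; exact: normc_ge0. Qed.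

Lemma mxnorm1_entry d e (M : 'M[R[i]]_(d, e)) i j : normc (M i j) <= mxnorm1 M.
Proof.
rewrite /mxnorm1 (bigD1 i)//= (bigD1 j)//= -addrA lerDl addr_ge0//.
  by apply: sumr_ge0 => k _; exact: normc_ge0.
by apply: sumr_ge0 => k _; apply: sumr_ge0 => l _; exact: normc_ge0.
Qed.

Lemma mxnorm10 d e : mxnorm1 (0 : 'M[R[i]]_(d, e)) = 0.
Proof.
by rewrite /mxnorm1 big1// => i _; rewrite big1// => j _; rewrite mxE normc0.
Qed.

Lemma mxnorm1D d e (M N : 'M[R[i]]_(d, e)) :
  mxnorm1 (M + N) <= mxnorm1 M + mxnorm1 N.
Proof.
rewrite /mxnorm1 -big_split/=; apply: ler_sum => i _.
rewrite -big_split/=; apply: ler_sum => j _; rewrite mxE; exact: le_normcD.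
Qed.

Lemma mxnorm1N d e (M : 'M[R[i]]_(d, e)) : mxnorm1 (- M) = mxnorm1 M.
Proof.
by apply: eq_bigr => i _; apply: eq_bigr => j _; rewrite mxE normcN.
Qed.

Lemma mxnorm1B d e (M N : 'M[R[i]]_(d, e)) :
  mxnorm1 (M - N) <= mxnorm1 M + mxnorm1 N.
Proof. by rewrite (le_trans (mxnorm1D _ _))// mxnorm1N. Qed.

Lemma mxnorm1M d m e (M : 'M[R[i]]_(d, m)) (N : 'M[R[i]]_(m, e)) :
  mxnorm1 (M *m N) <= mxnorm1 M * mxnorm1 N.
Proof.
rewrite {1}/mxnorm1 /mxnorm1 mulr_suml; apply: ler_sum => i _.
rewrite mulr_suml exchange_big/=.
apply: (@le_trans _ _ (\sum_k \sum_j normc (M i j) * normc (N j k))).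
  apply: ler_sum => k _; rewrite mxE (le_trans (normc_sum _ _ _))//.
  by apply: ler_sum => j _; rewrite normcM.
rewrite exchange_big/=; apply: ler_sum => j _.
rewrite -mulr_sumr ler_wpM2l ?normc_ge0// [leRHS]exchange_big/= [leRHS](bigD1 j)//= lerDl.
by apply: sumr_ge0 => l _; apply: sumr_ge0 => k _; exact: normc_ge0.
Qed.

Lemma mxnorm1_le m (v : 'cV[R[i]]_m) c : (forall k, normc (v k 0) <= c) ->
  mxnorm1 v <= m%:R * c.
Proof.
move=> vc; rewrite /mxnorm1 (le_trans (ler_sum _ (G := fun=> c) _))//.
  by move=> k _; rewrite big_ord1; exact: vc.
by rewrite sumr_const card_ord mulr_natl.
Qed.

End matrix_norm.

(** * Bounds uniform over a class of functions for small eps *)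

Section uniform_families.
Context {R : realType} (Y : Type) (d : nat).
Implicit Types (Z : Y -> Prop) (F G : R -> Y -> 'cV[R[i]]_d).

(** The class [Z] will be either a ball or a single function, so that boundedness on balls and
    convergence on fixed functions share one decomposition. The range of eps is chosen before
    [y]. *)
Definition unif_le Z F c := \forall eps \near (0 : R)^'+,
  forall y, Z y -> mxnorm1 (F eps y) <= c.

Definition unif_bounded Z F := exists c, unif_le Z F c.

Definition unif_small Z F := forall e : R, 0 < e -> unif_le Z F e.

Lemma unif_leD Z F G c c' : unif_le Z F c -> unif_le Z G c' ->
  unif_le Z (fun eps y => F eps y + G eps y) (c + c').
Proof.
apply: filterS2 => eps Fc Gc y Zy.
by rewrite (le_trans (mxnorm1D _ _))// lerD ?Fc ?Gc.
Qed.

Lemma unif_boundedD Z F G : unif_bounded Z F -> unif_bounded Z G ->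
  unif_bounded Z (fun eps y => F eps y + G eps y).
Proof. by move=> [c Fc] [c' Gc]; exists (c + c'); exact: unif_leD. Qed.

Lemma unif_smallD Z F G : unif_small Z F -> unif_small Z G ->
  unif_small Z (fun eps y => F eps y + G eps y).
Proof.
move=> Fs Gs e e0; rewrite (splitr e); apply: unif_leD.
  by apply: Fs; rewrite divr_gt0.
by apply: Gs; rewrite divr_gt0.
Qed.

Lemma unif_small0 Z : unif_small Z (fun _ _ => 0).
Proof. by move=> e e0; near=> eps => y _; rewrite mxnorm10 ltW.
Unshelve. all: by end_near. Qed.

Lemma unif_small_bounded Z F : unif_small Z F -> unif_bounded Z F.
Proof. by move=> /(_ 1 ltr01) F1; exists 1. Qed.

Lemma unif_big (P : (R -> Y -> 'cV[R[i]]_d) -> Prop) (u v : nat)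
    (F : nat -> R -> Y -> 'cV[R[i]]_d) :
  P (fun _ _ => 0) ->
  (forall F G, P F -> P G -> P (fun eps y => F eps y + G eps y)) ->
  (forall i, (u <= i < v)%N -> P (F i)) ->
  P (fun eps y => \sum_(u <= i < v) F i eps y).
Proof.
move=> P0 PD PF.
have H (s : seq nat) : {in s, forall i, P (F i)} ->
    P (fun eps y => \sum_(i <- s) F i eps y).
  elim: s => [_|i s IH Ps].
    by under eq_fun do under eq_fun do rewrite big_nil.
  under eq_fun do under eq_fun do rewrite big_cons.
  apply: PD; first by apply: Ps; rewrite mem_head.
  by apply: IH => j js; apply: Ps; rewrite in_cons js orbT.
by apply: H => i; rewrite mem_index_iota; exact: PF.
Qed.

Lemma unif_bounded_big Z (u v : nat) (F : nat -> R -> Y -> 'cV[R[i]]_d) :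
  (forall i, (u <= i < v)%N -> unif_bounded Z (F i)) ->
  unif_bounded Z (fun eps y => \sum_(u <= i < v) F i eps y).
Proof.
apply: (@unif_big (unif_bounded Z)); last exact: unif_boundedD.
exact/unif_small_bounded/unif_small0.
Qed.

Lemma unif_small_big Z (u v : nat) (F : nat -> R -> Y -> 'cV[R[i]]_d) :
  (forall i, (u <= i < v)%N -> unif_small Z (F i)) ->
  unif_small Z (fun eps y => \sum_(u <= i < v) F i eps y).
Proof.
by apply: (@unif_big (unif_small Z)); [exact: unif_small0|exact: unif_smallD].
Qed.

Lemma eq_unif_le Z F G c :
  (forall eps y, F eps y = G eps y) -> unif_le Z F c -> unif_le Z G c.
Proof. by move=> FG; apply: filterS => eps H y Zy; rewrite -FG H. Qed.

End uniform_families.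
Arguments unif_le {R Y d}.

Lemma cvg_mx_near (R : realType) (d1 d2 : nat) (M : R -> 'M[R[i]]_(d1, d2)) M0 :
  cvg_mx M M0 -> forall e : R, 0 < e ->
  \forall eps \near (0 : R)^'+, mxnorm1 (M eps - M0) <= e.
Proof.
move=> /cvgrPdist_le H e /H; apply: filterS => eps.
by rewrite sub0r normrN ger0_norm// mxnorm1_ge0.
Qed.

Lemma unif_small_mulmx (R : realType) (Y : Type) (d m : nat) (Z : Y -> Prop)
    (M : R -> 'M[R[i]]_(d, m)) M0
    (v : R -> Y -> 'cV[R[i]]_m) (c : R) : cvg_mx M M0 -> unif_le Z v c ->
  unif_small Z (fun eps y => (M eps - M0) *m v eps y).
Proof.
move=> MM vc e e0; have c0 : 0 < `|c| + 1 by rewrite ltr_wpDl.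
apply: filterS2 vc (cvg_mx_near MM (divr_gt0 e0 c0)) => eps vc Mc y Zy.
rewrite (le_trans (mxnorm1M _ _))//.
rewrite (le_trans (ler_pM (mxnorm1_ge0 _) (mxnorm1_ge0 _) Mc (vc y Zy)))//.
rewrite mulrAC ler_pdivrMr// ler_pM2l//.
by rewrite (le_trans (ler_norm c))// lerDl.
Qed.

Lemma unif_bounded_mulmx (R : realType) (Y : Type) (d m : nat) (Z : Y -> Prop)
    (M : 'M[R[i]]_(d, m)) (v : R -> Y -> 'cV[R[i]]_m) (c : R) :
  unif_le Z v c -> unif_bounded Z (fun eps y => M *m v eps y).
Proof.
move=> vc; exists (mxnorm1 M * c); apply: filterS vc => eps vc y Zy.
by rewrite (le_trans (mxnorm1M _ _))// ler_wpM2l ?mxnorm1_ge0// vc.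
Qed.

(** * Uniform boundedness and strong convergence of multipoint operators *)

Section multipoint.
Context {R : realType}.
Variables p a b : R.
Hypotheses (p1 : 1 <= p) (ab : a < b).
Variables q m n kappa : nat.
Local Notation sob := (sob p a b).
Local Notation N := (q.+1 + n)%N.
Local Notation vect := (R -> 'cV[R[i]]_m).
Implicit Types (y z : vect) (t s M C : R) (l : nat).

Definition sobv M y := forall i, sob N M (fun t => y t i 0).

Definition in_sobv y := forall i, exists M, sob N M (fun t => y t i 0).

Lemma sobv_in_sobv M y : sobv M y -> in_sobv y.
Proof. by move=> sy i; exists M. Qed.

Lemma in_sobv_sobv y : in_sobv y -> exists M, sobv M y.
Proof.
by move=> /(sob_uniform p1)[M _ sM]; exists M.
Qed.

Lemma in_sobv0 : in_sobv (fun=> 0).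
Proof.
move=> i; exists 1; apply: (sob_cong ab _ (sob0 p1 ab N ltr01)).
by apply: sob_eqW => t _; rewrite mxE.
Qed.

Lemma in_sobv_lin c y z : in_sobv y -> in_sobv z ->
  in_sobv (fun t => c *: y t + z t).
Proof.
move=> sy sz i; have [M sM] := sy i; have [K sK] := sz i.
exists (4 * ((normc c + 1) * M + K)).
apply: (sob_cong ab _ (sobD p1 ab (sobZ p1 ab c sM) sK)).
by apply: sob_eqW => t _; rewrite !mxE.
Qed.

Lemma cderivn_mx_lin l c y z t : in_sobv y -> in_sobv z -> (l < N)%N ->
  a <= t <= b -> cderivn_mx a b l (fun s => c *: y s + z s) t =
  c *: cderivn_mx a b l y t + cderivn_mx a b l z t.
Proof.
move=> sy sz lN tab; apply/matrixP => i j; rewrite !mxE (ord1 j).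
have [M sM] := sy i; have [K sK] := sz i.
rewrite -(cderivn_lin p1 ab c sM sK lN tab).
by apply: eq_cderivn => // s sab; rewrite !mxE.
Qed.

Lemma sobv_cderivn_sup l : (l < N)%N -> exists2 C, 1 <= C &
  forall M y, sobv M y -> forall t, a <= t <= b ->
    mxnorm1 (cderivn_mx a b l y t) <= m%:R * (C * M).
Proof.
move=> lN; have [C C1 H] := sob_sup p1 ab (N - l.+1); exists C => // M y sy t tab.
apply: mxnorm1_le => k; rewrite mxE; apply: H => //.
by rewrite subnSK//; apply: sob_cderivn => //; exact: ltnW.
Qed.

Lemma cderivn_mx_diff l y t s c :
  (forall k, normc (cderivn a b l (fun r => y r k 0) t -
                    cderivn a b l (fun r => y r k 0) s) <= c) ->
  mxnorm1 (cderivn_mx a b l y t - cderivn_mx a b l y s) <= m%:R * c.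
Proof. by move=> H; apply: mxnorm1_le => k; rewrite !mxE. Qed.

Let sym_bound (g : R -> R[i]) (w : R -> R) :
  (forall u v, a <= u -> u <= v -> v <= b -> normc (g v - g u) <= w (v - u)) ->
  forall t s, a <= t <= b -> a <= s <= b -> normc (g t - g s) <= w `|t - s|.
Proof.
move=> H t s /andP[at_ tb] /andP[as_ sb]; have [ts|/ltW st] := leP t s.
  by rewrite normcB distrC ger0_norm ?subr_ge0//; exact: H.
by rewrite ger0_norm ?subr_ge0//; exact: H.
Qed.

Section convergence.
Variables (eps0 : R) (alpha : nat -> nat -> 'M[R[i]]_(q.+1 * m, m)).
Variables (tau : nat -> R) (k : nat -> nat).
Variable alphaeps : R -> nat -> nat -> nat -> 'M[R[i]]_(q.+1 * m, m).
Variable taueps : R -> nat -> nat -> R.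
Hypotheses (eps0_gt0 : 0 < eps0)
  (tau_in : forall i, (1 <= i <= kappa)%N -> tau i \in `[a, b])
  (taueps_in : forall eps, 0 < eps < eps0 ->
     forall i j, (i <= kappa)%N -> (1 <= j <= k i)%N ->
       taueps eps i j \in `[a, b])
  (d1 : forall i j, (1 <= i <= kappa)%N -> (1 <= j <= k i)%N ->
     taueps eps i j @[eps --> 0^'+] --> tau i)
  (d2 : forall i l, (1 <= i <= kappa)%N -> (l < N)%N ->
     cvg_mx (fun eps => \sum_(1 <= j < (k i).+1) alphaeps eps l i j)
       (alpha l i))
  (d3 : forall i j, (1 <= i <= kappa)%N -> (1 <= j <= k i)%N ->
     (fun eps => mxnorm1 (alphaeps eps (q + n)%N i j) *
        `|taueps eps i j - tau i| `^ (1 - p^-1)) =O_ (0^'+) (fun=> 1 : R))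
  (d4 : forall i j l, (1 <= i <= kappa)%N -> (1 <= j <= k i)%N ->
     (l.+1 < N)%N ->
     mxnorm1 (alphaeps eps l i j) * `|taueps eps i j - tau i|
       @[eps --> 0^'+] --> (0 : R))
  (d5 : forall j l, (1 <= j <= k 0)%N -> (l < N)%N ->
     cvg_mx (fun eps => alphaeps eps l 0%N j) 0).

Local Notation B0 := (multipoint_op a b n kappa alpha tau).
Local Notation Beps eps :=
  (multipoint_op_eps a b n kappa k (alphaeps eps) (taueps eps)).

Let near_eps0 : \forall eps \near (0 : R)^'+, 0 < eps < eps0.
Proof. by near=> eps; apply/andP; split. Unshelve. all: by end_near. Qed.

Let near_tau i j : (i <= kappa)%N -> (1 <= j <= k i)%N ->
  \forall eps \near (0 : R)^'+, a <= taueps eps i j <= b.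
Proof.
move=> ik jk; apply: filterS near_eps0 => eps e0.
by have := taueps_in e0 ik jk; rewrite in_itv.
Qed.

(** For [i >= 1] only the sums over [j] of the coefficients converge; individual coefficients may
    blow up. Hence the sums are paired with values at the limiting points, and individual
    coefficients with increments of derivatives only. *)
Lemma multipoint_op_diff eps y :
  Beps eps y - B0 y = \sum_(0 <= l < n + q.+1)
    (\sum_(1 <= j < (k 0).+1)
       (alphaeps eps l 0%N j - 0) *m cderivn_mx a b l y (taueps eps 0%N j) +
     \sum_(1 <= i < kappa.+1)
       ((\sum_(1 <= j < (k i).+1) alphaeps eps l i j - alpha l i) *m
          cderivn_mx a b l y (tau i) +
        \sum_(1 <= j < (k i).+1) alphaeps eps l i j *m
          (cderivn_mx a b l y (taueps eps i j) - cderivn_mx a b l y (tau i)))).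
Proof.
rewrite /multipoint_op_eps /multipoint_op -sumrB; apply: eq_bigr => l _.
rewrite big_ltn// -addrA; congr (_ + _).
  by apply: eq_bigr => j _; rewrite subr0.
rewrite -sumrB; apply: eq_bigr => i _.
rewrite mulmxBl mulmx_suml addrAC; congr (_ - _).
by rewrite -big_split/=; apply: eq_bigr => j _; rewrite -mulmxDr addrC subrK.
Qed.

Let ltN l : (l < n + q.+1)%N -> (l < N)%N /\ (l != (q + n)%N -> (l.+1 < N)%N).
Proof.
by rewrite addnC => lN; split=> // ln; rewrite ltn_neqAle lN andbT addSn eqSS.
Qed.

Section class_of_functions.
Variables (Z : vect -> Prop) (M0 : R).
Hypothesis ZM0 : forall y, Z y -> sobv M0 y.

Let unif_sup l (s : R -> R) : (l < N)%N ->
  (\forall eps \near (0 : R)^'+, a <= s eps <= b) ->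
  exists c, unif_le Z (fun eps y => cderivn_mx a b l y (s eps)) c.
Proof.
move=> lN sab; have [C C1 H] := sobv_cderivn_sup lN; exists (m%:R * (C * M0)).
by apply: filterS sab => eps sab y /ZM0 sy; exact: H.
Qed.

Let term0 l j : (l < N)%N -> (1 <= j <= k 0)%N -> unif_small Z (fun eps y =>
  (alphaeps eps l 0%N j - 0) *m cderivn_mx a b l y (taueps eps 0%N j)).
Proof.
move=> lN jk; have [c Hc] := unif_sup lN (near_tau (leq0n _) jk).
exact: unif_small_mulmx (d5 jk lN) Hc.
Qed.

Let term1 l i : (l < N)%N -> (1 <= i <= kappa)%N -> unif_small Z (fun eps y =>
  (\sum_(1 <= j < (k i).+1) alphaeps eps l i j - alpha l i) *m
     cderivn_mx a b l y (tau i)).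
Proof.
move=> lN ik; have tab : \forall eps \near (0 : R)^'+, a <= tau i <= b.
  by apply: nearW => _; have := tau_in ik; rewrite in_itv.
have [c Hc] := unif_sup lN tab.
exact: unif_small_mulmx (d2 ik lN) Hc.
Qed.

Let term2 l i j : (l.+1 < N)%N -> (1 <= i <= kappa)%N -> (1 <= j <= k i)%N ->
  unif_small Z (fun eps y => alphaeps eps l i j *m
    (cderivn_mx a b l y (taueps eps i j) - cderivn_mx a b l y (tau i))).
Proof.
move=> lN ik jk e e0; have [C C1 H] := sob2_lipschitz p1 ab (N - l.+2).
pose c : R := m%:R * (C * (`|M0| + 1)) + 1.
have M01 : 0 < `|M0| + 1 by rewrite ltr_wpDl.
have C0 : 0 <= C by exact: le_trans C1.
have c0 : 0 < c by rewrite ltr_wpDl// mulr_ge0// mulr_ge0// ltW.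
have /cvgrPdist_le/(_ _ (divr_gt0 e0 c0)) := d4 ik jk lN.
have /andP[_ ik'] := ik.
apply: filterS2 (near_tau ik' jk) => eps tab.
rewrite sub0r normrN ger0_norm ?mulr_ge0 ?mxnorm1_ge0// => He y /ZM0 sy.
rewrite (le_trans (mxnorm1M _ _))//.
have tiab : a <= tau i <= b by have := tau_in ik; rewrite in_itv.
have D : mxnorm1 (cderivn_mx a b l y (taueps eps i j) -
    cderivn_mx a b l y (tau i)) <= c * `|taueps eps i j - tau i|.
  apply: (@le_trans _ _ (m%:R * (C * M0 * `|taueps eps i j - tau i|))).
    apply: cderivn_mx_diff => x; apply: (sym_bound (w := fun r => C * M0 * r)) => //.
    apply: H; rewrite (_ : (N - l.+2).+2 = N - l)%N; last by rewrite !subnSK// ltnW.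
    by apply: sob_cderivn => //; rewrite ltnW// ltnW.
  rewrite !mulrA ler_wpM2r// /c -mulrA ler_wpDr// ler_wpM2l// ler_wpM2l//.
  by rewrite (le_trans (ler_norm _))// lerDl.
rewrite (le_trans (ler_wpM2l (mxnorm1_ge0 _) D))// mulrCA.
by rewrite mulrC -ler_pdivlMr.
Qed.

(** The only summand that need not be small on balls. The constant [w] of the increments decides: it
    is of the size of the radius on a ball, and arbitrarily small for a single function. *)
Let last_term i j w (e0 : 0 <= w) : (1 <= i <= kappa)%N -> (1 <= j <= k i)%N ->
  (exists2 d, 0 < d & forall y, Z y -> forall x u v, a <= u -> u <= v -> v <= b ->
     v - u < d -> normc (cderivn a b (q + n)%N (fun r => y r x 0) v -
       cderivn a b (q + n)%N (fun r => y r x 0) u) <= w * (v - u) `^ (1 - p^-1)) ->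
  forall h, 0 < h ->
  (\forall eps \near (0 : R)^'+, mxnorm1 (alphaeps eps (q + n)%N i j) *
        `|taueps eps i j - tau i| `^ (1 - p^-1) <= h) ->
  unif_le Z (fun eps y => alphaeps eps (q + n)%N i j *m
    (cderivn_mx a b (q + n) y (taueps eps i j) -
     cderivn_mx a b (q + n) y (tau i))) (m%:R * w * h).
Proof.
move=> ik jk [d d0 Hd] h h0; have /andP[_ ik'] := ik.
have /cvgrPdist_lt/(_ _ d0) := d1 ik jk.
apply: filterS3 (near_tau ik' jk) => eps tab td Hh y Zy.
rewrite (le_trans (mxnorm1M _ _))//.
have tiab : a <= tau i <= b by have := tau_in ik; rewrite in_itv.
have D : mxnorm1 (cderivn_mx a b (q + n) y (taueps eps i j) -
    cderivn_mx a b (q + n) y (tau i)) <=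
    m%:R * (w * `|taueps eps i j - tau i| `^ (1 - p^-1)).
  apply: cderivn_mx_diff => x; move: tab tiab => /andP[t1 t2] /andP[t3 t4].
  have [ts|/ltW st] := leP (taueps eps i j) (tau i).
    rewrite normcB distrC ger0_norm ?subr_ge0//; apply: Hd => //.
    by move: td; rewrite ger0_norm ?subr_ge0.
  rewrite ger0_norm ?subr_ge0//; apply: Hd => //.
  by move: td; rewrite distrC ger0_norm ?subr_ge0.
rewrite (le_trans (ler_wpM2l (mxnorm1_ge0 _) D))//.
rewrite [leLHS](_ : _ = m%:R * w * (mxnorm1 (alphaeps eps (q + n)%N i j) *
  `|taueps eps i j - tau i| `^ (1 - p^-1))); last by ring.
by apply: ler_wpM2l Hh; rewrite mulr_ge0.
Qed.

Let d3_bound i j : (1 <= i <= kappa)%N -> (1 <= j <= k i)%N ->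
  exists2 h : R, 0 < h & \forall eps \near (0 : R)^'+,
    mxnorm1 (alphaeps eps (q + n)%N i j) *
        `|taueps eps i j - tau i| `^ (1 - p^-1) <= h.
Proof.
move=> ik jk; have /eqOP := d3 ik jk.
move=> [h0 [_ H]]; exists (`|h0| + 1); first by rewrite ltr_wpDl.
have h01 : h0 < `|h0| + 1 by rewrite (le_lt_trans (ler_norm h0))// ltrDl.
apply: filterS (H _ h01) => eps; rewrite normr1 mulr1.
by apply: le_trans; exact: ler_norm.
Qed.

Lemma multipoint_diff_bounded : unif_bounded Z (fun eps y => Beps eps y - B0 y).
Proof.
rewrite (funext (fun eps => funext (multipoint_op_diff eps))).
apply: unif_bounded_big => l /andP[_ /ltN[lN lN']]; apply: unif_boundedD.
  by apply/unif_small_bounded/unif_small_big => j jk; exact: term0.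
apply: unif_bounded_big => i ik; apply: unif_boundedD.
  exact/unif_small_bounded/term1.
apply: unif_bounded_big => j jk; have [->|/lN' lN2] := eqVneq l (q + n)%N; last first.
  exact/unif_small_bounded/term2.
have [h h0 Hh] := d3_bound ik jk.
exists (m%:R * (4 * (`|M0| + 1)) * h); apply: last_term => //.
exists 1 => // y /ZM0 sy x u v au uv vb _.
have s1 : sob 1 M0 (cderivn a b (q + n) (fun r => y r x 0)).
  have := sob_cderivn (leqW (leqnn (q + n))) (sy x).
  by rewrite -addSn subSn// subnn.
rewrite (le_trans (sob1_hoelder p1 ab s1 au uv vb))//.
rewrite ler_wpM2r ?powR_ge0// ler_pM2l// (le_trans (ler_norm _))// lerDl//.
Qed.

Lemma multipoint_diff_small :
  (forall e, 0 < e -> exists2 d, 0 < d & forall y, Z y ->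
   forall x u v, a <= u -> u <= v -> v <= b ->
     v - u < d -> normc (cderivn a b (q + n)%N (fun r => y r x 0) v -
       cderivn a b (q + n)%N (fun r => y r x 0) u) <= e * (v - u) `^ (1 - p^-1)) ->
  unif_small Z (fun eps y => Beps eps y - B0 y).
Proof.
move=> Hs.
rewrite (funext (fun eps => funext (multipoint_op_diff eps))).
apply: unif_small_big => l /andP[_ /ltN[lN lN']]; apply: unif_smallD.
  by apply/unif_small_big => j jk; exact: term0.
apply: unif_small_big => i ik; apply: unif_smallD; first exact: term1.
apply: unif_small_big => j jk; have [->|/lN' lN2] := eqVneq l (q + n)%N; last first.
  exact: term2.
have [h h0 Hh] := d3_bound ik jk; move=> e e0.
(* Makes the bound [m%:R * w * h] of [last_term] at most [e]; [m%:R + 1] keeps the denominator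
   positive. *)
pose w : R := e / ((m%:R + 1) * h).
have m0 : 0 < m%:R + 1 :> R by rewrite ltr_wpDl.
have w0 : 0 < w by rewrite divr_gt0// mulr_gt0.
have we : m%:R * w * h <= e.
  have -> : m%:R * w * h = e * (m%:R / (m%:R + 1)).
    by rewrite /w; field; rewrite !gt_eqF.
  by rewrite ler_piMr ?(ltW e0)// ler_pdivrMr// mul1r lerDl.
have := last_term (ltW w0) ik jk (Hs _ w0) h0 Hh.
by apply: filterS => eps H y Zy; rewrite (le_trans (H y Zy)).
Qed.

End class_of_functions.

Let multipoint_op_bounded (Z : vect -> Prop) M0 : (forall y, Z y -> sobv M0 y) ->
  unif_bounded Z (fun _ y => B0 y).
Proof.
move=> ZM0; apply: unif_bounded_big => l /andP[_ /ltN[lN _]].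
apply: unif_bounded_big => i ik.
have [C C1 H] := sobv_cderivn_sup lN.
apply: (@unif_bounded_mulmx _ _ _ _ _ _ _ (m%:R * (C * M0))).
apply: nearW => _ y /ZM0 sy; apply: H => //.
by have := tau_in ik; rewrite in_itv.
Qed.

Lemma multipoint_op_eps_lin eps c y z : 0 < eps < eps0 ->
  in_sobv y -> in_sobv z ->
  Beps eps (fun t => c *: y t + z t) = c *: Beps eps y + Beps eps z.
Proof.
move=> e0 sy sz; rewrite /multipoint_op_eps scaler_sumr -big_split/=.
apply: eq_big_nat => l /andP[_ /ltN[lN _]].
rewrite scaler_sumr -big_split/=; apply: eq_big_nat => i /andP[_ ik].
rewrite scaler_sumr -big_split/=; apply: eq_big_nat => j jk.
rewrite cderivn_mx_lin//; last by have := taueps_in e0 ik jk; rewrite in_itv.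
by rewrite mulmxDr scalemxAr.
Qed.

Lemma multipoint_op_lin c y z : in_sobv y -> in_sobv z ->
  B0 (fun t => c *: y t + z t) = c *: B0 y + B0 z.
Proof.
move=> sy sz; rewrite /multipoint_op scaler_sumr -big_split/=.
apply: eq_big_nat => l /andP[_ /ltN[lN _]].
rewrite scaler_sumr -big_split/=; apply: eq_big_nat => i ik.
rewrite cderivn_mx_lin//; last by have := tau_in ik; rewrite in_itv.
by rewrite mulmxDr scalemxAr.
Qed.

(** The range of eps must not depend on [M]. The bound is therefore obtained on the ball of radius 1
    and carried over by homogeneity, for which the exact scaling [sobZ_neq0] is essential. *)
Theorem multipoint_op_eps_bounded : exists2 C, 1 <= C &
  \forall eps \near (0 : R)^'+, forall M y, sobv M y -> 0 < M ->
    mxnorm1 (Beps eps y) <= C * M.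
Proof.
have [c Hc] : unif_bounded (sobv 1) (fun eps y => Beps eps y).
  have := unif_boundedD (multipoint_diff_bounded (fun y (H : sobv 1 y) => H))
    (multipoint_op_bounded (fun y (H : sobv 1 y) => H)).
  by move=> [c H]; exists c; apply: eq_unif_le H => eps y; rewrite subrK.
exists (`|c| + 1); first by rewrite lerDr.
apply: filterS2 near_eps0 Hc => eps e0 Hc M y sy M0.
have s0 := in_sobv0.
have B00 : Beps eps (fun=> 0) = 0.
  have := multipoint_op_eps_lin 1 e0 s0 s0; under eq_fun do rewrite scaler0 addr0.
  by rewrite scale1r => /eqP; rewrite -subr_eq0 opprD addNKr oppr_eq0 => /eqP.
pose x t := (M^-1)%:C *: y t.
have MC0 : (M^-1)%:C != 0 by rewrite eq_complex /= eqxx andbT invr_eq0 gt_eqF.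
have nM : normc (M^-1)%:C = M^-1.
  by rewrite /= expr0n/= addr0 sqrtr_sqr ger0_norm// invr_ge0 ltW.
have sx : sobv 1 x.
  move=> i; have := sobZ_neq0 p1 ab MC0 (sy i); rewrite nM (mulVf (negbT (gt_eqF M0))).
  by apply: (sob_cong ab); apply: sob_eqW => t _; rewrite mxE.
have Bx : Beps eps x = (M^-1)%:C *: Beps eps y.
  have := multipoint_op_eps_lin (M^-1)%:C e0 (sobv_in_sobv sy) s0.
  by rewrite B00 addr0; under eq_fun do rewrite addr0.
have nB : mxnorm1 (Beps eps x) = M^-1 * mxnorm1 (Beps eps y).
  rewrite Bx /mxnorm1 mulr_sumr; apply: eq_bigr => i _.
  by rewrite mulr_sumr; apply: eq_bigr => j _; rewrite mxE normcM nM.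
have := Hc x sx; rewrite nB mulrC ler_pdivrMr// => /le_trans; apply.
by rewrite ler_wpM2r ?(ltW M0)// (le_trans (ler_norm c))// lerDl.
Qed.

(** The class is a single function; its finitely many components share the smallest of their
    thresholds for short increments. *)
Theorem multipoint_op_eps_cvg y : in_sobv y -> forall e : R, 0 < e ->
  \forall eps \near (0 : R)^'+, mxnorm1 (Beps eps y - B0 y) <= e.
Proof.
move=> sy e e0; have [M sM] := in_sobv_sobv sy.
have ZM z : z = y -> sobv M z by move=> ->.
have := @multipoint_diff_small (fun z => z = y) M ZM.
move=> /(_ _ e e0) H; apply: filterS (H _) => [eps|]; first exact.
move=> {H} {}e {}e0.
have H k' : {d : R | 0 < d /\ forall u v, a <= u -> u <= v -> v <= b ->
     v - u < d -> normc (cderivn a b (q + n)%N (fun r => y r k' 0) v -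
       cderivn a b (q + n)%N (fun r => y r k' 0) u) <= e * (v - u) `^ (1 - p^-1)}.
  apply: cid; have s1 : sob 1 M (cderivn a b (q + n) (fun r => y r k' 0)).
    have := sob_cderivn (leqW (leqnn (q + n))) (sM k').
    by rewrite -addSn subSn// subnn.
  by have [d d0 Hd] := sob1_hoelder_small p1 ab s1 e0; exists d.
exists (\big[Num.min/1]_x sval (H x)).
  by apply: lt_bigmin => // x _; have [] := svalP (H x).
move=> _ -> x u v au uv vb vud; have [_ Hx] := svalP (H x); apply: Hx => //.
by apply: (lt_le_trans vud); exact: bigmin_le_cond.
Qed.

End convergence.

End multipoint.

Lemma injective_unitmx (F : fieldType) d (A : 'M[F]_d) :
  (forall v : 'cV_d, A *m v = 0 -> v = 0) -> A \in unitmx.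
Proof.
move=> Ainj; rewrite -unitmx_tr -row_free_unit; apply: inj_row_free => v vA.
apply: trmx_inj; rewrite trmx0; apply: Ainj.
by apply: trmx_inj; rewrite trmx_mul trmxK trmx0.
Qed.

(** * Boundary-value problems reduced to initial data *)

Section linear_problem.
Context {R : realType}.
Variables p a b : R.
Hypotheses (p1 : 1 <= p) (ab : a < b).
Variables q m n : nat.
Local Notation sob := (sob p a b).
Local Notation N := (q.+1 + n)%N.
Local Notation vect := (R -> 'cV[R[i]]_m).
Local Notation coefs := (nat -> 'I_m -> 'I_m -> R -> R[i]).
Local Notation in_sobv := (@in_sobv R p a b q m n).
Local Notation sobv := (@sobv R p a b q m n).
Local Notation dmn := (q.+1 * m)%N.
Implicit Types (y z : vect) (A : coefs) (h : 'I_m -> R -> R[i]).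
Implicit Types (t s M C : R) (l d : nat) (i k : 'I_m) (xi : 'cV[R[i]]_dmn).

Let ab' : a <= b. Proof. exact: ltW. Qed.
Let aab : a <= a <= b. Proof. by rewrite lexx ab'. Qed.

Definition sob_coefs M A := forall l i k, (l < q.+1)%N -> sob n M (A l i k).

Definition vode A h y := ode a b q A h (fun i t => y t i 0).

Definition sumA A y i t : R[i] :=
  \sum_(l < q.+1) \sum_k A l i k t * cderivn a b l (fun s => y s k 0) t.

Definition subA A A' : coefs := fun l i k t => A l i k t - A' l i k t.

(** Flattened to the length of the vector of boundary values, so that initial data are mapped to
    boundary values by a square matrix. *)
Definition init y : 'cV[R[i]]_dmn :=
  (mxvec (\matrix_(l < q.+1, i < m) cderivn a b l (fun s => y s i 0) a))^T.

Lemma initE y l i (lq : (l < q.+1)%N) :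
  init y (mxvec_index (Ordinal lq) i) 0 = cderivn a b l (fun s => y s i 0) a.
Proof. by rewrite mxE mxvecE mxE. Qed.

Let orderN l : (l <= q)%N -> (l < N)%N.
Proof. by move=> lq; rewrite addSn ltnS (leq_trans lq)// leq_addr. Qed.

Lemma cderivn_vlin l c y z i t : in_sobv y -> in_sobv z -> (l < N)%N ->
  a <= t <= b -> cderivn a b l (fun s => (c *: y s + z s) i 0) t =
  c * cderivn a b l (fun s => y s i 0) t + cderivn a b l (fun s => z s i 0) t.
Proof.
move=> sy sz lN tab; have := cderivn_mx_lin p1 ab c sy sz lN tab.
by move=> /matrixP/(_ i 0); rewrite !mxE.
Qed.

Lemma init_lin c y z : in_sobv y -> in_sobv z ->
  init (fun t => c *: y t + z t) = c *: init y + init z.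
Proof.
move=> sy sz; apply/matrixP => x j; rewrite (ord1 j) !mxE.
case/mxvec_indexP: x => l i; rewrite !mxvecE !mxE.
have lN : (l < N)%N by apply: orderN; rewrite -ltnS.
exact: (cderivn_vlin c i sy sz lN aab).
Qed.

Lemma init_bound y i l : (l <= q)%N ->
  normc (cderivn a b l (fun s => y s i 0) a) <= mxnorm1 (init y).
Proof.
move=> lq; have lq' : (l < q.+1)%N by rewrite ltnS.
by rewrite -(initE y i lq'); exact: mxnorm1_entry.
Qed.

Lemma rhs_vlin A c h h' y z i t : in_sobv y -> in_sobv z -> a <= t <= b ->
  rhs q A (fun i t => c * h i t + h' i t)
    (fun k l => cderivn a b l (fun s => (c *: y s + z s) k 0)) i t =
  c * rhs q A h (fun k l => cderivn a b l (fun s => y s k 0)) i t +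
  rhs q A h' (fun k l => cderivn a b l (fun s => z s k 0)) i t.
Proof.
move=> sy sz tab; rewrite /rhs.
have -> : \sum_(l < q.+1) \sum_k
    A l i k t * cderivn a b l (fun s => (c *: y s + z s) k 0) t =
  c * (\sum_(l < q.+1) \sum_k A l i k t * cderivn a b l (fun s => y s k 0) t) +
  \sum_(l < q.+1) \sum_k A l i k t * cderivn a b l (fun s => z s k 0) t.
  rewrite mulr_sumr -big_split/=; apply: eq_bigr => l _.
  rewrite mulr_sumr -big_split/=; apply: eq_bigr => k _.
  have lN : (l < N)%N by apply: orderN; rewrite -ltnS.
  by rewrite (cderivn_vlin c k sy sz lN tab) mulrDr mulrCA.
by rewrite mulrBr opprD addrACA.
Qed.

Lemma vode_rhs_integrable MA A h N y i : sob_coefs MA A -> sob n N (h i) ->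
  in_sobv y ->
  cintegrable a b (rhs q A h (fun k l => cderivn a b l (fun s => y s k 0)) i).
Proof.
move=> sA sh sy; apply: (rhs_integrable p1 ab sA sh) => k l lq.
by have [K sK] := sy k; exact: (sob_cbounded_cderivn p1 ab (orderN lq) sK).
Qed.

Lemma vode_lin MA A c h h' N N' y z : sob_coefs MA A ->
  (forall i, sob n N (h i)) -> (forall i, sob n N' (h' i)) ->
  in_sobv y -> in_sobv z -> vode A h y -> vode A h' z ->
  vode A (fun i t => c * h i t + h' i t) (fun t => c *: y t + z t).
Proof.
move=> sA sh sh' sy sz E E' i t tab; have /andP[at_ tb] := tab.
have qN := orderN (leqnn q).
rewrite (cderivn_vlin c i sy sz qN tab) (cderivn_vlin c i sy sz qN aab).
rewrite (E i t tab) (E' i t tab).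
pose g := rhs q A h (fun k l => cderivn a b l (fun s => y s k 0)) i.
pose g' := rhs q A h' (fun k l => cderivn a b l (fun s => z s k 0)) i.
have ig : cintegrable a b g by exact: (vode_rhs_integrable sA (sh i) sy).
have ig' : cintegrable a b g' by exact: (vode_rhs_integrable sA (sh' i) sz).
rewrite -/g -/g' [in RHS](_ : cint a t (rhs q A _ _ i) = cint a t (fun s => c * g s + g' s)).
  rewrite [in RHS](@cintD _ a b)//; last exact: cintegrableZ.
  by rewrite [in RHS](@cintZ _ a b)// mulrDr addrACA.
apply: eq_cint => s /andP[as_ st].
by rewrite rhs_vlin// as_ (le_trans st tb).
Qed.

(** Moves a change of coefficients into the right-hand side, so that a solution of one system can be
    inserted into another. *)
Lemma vode_subA A A' h y : vode A' h y ->
  vode A (fun i t => h i t + sumA (subA A A') y i t) y.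
Proof.
move=> E i t tab; rewrite (E i t tab); congr (_ + _); apply: eq_cint => s _.
rewrite /rhs /sumA -addrA; congr (_ + _); rewrite -sumrB -sumrN.
apply: eq_bigr => l _; rewrite -sumrB -sumrN; apply: eq_bigr => k _.
by rewrite /subA; ring.
Qed.

(** Bilinearity of the bound is the point: a small change of coefficients acting on a fixed ball
    yields a small right-hand side. Derivatives of order up to [q] lie one order above W^n_p, as
    [sobM_down] requires. *)
Lemma sumA_sob : exists2 C, 1 <= C & forall M K A y, sob_coefs M A -> 0 < M ->
  0 < K -> sobv K y -> forall i, sob n (C * (M * K)) (sumA A y i).
Proof.
have [c1 c11 H1] := sob_sum p1 ab 'I_m n.
have [c2 c21 H2] := sob_sum p1 ab 'I_q.+1 n.
have [c3 c31 H3] := sobM_down p1 ab n.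
have [f f1 Hf] := sob_cderivn_down p1 ab q n.
exists (c2 * (c1 * (c3 * f))); first by rewrite !mulr_ege1.
have g0 (c : R) : 1 <= c -> 0 < c by exact: lt_le_trans.
move=> M K A y sA M0 K0 sy i.
have -> : c2 * (c1 * (c3 * f)) * (M * K) = c2 * (c1 * (c3 * (M * (f * K)))).
  by ring.
apply: H2 => [|l]; first by rewrite !mulr_gt0// g0.
apply: H1 => [|k]; first by rewrite !mulr_gt0// g0.
apply: H3; first exact: (sA l i k (ltn_ord l)).
have lq : (l <= q)%N by rewrite -ltnS.
exact: (Hf l K _ lq (sy k)).
Qed.

Lemma rhs_sob MA A h M y i : sob_coefs MA A -> sob n M (h i) -> in_sobv y ->
  exists K, sob n K (rhs q A h (fun k l => cderivn a b l (fun s => y s k 0)) i).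
Proof.
move=> sA sh sy; have [C _ H] := sumA_sob; have [K sK] := in_sobv_sobv p1 sy.
have MA0 := sob_gt0 (sA 0%N i i (ltn0Sn _)); have K0 := sob_gt0 (sK i).
by exists (8 * (M + C * (MA * K))); apply: (sobB p1 ab sh); exact: H.
Qed.

Lemma sob_zero y : (forall M, 0 < M -> sobv M y) ->
  forall t, a <= t <= b -> y t = 0.
Proof.
move=> sy t tab; apply/matrixP => i j; rewrite (ord1 j) [RHS]mxE.
have [C C1 H] := sob_sup p1 ab (q + n); have C0 : 0 < C by exact: lt_le_trans C1.
apply/eqP; rewrite -normc_eq0 eq_le normc_ge0 andbT; apply/ler_addgt0Pr => e e0.
rewrite add0r (le_trans (H (e / C) _ (sy _ _ i) t tab)) ?divr_gt0//.
by rewrite mulrC divfK ?gt_eqF.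
Qed.

Lemma init_zero y : (forall t, a <= t <= b -> y t = 0) -> init y = 0.
Proof.
move=> y0; apply/matrixP => x j; rewrite (ord1 j) !mxE.
case/mxvec_indexP: x => l i; rewrite !mxvecE !mxE.
have s0 := @in_sobv0 _ p a b p1 ab q m n.
(* Derivatives of the zero function vanish by linearity, zero being its own negative plus itself. *)
have /(cderivn_vlin (-1) i s0 s0)/(_ aab) : (l < N)%N.
  by rewrite orderN// -ltnS.
rewrite mulN1r addNr => <-.
apply: eq_cderivn => // s sab; by rewrite y0// scaler0 addr0.
Qed.

Definition lin_op d (B : vect -> 'cV[R[i]]_d) := forall c y z,
  in_sobv y -> in_sobv z ->
  B (fun t => c *: y t + z t) = c *: B y + B z.

Lemma vode_exists MA A h M xi : sob_coefs MA A -> (forall i, sob n M (h i)) ->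
  exists y, [/\ in_sobv y, vode A h y & init y = xi].
Proof.
move=> sA sh.
have [z [sz E za]] := cauchy_problem p1 ab (fun i l => vec_mx xi^T (inord l) i) sA sh.
have zE : (fun i t => (\col_j z j t : 'cV[R[i]]_m) i 0) = z.
  by apply/funext => i; apply/funext => t; rewrite mxE.
have zEi i : (fun t => (\col_j z j t : 'cV[R[i]]_m) i 0) = z i.
  by apply/funext => t; rewrite mxE.
exists (fun t => \col_j z j t); split.
- by move=> i; rewrite zEi.
- by rewrite /vode zE.
- apply: trmx_inj; rewrite trmxK -[RHS]vec_mxK; congr mxvec.
  apply/matrixP => l i; rewrite mxE zEi za ?inord_val//.
  by rewrite -ltnS.
Qed.

Lemma zero_rhs : forall i : 'I_m, sob n 1 ((fun _ _ => 0) i).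
Proof. by move=> i; exact: sob0. Qed.

(** The [psi x] solve the Cauchy problems with unit initial data, and [y] is their combination.
    Quantifying over all linear [B] expresses this once for the limiting operator and for every
    perturbed one. *)
Lemma fundamental MA A : sob_coefs MA A -> exists psi : 'I_dmn -> vect,
  (forall x, in_sobv (psi x)) /\ forall xi, exists y,
  [/\ in_sobv y, vode A (fun _ _ => 0) y, init y = xi &
      forall d (B : vect -> 'cV[R[i]]_d), lin_op B ->
        B y = \sum_x xi x 0 *: B (psi x)].
Proof.
move=> sA.
pose P (x : 'I_dmn) := cid (vode_exists (delta_mx x 0) sA zero_rhs).
pose psi x := sval (P x); exists psi.
have psiP x : [/\ in_sobv (psi x), vode A (fun _ _ => 0) (psi x) &
  init (psi x) = delta_mx x 0] by exact: svalP (P x).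
split=> [x|xi]; first by have [] := psiP x.
suff H (s : seq 'I_dmn) : exists y, [/\ in_sobv y, vode A (fun _ _ => 0) y,
    init y = \sum_(x <- s) xi x 0 *: delta_mx x 0 &
    forall d (B : vect -> 'cV[R[i]]_d), lin_op B ->
      B y = \sum_(x <- s) xi x 0 *: B (psi x)].
  have [y [y1 y2 y3 y4]] := H (enum 'I_dmn); exists y; split=> //.
    rewrite y3 big_enum/= [RHS]matrix_sum_delta.
    by apply: eq_bigr => x _; rewrite big_ord1.
  by move=> d B lB; rewrite y4// big_enum.
elim: s => [|x s [y [y1 y2 y3 y4]]].
  have [y [y1 y2 y3]] := vode_exists 0 sA zero_rhs.
  (* The empty combination is written in this form so that [lin_op] itself shows that every [B]
     sends it to 0. *)
  exists (fun t => (-1) *: y t + y t); split.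
  - exact: in_sobv_lin.
  - have := vode_lin (-1) sA zero_rhs zero_rhs y1 y1 y2 y2.
    by under eq_fun do under eq_fun do rewrite mulr0 addr0.
  - by rewrite init_lin// y3 big_nil scaler0 addr0.
  - by move=> d B lB; rewrite lB// big_nil scaleN1r addNr.
have [x1 x2 x3] := psiP x.
exists (fun t => xi x 0 *: psi x t + y t); split.
- exact: in_sobv_lin.
- have := vode_lin (xi x 0) sA zero_rhs zero_rhs x1 y1 x2 y2.
  by under eq_fun do under eq_fun do rewrite mulr0 addr0.
- by rewrite init_lin// x3 y3 big_cons.
- by move=> d B lB; rewrite lB// y4// big_cons.
Qed.

Section invertible.
Variables (MA : R) (A : coefs) (B : vect -> 'cV[R[i]]_dmn).
Hypotheses (sA : sob_coefs MA A) (lB : lin_op B)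
  (kerB : forall y, in_sobv y -> vode A (fun _ _ => 0) y -> B y = 0 ->
     forall t, a <= t <= b -> y t = 0).

(** A kernel vector is the initial data of a solution of the homogeneous problem, which vanishes;
    for a square matrix injectivity is enough. *)
Lemma boundary_unitmx (psi : 'I_dmn -> vect) :
  (forall xi, exists y,
  [/\ in_sobv y, vode A (fun _ _ => 0) y, init y = xi &
      forall d (B : vect -> 'cV[R[i]]_d), lin_op B ->
        B y = \sum_x xi x 0 *: B (psi x)]) ->
  exists2 Mx : 'M[R[i]]_dmn, Mx \in unitmx &
    forall xi, \sum_x xi x 0 *: B (psi x) = Mx *m xi.
Proof.
move=> H; exists (\matrix_(j, x) B (psi x) j 0); last first.
  move=> xi; apply/matrixP => j k; rewrite (ord1 k) summxE mxE.
  by apply: eq_bigr => x _; rewrite !mxE mulrC.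
apply: injective_unitmx => xi xi0.
have [y [y1 y2 y3 y4]] := H xi; rewrite -y3; apply/init_zero/kerB => //.
rewrite y4// -[RHS]xi0; apply/matrixP => j k; rewrite (ord1 k) summxE mxE.
by apply: eq_bigr => x _; rewrite !mxE mulrC.
Qed.

(** A particular solution with zero initial data is corrected by a homogeneous one, whose initial
    data solve the remaining finite linear system. *)
Lemma boundary_problem h M c : (forall i, sob n M (h i)) ->
  exists y, [/\ in_sobv y, vode A h y & B y = c].
Proof.
move=> sh; have [psi [_ H]] := fundamental sA.
have [Mx Mu HM] := boundary_unitmx H.
have [z [z1 z2 _]] := vode_exists 0 sA sh.
have [y [y1 y2 _ y4]] := H (invmx Mx *m (c - B z)).
exists (fun t => 1 *: y t + z t); split.
- exact: in_sobv_lin.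
- have := vode_lin 1 sA zero_rhs sh y1 z1 y2 z2.
  by under eq_fun do under eq_fun do rewrite mulr0 add0r.
- by rewrite lB// y4// HM mulKVmx// scale1r subrK.
Qed.

End invertible.

Lemma vode_apriori MA : 0 < MA -> exists2 C, 1 <= C & forall A h M y,
  sob_coefs MA A -> (forall i, sob n M (h i)) -> in_sobv y -> vode A h y ->
  mxnorm1 (init y) <= M -> sobv (C * M) y.
Proof.
move=> MA0; have [C C1 H] := ode_apriori p1 ab q m n MA0.
exists C => // A h M y sA sh sy E yM; apply: (H A h) => // i l lq.
by rewrite (le_trans (init_bound _ _ lq)).
Qed.

End linear_problem.

(** * Stability under perturbation of coefficients and boundary operator *)

Section perturbation.
Context {R : realType}.
Variables p a b : R.
Hypotheses (p1 : 1 <= p) (ab : a < b).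
Variables q m n : nat.
Local Notation sob := (sob p a b).
Local Notation vect := (R -> 'cV[R[i]]_m).
Local Notation coefs := (nat -> 'I_m -> 'I_m -> R -> R[i]).
Local Notation in_sobv := (@in_sobv R p a b q m n).
Local Notation sobv := (@sobv R p a b q m n).
Local Notation sob_coefs := (@sob_coefs R p a b q m n).
Local Notation lin_op := (@lin_op R p a b q m n).
Local Notation vode := (@vode R a b q m).
Local Notation init := (@init R a b q m).
Local Notation dmn := (q.+1 * m)%N.
Implicit Types (y z : vect) (h : 'I_m -> R -> R[i]) (M C e : R).

Variables (MA : R) (A : coefs) (Aeps : R -> coefs).
Variables (B : vect -> 'cV[R[i]]_dmn) (Beps : R -> vect -> 'cV[R[i]]_dmn).
Hypotheses (MA0 : 0 < MA) (sA : sob_coefs MA A).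
Hypothesis cvgA : forall e, 0 < e ->
  \forall eps \near (0 : R)^'+, sob_coefs e (subA (Aeps eps) A).
Hypotheses (lB : lin_op B)
  (lBeps : \forall eps \near (0 : R)^'+, lin_op (Beps eps)).
Hypothesis bBeps : exists2 C, 1 <= C &
  \forall eps \near (0 : R)^'+, forall M y, sobv M y -> 0 < M ->
    mxnorm1 (Beps eps y) <= C * M.
Hypothesis cvgB : forall y, in_sobv y -> forall e, 0 < e ->
  \forall eps \near (0 : R)^'+, mxnorm1 (Beps eps y - B y) <= e.
Hypothesis kerB : forall y, in_sobv y -> vode A (fun _ _ => 0) y -> B y = 0 ->
  forall t, a <= t <= b -> y t = 0.

Lemma sob_coefs_eps e eps : sob_coefs e (subA (Aeps eps) A) ->
  sob_coefs (4 * (e + MA)) (Aeps eps).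
Proof.
move=> sAe l i k lq; have := sobD p1 ab (sAe l i k lq) (@sA l i k lq).
by apply: (sob_cong ab); apply: sob_eqW => t _; rewrite /subA subrK.
Qed.

Lemma init_estimate0 (psi : 'I_dmn -> vect) :
  (forall xi : 'cV_dmn, exists y,
  [/\ in_sobv y, vode A (fun _ _ => 0) y, init y = xi &
      forall d (B : vect -> 'cV[R[i]]_d), lin_op B ->
        B y = \sum_x xi x 0 *: B (psi x)]) ->
  exists2 K : R, 1 <= K & forall xi : 'cV_dmn,
    mxnorm1 xi <= K * mxnorm1 (\sum_x xi x 0 *: B (psi x)).
Proof.
move=> H; have [Mx Mu HM] := boundary_unitmx p1 ab lB kerB H.
exists (1 + mxnorm1 (invmx Mx)); first by rewrite lerDl mxnorm1_ge0.
move=> xi; rewrite HM -{1}[xi](mulKmx Mu) (le_trans (mxnorm1M _ _))//.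
by rewrite ler_wpM2r ?mxnorm1_ge0// lerDr.
Qed.

Lemma mxnorm1_comb d (xi : 'cV[R[i]]_dmn) (v : 'I_dmn -> 'cV[R[i]]_d) e :
  (forall x, mxnorm1 (v x) <= e) ->
  mxnorm1 (\sum_x xi x 0 *: v x) <= e * mxnorm1 xi.
Proof.
move=> ve; rewrite (@le_trans _ _ (\sum_x mxnorm1 (xi x 0 *: v x)))//.
  elim/big_rec2: _ => [|x s u _ su]; first by rewrite mxnorm10.
  by rewrite (le_trans (mxnorm1D _ _))// lerD2l.
rewrite [in leRHS]/mxnorm1 mulr_sumr; apply: ler_sum => x _; rewrite big_ord1.
rewrite /mxnorm1; under eq_bigr do under eq_bigr do rewrite mxE normcM.
under eq_bigr do rewrite -mulr_sumr.
rewrite -mulr_sumr mulrC; apply: ler_wpM2r; [exact: normc_ge0|exact: ve].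
Qed.

(* The solution is compared with the solution [y] of the limiting homogeneous
   system with the same initial data. Invertibility of the limiting boundary
   matrix bounds those data by [B y], and [B y - Beps eps z] is controlled by
   the data themselves with a factor tending to 0, which is absorbed. *)
Theorem stability : exists2 C, 1 <= C & \forall eps \near (0 : R)^'+,
  forall z h M, 0 < M -> in_sobv z -> vode (Aeps eps) h z ->
  (forall i, sob n M (h i)) -> mxnorm1 (Beps eps z) <= M -> sobv (C * M) z.
Proof.
have [psi [psi1 H]] := fundamental p1 ab sA.
have [K K1 HK] := init_estimate0 H.
have [C0 C01 H0] := vode_apriori p1 ab q m n MA0.
have MA'0 : 0 < 4 * (MA + MA) by rewrite mulr_gt0// addr_gt0.
have [C4 C41 H4] := vode_apriori p1 ab q m n MA'0.
have [K2 K21 H2] := sumA_sob p1 ab q m n.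
have [Cb Cb1 Hb] := bBeps.
have g0 (c : R) : 1 <= c -> 0 < c by exact: lt_le_trans.
pose nn : R := normc (-1 : R[i]) + 1.
have nn0 : 0 < nn by rewrite ltr_wpDl// normc_ge0.
(* [P] and [Q] are read off from the bound on [Beps eps w] below, which is rewritten as
   [P * de * (X + M) + Q * M]. *)
pose P := Cb * (C4 * (4 * (nn * (K2 * C0)))).
have P0 : 0 < P by rewrite !mulr_gt0// g0.
pose Q := Cb * (C4 * 4).
have Q0 : 0 < Q by rewrite !mulr_gt0// g0.
(* The first summand makes the coefficient [de * (K * (P + 1))] of the initial data at most one
   half; the second makes [de <= MA], which keeps the perturbed coefficients in a fixed ball. *)
pose de := (2 * (K * (P + 1)) + MA^-1)^-1.
have D0 : 0 < 2 * (K * (P + 1)) + MA^-1.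
  apply: addr_gt0; last by rewrite invr_gt0.
  by apply: mulr_gt0 => //; apply: mulr_gt0; [exact: g0|exact: addr_gt0].
have de0 : 0 < de by rewrite invr_gt0.
have deMA : de <= MA.
  rewrite /de -[leRHS]invrK lef_pV2 ?posrE ?invr_gt0//.
  by rewrite lerDr !mulr_ge0 ?addr_ge0 ?(ltW P0) ?(le_trans ler01 K1).
have deK : de * (K * (P + 1)) <= 2^-1.
  have : 0 < MA^-1 by rewrite invr_gt0.
  by rewrite /de mulrC ler_pdivrMr//; move: (K * _) (MA^-1) => u v; lra.
pose X1 := 2 * K * (1 + P * de + Q).
have X11 : 1 <= X1.
  have : 1 <= 1 + P * de + Q.
    by rewrite -addrA lerDl; apply: addr_ge0 (ltW Q0); apply: mulr_ge0; exact: ltW.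
  by move=> L; rewrite !mulr_ege1// ler1n.
exists (C4 * X1); first by rewrite mulr_ege1.
(* Pointwise convergence of the boundary operators is uniform over the finitely many [psi x], so the
   range of eps does not depend on [z]. *)
have cvgpsi : \forall eps \near (0 : R)^'+,
    forall x, mxnorm1 (Beps eps (psi x) - B (psi x)) <= de.
  by apply: filter_forall => x; exact: cvgB.
apply: filterS2 (filterI (cvgA de0) cvgpsi) (filterI lBeps Hb) => eps.
move=> [Ade pside] [le Hbe] z h M M0 sz E sh zM.
have sAe : sob_coefs (4 * (MA + MA)) (Aeps eps).
  apply: sob_coefs_eps => l i k lq.
  exact: (sob_le p1 deMA (Ade l i k lq)).
suff XM : mxnorm1 (init z) <= X1 * M.
  rewrite -mulrA; apply: (H4 (Aeps eps) h (X1 * M) z sAe _ sz E XM) => i.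
  by apply: (sob_le p1 _ (sh i)); rewrite ler_peMl// ltW.
pose X := mxnorm1 (init z).
have X0 : 0 <= X by exact: mxnorm1_ge0.
(* The radius of a ball must be positive, and [X] may be 0; hence [X + M] is used for the solution
   [y]. *)
have XM0 : 0 < X + M by rewrite ltr_wpDl.
have [y [y1 y2 y3 y4]] := H (init z).
have sy : sobv (C0 * (X + M)) y.
  apply: (H0 A (fun _ _ => 0)) => //.
    by move=> i; exact: sob0.
  by rewrite y3 lerDl ltW.
have C0X : 0 < C0 * (X + M) by rewrite mulr_gt0// g0.
pose g := sumA a b q (subA (Aeps eps) A) y.
have sg i : sob n (K2 * (de * (C0 * (X + M)))) (g i) by exact: H2.
have Ey : vode (Aeps eps) (fun i t => 0 + g i t) y by exact: vode_subA.
have sg' i : sob n (K2 * (de * (C0 * (X + M)))) (fun t => 0 + g i t).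
  by apply: (sob_cong ab _ (sg i)); apply: sob_eqW => t _; rewrite add0r.
(* The remainder has zero initial data, so the a priori estimate bounds it by its right-hand side:
   [h] and the effect of the changed coefficients on [y]. *)
pose w t := (-1) *: y t + z t.
have sw : in_sobv w by exact: in_sobv_lin.
have Ew : vode (Aeps eps) (fun i t => (-1) * (0 + g i t) + h i t) w.
  exact: (vode_lin p1 ab _ sAe sg' sh).
pose S := 4 * (nn * (K2 * (de * (C0 * (X + M)))) + M).
have sh' i : sob n S (fun t => (-1) * (0 + g i t) + h i t).
  exact: (sobD p1 ab (sobZ p1 ab (-1) (sg' i)) (sh i)).
have S0 : 0 < S.
  by rewrite mulr_gt0// addr_gt0// !mulr_gt0 ?(g0 _ K21) ?(g0 _ C01).
have sSw : sobv (C4 * S) w.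
  apply: (H4 (Aeps eps) _ S w sAe sh' sw Ew).
  by rewrite (init_lin p1 ab (-1) y1 sz) y3 scaleN1r addNr mxnorm10 ltW.
have Bw : mxnorm1 (Beps eps w) <= Cb * (C4 * S).
  by apply: Hbe => //; rewrite mulr_gt0// g0.
have Bey : mxnorm1 (Beps eps y) <= M + Cb * (C4 * S).
  have -> : Beps eps y = Beps eps z - Beps eps w.
    by rewrite (le (-1))// scaleN1r opprD opprK addrC subrK.
  by rewrite (le_trans (mxnorm1B _ _))// lerD.
(* [B y] and [Beps eps y] are the same combination of values on the [psi x], so they differ by at
   most [de] times the norm of the coefficients, which are the initial data. *)
have By : mxnorm1 (B y) <= M + Cb * (C4 * S) + de * X.
  have -> : B y = Beps eps y - (Beps eps y - B y) by rewrite opprD opprK addNKr.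
  rewrite (le_trans (mxnorm1B _ _))// lerD//.
  rewrite (y4 _ _ le) (y4 _ _ lB) -sumrB.
  under eq_bigr do rewrite -scalerBr.
  exact: mxnorm1_comb.
have : X <= K * (M + Cb * (C4 * S) + de * X).
  rewrite (le_trans (HK _))// -y4// ler_wpM2l//.
  exact: le_trans K1.
have -> : Cb * (C4 * S) = P * de * (X + M) + Q * M by rewrite /S /P /Q; ring.
move=> XK.
have : K * (M + (P * de * (X + M) + Q * M) + de * X) =
    K * (1 + P * de + Q) * M + de * (K * (P + 1)) * X by ring.
move=> E1; rewrite E1 in XK.
have XK' : X <= K * (1 + P * de + Q) * M + 2^-1 * X.
  by rewrite (le_trans XK)// lerD2l ler_wpM2r.
rewrite -/X /X1; move: XK'; set T := (K * _ * M).
have -> : 2 * K * (1 + P * de + Q) * M = 2 * T by rewrite /T; ring.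
lra.
Qed.

(** With zero data [stability] applies with every positive radius, so the solution lies in all
    balls. *)
Lemma perturbed_kernel : \forall eps \near (0 : R)^'+, forall y,
  in_sobv y -> vode (Aeps eps) (fun _ _ => 0) y -> Beps eps y = 0 ->
  forall t, a <= t <= b -> y t = 0.
Proof.
have [C C1 H] := stability; have C0 : 0 < C by exact: lt_le_trans C1.
apply: filterS H => eps H y sy E B0; apply: (sob_zero p1 ab) => M M0.
have M'0 : 0 < M / C by rewrite divr_gt0.
have -> : M = C * (M / C) by rewrite mulrC divfK ?gt_eqF.
apply: (H y (fun _ _ => 0)) => //; first by move=> i; exact: sob0.
by rewrite B0 mxnorm10 ltW.
Qed.

(** The difference of the solutions satisfies the perturbed system. Its right-hand side consists of
    the change of [h] and the change of coefficients acting on the fixed function [y0]; its boundary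
    value differs from a given small quantity by [Beps eps y0 - B y0], small because [y0] is
    fixed. *)
Lemma perturbed_solution_cvg (h0 : 'I_m -> R -> R[i])
    (h : R -> 'I_m -> R -> R[i]) (y0 : vect) (y : R -> vect) M0 :
  (forall i, sob n M0 (h0 i)) -> in_sobv y0 -> vode A h0 y0 ->
  (\forall eps \near (0 : R)^'+, in_sobv (y eps) /\ vode (Aeps eps) (h eps) (y eps)) ->
  (forall e, 0 < e -> \forall eps \near (0 : R)^'+,
     forall i, sob n e (fun t => h eps i t - h0 i t)) ->
  (forall e, 0 < e -> \forall eps \near (0 : R)^'+,
     mxnorm1 (Beps eps (y eps) - B y0) <= e) ->
  forall e, 0 < e ->
  \forall eps \near (0 : R)^'+, sobv e (fun t => y eps t - y0 t).
Proof.
move=> sh0 sy0 E0 yP hcvg Bcvg e e0.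
have [C C1 H] := stability; have C0 : 0 < C by exact: lt_le_trans C1.
have [K sK] := in_sobv_sobv p1 sy0.
have [K2 K21 H2] := sumA_sob p1 ab q m n.
have K20 : 0 < K2 by exact: lt_le_trans K21.
pose M := e / C; have M'0 : 0 < M by rewrite divr_gt0.
pose K' := `|K| + 1; have K'0 : 0 < K' by rewrite ltr_wpDl.
have sK' : sobv K' y0.
  by move=> i; apply: (sob_le p1 _ (sK i)); rewrite ler_wpDr// ler_norm.
(* Together with the radius [M / 16] for the change of [h], this makes the bound
   [8 * (M / 16 + K2 * (d2 * K'))] of [sobB] equal to [M]. *)
pose d2 := M / (16 * (K2 * K')).
have d20 : 0 < d2 by rewrite divr_gt0// !mulr_gt0.
have M16 : 0 < M / 16 by rewrite divr_gt0.
have M2 : 0 < M / 2 by rewrite divr_gt0.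
apply: filterS3 (filterI lBeps H) (filterI yP (hcvg _ M16))
  (filterI (cvgA d20) (filterI (Bcvg _ M2) (cvgB sy0 M2))) => eps.
move=> [le {}H] [[sy E] sd] [Ad [By By0]].
pose w t := (-1) *: y0 t + y eps t.
pose g := sumA a b q (subA (Aeps eps) A) y0.
have sg i : sob n (K2 * (d2 * K')) (g i) by exact: H2.
have Ey0 : vode (Aeps eps) (fun i t => h0 i t + g i t) y0 by exact: vode_subA.
have sAe := sob_coefs_eps Ad.
have sh0g i : sob n (4 * (M0 + K2 * (d2 * K'))) (fun t => h0 i t + g i t).
  exact: (sobD p1 ab (sh0 i) (sg i)).
have she i : sob n (4 * (M / 16 + M0)) (h eps i).
  apply: (sob_cong ab _ (sobD p1 ab (sd i) (sh0 i))).
  by apply: sob_eqW => t _; rewrite subrK.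
have sw : in_sobv w by exact: in_sobv_lin.
have Ew : vode (Aeps eps) (fun i t => (-1) * (h0 i t + g i t) + h eps i t) w.
  exact: (vode_lin p1 ab (-1) sAe sh0g she sy0 sy Ey0 E).
have shw i : sob n M (fun t => (-1) * (h0 i t + g i t) + h eps i t).
  have := sobB p1 ab (sd i) (sg i).
  have -> : 8 * (M / 16 + K2 * (d2 * K')) = M.
    by rewrite /d2; field; rewrite !gt_eqF.
  by apply: (sob_cong ab); apply: sob_eqW => t _; ring.
have Bw : mxnorm1 (Beps eps w) <= M.
  have -> : Beps eps w = (Beps eps (y eps) - B y0) - (Beps eps y0 - B y0).
    by rewrite (le (-1) _ _ sy0 sy) scaleN1r opprB addrA subrK addrC.
  by rewrite (le_trans (mxnorm1B _ _))// (splitr M) lerD.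
move=> i; have := H w _ M M'0 sw Ew shw Bw i.
have -> : C * M = e by rewrite /M mulrC divfK ?gt_eqF.
by apply: (sob_cong ab); apply: sob_eqW => t _; rewrite !mxE mulN1r addrC.
Qed.

End perturbation.

(** * Translation of the stated problem into integral form and balls *)

Section bridge.
Context {R : realType}.
Variables p a b : R.
Hypotheses (p1 : 1 <= p) (ab : a < b).
Local Notation sob := (sob p a b).
Implicit Types (x y : R -> R[i]) (e M C : R) (n : nat).

Lemma in_itv_ab t : (t \in `[a, b]) = (a <= t <= b).
Proof. by rewrite in_itv. Qed.

Lemma sobolev_mxB n m k (X Y : R -> 'M[R[i]]_(m, k)) :
  sobolev_mx n p a b X -> sobolev_mx n p a b Y ->
  sobolev_mx n p a b (fun t => X t - Y t).
Proof.
move=> sX sY i j; have [M sM] := sobolev_sob p1 ab (sX i j).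
have [K sK] := sobolev_sob p1 ab (sY i j).
apply: (sob_sobolev p1 ab (M := 8 * (M + K))).
apply: (sob_cong ab _ (sobB p1 ab sM sK)).
by apply: sob_eqW => t _; rewrite !mxE.
Qed.

Lemma sobolev_norm_ge0 n x : (0 <= sobolev_norm n p a b x)%E.
Proof. exact: poweR_ge0. Qed.

Lemma sobolev_norm_entry n m k (X : R -> 'M[R[i]]_(m, k)) i j :
  (sobolev_norm n p a b (fun t => X t i j) <= sobolev_norm_mx n p a b X)%E.
Proof.
have H (F : 'I_m -> 'I_k -> \bar R) : (forall u v, 0 <= F u v)%E ->
    (F i j <= \sum_u \sum_v F u v)%E.
  move=> F0; rewrite (bigD1 i)//= (bigD1 j)//= -addeA leeDl// adde_ge0//.
    by rewrite sume_ge0.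
  by rewrite sume_ge0// => u _; rewrite sume_ge0.
exact: (H (fun u v => sobolev_norm n p a b (fun t => X t u v))
  (fun u v => sobolev_norm_ge0 n _)).
Qed.

Lemma cvg_sobolev_sob n m k (X : R -> R -> 'M[R[i]]_(m, k)) X0 :
  cvg_sobolev n p a b X X0 -> sobolev_mx n p a b X0 ->
  (\forall eps \near (0 : R)^'+, sobolev_mx n p a b (X eps)) ->
  forall e, 0 < e -> \forall eps \near (0 : R)^'+,
    forall i j, sob n e (fun t => X eps t i j - X0 t i j).
Proof.
move=> XX0 sX0 sX e e0; have [C C1 H] := sob_sobolev_norm p1 ab n.
have C0 : 0 < C by exact: lt_le_trans C1.
have M0 : 0 < e / C by rewrite divr_gt0.
have U : nbhs (0%E : \bar R) [set u | (u < (e / C)%:E)%E].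
  by apply: open_nbhs_nbhs; split; [exact: open_ereal_lt_ereal|rewrite /= lte_fin].
have XU : \forall eps \near (0 : R)^'+,
  (sobolev_norm_mx n p a b (fun t => (X eps t - X0 t)%R) < (e / C)%:E)%E := XX0 _ U.
apply: filterS2 XU sX => eps Xe sXe i j.
have -> : e = C * (e / C) by rewrite mulrC divfK ?gt_eqF.
have sd := sobolev_mxB sXe sX0 i j.
have := H (e / C) _ sd M0 (le_trans (sobolev_norm_entry _ _ i j) (ltW Xe)).
by apply: (sob_cong ab); apply: sob_eqW => t _; rewrite !mxE.
Qed.

Lemma sob_cvg_sobolev n m k (X : R -> R -> 'M[R[i]]_(m, k)) (X0 : R -> 'M[R[i]]_(m, k)) :
  (forall e, 0 < e -> \forall eps \near (0 : R)^'+,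
    forall i j, sob n e (fun t => X eps t i j - X0 t i j)) ->
  cvg_sobolev n p a b X X0.
Proof.
move=> H; have [C C1 HC] := sobolev_norm_le p1 ab n.
have C0 : 0 < C by exact: lt_le_trans C1.
have N0 eps : (0 <= sobolev_norm_mx n p a b (fun t => (X eps t - X0 t)%R))%E.
  by rewrite sume_ge0// => i _; rewrite sume_ge0// => j _; exact: sobolev_norm_ge0.
have bnd e : 0 < e -> \forall eps \near (0 : R)^'+,
    (sobolev_norm_mx n p a b (fun t => (X eps t - X0 t)%R) <= e%:E)%E.
  (* The bound [e] is shared among the matrix entries; the added 1 keeps [K] positive when there are
     none. *)
  move=> e0; pose K : R := (m * k)%:R + 1.
  have K0 : 0 < K by rewrite ltr_wpDl.
  have d0 : 0 < e / (C * K) by rewrite divr_gt0// mulr_gt0.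
  apply: filterS (H _ d0) => eps He.
  apply: (@le_trans _ _ (\sum_(i < m) \sum_(j < k) (e / K)%:E)%E).
    apply: lee_sum => i _; apply: lee_sum => j _.
    have -> : e / K = C * (e / (C * K)) by field; rewrite !gt_eqF.
    apply: HC; apply: (sob_cong ab _ (He i j)).
    by apply: sob_eqW => t _; rewrite !mxE.
  under eq_bigr do rewrite sumEFin.
  rewrite sumEFin lee_fin.
  under eq_bigr do rewrite sumr_const card_ord.
  rewrite sumr_const card_ord -mulrnA mulnC -mulr_natl mulrA ler_pdivrMr// mulrC.
  by rewrite ler_pM2l// /K lerDl.
apply/fine_cvgP; split.
  apply: filterS (bnd 1 ltr01) => eps le1.
  by rewrite ge0_fin_numE// (le_lt_trans le1)// ltry.
apply/cvgrPdist_le => e e0; apply: filterS (bnd e e0) => eps lee.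
rewrite sub0r normrN ger0_norm; last exact: fine_ge0.
by rewrite -lee_fin fineK// ge0_fin_numE// (le_lt_trans lee)// ltry.
Qed.

Section order.
Variables q m n : nat.
Local Notation N := (q.+1 + n)%N.
Local Notation vect := (R -> 'cV[R[i]]_m).
Local Notation in_sobv := (@in_sobv R p a b q m n).
Local Notation sob_coefs := (@sob_coefs R p a b q m n).
Local Notation lin_op := (@lin_op R p a b q m n).
Local Notation vode := (@vode R a b q m).
Local Notation dmn := (q.+1 * m)%N.
Implicit Types (A : nat -> R -> 'M[R[i]]_m) (u v : vect) (B : vect -> 'cV[R[i]]_dmn).

Definition mxcoef A : nat -> 'I_m -> 'I_m -> R -> R[i] := fun l i k t => A l t i k.

Lemma sobolev_in_sobv u : sobolev_mx (n + q.+1) p a b u <-> in_sobv u.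
Proof.
rewrite addnC; split=> [su i|su i j].
  exact: (sobolev_sob p1 ab (su i 0)).
by have [M sM] := su i; rewrite (ord1 j); exact: (sob_sobolev p1 ab sM).
Qed.

Lemma sobolev_sob_rhs u : sobolev_mx n p a b u ->
  exists M, forall i, sob n M (fun t => u t i 0).
Proof.
move=> su; have [M _ sM] := sob_uniform p1 (fun i => sobolev_sob p1 ab (su i 0)).
by exists M.
Qed.

Lemma sobolev_sob_coefs A : (forall l, (l < q.+1)%N -> sobolev_mx n p a b (A l)) ->
  exists2 M, 0 < M & sob_coefs M (mxcoef A).
Proof.
move=> sA.
have [|M M0 sM] := @sob_uniform _ p a b p1 ('I_q.+1 * 'I_m * 'I_m)%type n
    (fun x : 'I_q.+1 * 'I_m * 'I_m => mxcoef A x.1.1 x.1.2 x.2).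
  by move=> [[l i] k]; exact: (sobolev_sob p1 ab (sA l (ltn_ord l) i k)).
by exists M => // l i k lq; exact: (sM (Ordinal lq, i, k)).
Qed.

Lemma diff_opE A u t i : diff_op a b q.+1 A u t i 0 =
  cderivn a b q.+1 (fun s => u s i 0) t + sumA a b q (mxcoef A) u i t.
Proof.
rewrite /diff_op !mxE; congr (_ + _).
have -> : \sum_(1 <= j < q.+2) A (q.+1 - j)%N t *m cderivn_mx a b (q.+1 - j) u t =
   \sum_(l < q.+1) A l t *m cderivn_mx a b l u t.
  by rewrite big_add1/= -[RHS](big_mkord xpredT
    (fun l => A l t *m cderivn_mx a b l u t)) [RHS]big_nat_rev.
rewrite summxE /sumA; apply: eq_bigr => l _; rewrite mxE.
by apply: eq_bigr => k _; rewrite !mxE.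
Qed.

Lemma eq_sobolevP u v : eq_sobolev n a b u v <->
  forall i, sob_eq a b n (fun t => u t i 0) (fun t => v t i 0).
Proof.
rewrite /eq_sobolev /sob_eq; case: n => [|n']; split.
- move=> H i; apply: filterS H => t uv tab; rewrite uv// in_itv_ab//.
- move=> H; have /filter_forall := H; apply: filterS => t uv.
  rewrite in_itv_ab => tab; apply/matrixP => i j; rewrite (ord1 j); exact: uv.
- by move=> H i t tab; rewrite H// in_itv_ab.
- move=> H t; rewrite in_itv_ab => tab; apply/matrixP => i j.
  by rewrite (ord1 j); exact: H.
Qed.

Lemma sob_eq_map (k : nat) x y x' y' : (forall t, x t = y t -> x' t = y' t) ->
  sob_eq a b k x y -> sob_eq a b k x' y'.
Proof.
move=> xy; case: k => [|k] H; last by move=> t tab; exact/xy/H.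
by apply: filterS H => t H tab; exact/xy/H.
Qed.

(** Integration from [a] gives one direction. For the converse the integrand lies in W^n_p, so its
    primitive is differentiable exactly where [eq_sobolev] asks: everywhere for [n > 0], almost
    everywhere for [n = 0]. *)
Lemma diff_op_vode MA A u f : sob_coefs MA (mxcoef A) -> in_sobv u ->
  sobolev_mx n p a b f ->
  eq_sobolev n a b (diff_op a b q.+1 A u) f <->
  vode (mxcoef A) (fun i t => f t i 0) u.
Proof.
move=> sA su sf; have [M sM] := sobolev_sob_rhs sf.
have qN : (q < N)%N by rewrite addSn ltnS leq_addr.
split=> [/eq_sobolevP H i t tab|E].
  have [K sK] := su i; rewrite (sob_primitive_cderivn qN sK tab).
  congr (_ + _); have /andP[_ tb] := tab.
  apply: (ae_eq_cint (lexx a) tb); apply: (@sob_eq_ae _ _ _ n).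
  apply: sob_eq_map (H i) => s; rewrite diff_opE /rhs => <-.
  by rewrite -[X in _ - X]/(sumA a b q (mxcoef A) u i s) addrK.
apply/eq_sobolevP => i; have [K sK] := rhs_sob (h := fun i t => f t i 0) p1 ab sA (sM i) su.
apply: sob_eq_map (primitive_cderiv p1 ab sK (E i)) => s Es.
rewrite diff_opE.
rewrite -[cderivn a b q.+1 _ s]/(cderiv a b (cderivn a b q (fun s => u s i 0)) s).
by rewrite Es /rhs -[X in _ - X + _]/(sumA a b q (mxcoef A) u i s) subrK.
Qed.

Lemma is_solutionP MA A B f c u : sob_coefs MA (mxcoef A) ->
  sobolev_mx n p a b f ->
  is_solution n q.+1 p a b (diff_op a b q.+1 A) B f c u <->
  [/\ in_sobv u, vode (mxcoef A) (fun i t => f t i 0) u & B u = c].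
Proof.
move=> sA sf; split=> -[u1 u2 u3]; split=> //; first exact/sobolev_in_sobv.
- by apply/(diff_op_vode sA) => //; exact/sobolev_in_sobv.
- exact/sobolev_in_sobv.
- exact/(diff_op_vode sA).
Qed.

Lemma well_posed MA A B f c : sob_coefs MA (mxcoef A) -> lin_op B ->
  (forall u, in_sobv u -> vode (mxcoef A) (fun _ _ => 0) u -> B u = 0 ->
    forall t, a <= t <= b -> u t = 0) ->
  sobolev_mx n p a b f ->
  exists2 u, is_solution n q.+1 p a b (diff_op a b q.+1 A) B f c u &
    forall v, is_solution n q.+1 p a b (diff_op a b q.+1 A) B f c v ->
      forall t, t \in `[a, b] -> v t = u t.
Proof.
move=> sA lB kerB sf; have [M sM] := sobolev_sob_rhs sf.
have [u [u1 u2 u3]] := boundary_problem p1 ab sA lB kerB c sM.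
exists u; first exact/(is_solutionP _ _ _ sA).
move=> v /(is_solutionP _ _ _ sA sf)[v1 v2 v3] t; rewrite in_itv_ab => tab.
have := kerB (fun t => (-1) *: u t + v t) _ _ _ t tab.
rewrite scaleN1r addrC => H; apply/eqP; rewrite -subr_eq0; apply/eqP/H.
- exact: in_sobv_lin.
- have := vode_lin p1 ab (-1) sA sM sM u1 v1 u2 v2.
  by under eq_fun do under eq_fun do rewrite mulN1r addNr.
- by rewrite lB// u3 v3 scaleN1r addNr.
Qed.

End order.

End bridge.

Theorem theorem4p2 (R : realType) (n m r kappa : nat) (p a b eps0 : R)
    (A : nat -> R -> 'M[R[i]]_m)
    (alpha : nat -> nat -> 'M[R[i]]_(r * m, m)) (tau : nat -> R)
    (Aeps : R -> nat -> R -> 'M[R[i]]_m)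
    (k : nat -> nat)
    (alphaeps : R -> nat -> nat -> nat -> 'M[R[i]]_(r * m, m))
    (taueps : R -> nat -> nat -> R)
    (m_ge1 : (1 <= m)%N) (r_ge1 : (1 <= r)%N) (kappa_ge1 : (1 <= kappa)%N)
    (p_ge1 : 1 <= p) (a_lt_b : a < b) (eps0_gt0 : 0 < eps0)
    (tau_in : forall i, (1 <= i <= kappa)%N -> tau i \in `[a, b])
    (tau_inj : forall i j, (1 <= i <= kappa)%N -> (1 <= j <= kappa)%N ->
       tau i = tau j -> i = j)
    (A_sobolev : forall j, (1 <= j <= r)%N -> sobolev_mx n p a b (A (r - j)%N))
    (k_ge1 : forall i, (i <= kappa)%N -> (1 <= k i)%N)
    (Aeps_sobolev : forall eps, 0 < eps < eps0 ->
       forall j, (1 <= j <= r)%N -> sobolev_mx n p a b (Aeps eps (r - j)%N))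
    (taueps_in : forall eps, 0 < eps < eps0 ->
       forall i j, (i <= kappa)%N -> (1 <= j <= k i)%N ->
         taueps eps i j \in `[a, b])
    (A_cvg : forall j, (1 <= j <= r)%N ->
       cvg_sobolev n p a b (fun eps => Aeps eps (r - j)%N) (A (r - j)%N))
    (d1 : forall i j, (1 <= i <= kappa)%N -> (1 <= j <= k i)%N ->
       taueps eps i j @[eps --> 0^'+] --> tau i)
    (d2 : forall i l, (1 <= i <= kappa)%N -> (l <= (n + r).-1)%N ->
       cvg_mx (fun eps => \sum_(1 <= j < (k i).+1) alphaeps eps l i j)
         (alpha l i))
    (d3 : forall i j, (1 <= i <= kappa)%N -> (1 <= j <= k i)%N ->
       (fun eps => mxnorm1 (alphaeps eps (n + r).-1 i j) *
          `|taueps eps i j - tau i| `^ (1 - p^-1)) =O_ (0^'+) (fun=> 1 : R))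
    (d4 : forall i j l, (1 <= i <= kappa)%N -> (1 <= j <= k i)%N ->
       (l.+2 <= n + r)%N ->
       mxnorm1 (alphaeps eps l i j) * `|taueps eps i j - tau i|
         @[eps --> 0^'+] --> (0 : R))
    (d5 : forall j l, (1 <= j <= k 0)%N -> (l <= (n + r).-1)%N ->
       cvg_mx (fun eps => alphaeps eps l 0%N j) 0)
    (trivial_kernel : forall y : R -> 'cV[R[i]]_m,
       is_solution n r p a b (diff_op a b r A)
         (multipoint_op a b n kappa alpha tau) (fun=> 0) 0 y ->
       forall t, t \in `[a, b] -> y t = 0) :
  depends_continuously_at0 n r p a b eps0
    (fun eps => if eps == 0 then diff_op a b r A
                else diff_op a b r (Aeps eps))
    (fun eps => if eps == 0 then multipoint_op a b n kappa alpha tau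
                else multipoint_op_eps a b n kappa k (alphaeps eps)
                       (taueps eps)).
Proof.
(* The order is [r = q.+1]. Once [n + r] reads [q.+1 + n], the highest index [(n + r).-1] computes
   to [q + n]. *)
case: r r_ge1 A_sobolev Aeps_sobolev A_cvg alpha alphaeps d2 d3 d4 d5
  trivial_kernel => [//|q _] sA sAe cA {}alpha {}alphaeps.
rewrite [(n + q.+1)%N]addnC => {}d2 {}d3 {}d4 {}d5 kerB.
have ordE l : (l < q.+1)%N -> exists2 j, (1 <= j <= q.+1)%N & l = (q.+1 - j)%N.
  move=> lq; exists (q.+1 - l)%N; last by rewrite subKn// ltnW.
  by rewrite subn_gt0 lq leq_subr.
have sA' l : (l < q.+1)%N -> sobolev_mx n p a b (A l).
  by move=> /ordE[j jq ->]; exact: sA.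
have sAe' eps l : 0 < eps < eps0 -> (l < q.+1)%N -> sobolev_mx n p a b (Aeps eps l).
  by move=> e0 /ordE[j jq ->]; exact: sAe.
have near0 : \forall eps \near (0 : R)^'+, 0 < eps < eps0.
  by near=> eps; apply/andP; split.
have cA' : forall e, 0 < e -> \forall eps \near (0 : R)^'+,
    sob_coefs p a b q n e (subA (mxcoef (Aeps eps)) (mxcoef A)).
  move=> e e0; have H (l : 'I_q.+1) : \forall eps \near (0 : R)^'+,
      forall i j, sob p a b n e (fun t => Aeps eps l t i j - A l t i j).
    apply: (cvg_sobolev_sob p_ge1 a_lt_b _ (sA' l (ltn_ord l))) => //.
      by have [j jq ->] := ordE l (ltn_ord l); exact: cA.
    by apply: filterS near0 => eps e0'; exact: sAe'.
  by apply: filterS (filter_forall _ H) => eps He l i j lq; exact: (He (Ordinal lq)).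
have [MA MA0 sMA] := sobolev_sob_coefs p_ge1 a_lt_b sA'.
set B := multipoint_op a b n kappa alpha tau in kerB *.
pose Beps eps := multipoint_op_eps a b n kappa k (alphaeps eps) (taueps eps).
have lB : lin_op p a b q n B.
  by move=> c y z sy sz; exact: (multipoint_op_lin p_ge1 a_lt_b).
have lBe eps : 0 < eps < eps0 -> lin_op p a b q n (Beps eps).
  by move=> e0 c y z sy sz; exact: (multipoint_op_eps_lin p_ge1 a_lt_b _ taueps_in).
have lBeN : \forall eps \near (0 : R)^'+, lin_op p a b q n (Beps eps).
  by apply: filterS near0 => eps; exact: lBe.
have bB := multipoint_op_eps_bounded p_ge1 a_lt_b eps0_gt0 tau_in taueps_in
  d1 d2 d3 d4 d5.
have cB := multipoint_op_eps_cvg p_ge1 a_lt_b eps0_gt0 tau_in taueps_in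
  d1 d2 d3 d4 d5.
have s0 : sobolev_mx n p a b (fun=> 0 : 'cV[R[i]]_m).
  move=> i j; apply: (sob_sobolev p_ge1 a_lt_b (M := 1)).
  apply: (sob_cong a_lt_b _ (sob0 p_ge1 a_lt_b n ltr01)).
  by apply: sob_eqW => t _; rewrite mxE.
have kerB' y : in_sobv p a b q n y -> vode a b q (mxcoef A) (fun _ _ => 0) y ->
    B y = 0 -> forall t, a <= t <= b -> y t = 0.
  move=> sy E By t tab; apply: kerB; last by rewrite in_itv.
  apply/(is_solutionP p_ge1 a_lt_b _ _ _ sMA s0); split=> //.
  by under eq_fun do under eq_fun do rewrite mxE.
have kerBe := perturbed_kernel p_ge1 a_lt_b MA0 sMA cA' lB lBeN bB cB kerB'.
have [d /= d0 Hd] := kerBe.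
(* Below [d] the perturbed homogeneous problem has only the trivial solution; the half gives the
   strict inequality [eps1 < eps0]. *)
pose eps1 := Num.min d (eps0 / 2).
have eps1_gt0 : 0 < eps1 by rewrite lt_min d0 divr_gt0.
have eps1_lt : eps1 < eps0 by rewrite gt_min; apply/orP; right; lra.
exists eps1; split; first by rewrite eps1_gt0.
  (* At [eps = 0] the kernel is trivial by hypothesis, since [perturbed_kernel] concerns only
     positive eps. *)
  move=> eps /andP[e0 e1] f c sf; have [eE|eN] := eqVneq eps 0.
    exact: (well_posed p_ge1 a_lt_b c sMA lB kerB' sf).
  have ep : 0 < eps by rewrite lt_neqAle eq_sym eN.
  have e00 : 0 < eps < eps0 by rewrite ep (lt_trans e1).
  have [MAe _ sMAe] := sobolev_sob_coefs p_ge1 a_lt_b (sAe' eps ^~ e00).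
  apply: (well_posed p_ge1 a_lt_b c sMAe (lBe eps e00) _ sf).
  apply: (Hd eps _ ep); rewrite /= sub0r normrN gtr0_norm//.
  by rewrite (lt_le_trans e1)// ge_min lexx.
move=> f c y sf sol cf cc.
have near1 : \forall eps \near (0 : R)^'+, 0 < eps < eps1.
  by near=> eps; apply/andP; split.
have I0 : 0 <= (0 : R) < eps1 by rewrite lexx.
have := sol 0 I0; rewrite eqxx => /(is_solutionP p_ge1 a_lt_b _ _ _ sMA (sf 0 I0)).
move=> [sy0 E0 B0].
have [M0 sM0] := sobolev_sob_rhs p_ge1 a_lt_b (sf 0 I0).
have solN : \forall eps \near (0 : R)^'+, [/\ in_sobv p a b q n (y eps),
    vode a b q (mxcoef (Aeps eps)) (fun i t => f eps t i 0) (y eps) &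
    Beps eps (y eps) = c eps].
  apply: filterS near1 => eps /andP[ep e1].
  have I1 : 0 <= eps < eps1 by rewrite ltW.
  have e00 : 0 < eps < eps0 by rewrite ep (lt_trans e1).
  have [MAe _ sMAe] := sobolev_sob_coefs p_ge1 a_lt_b (sAe' eps ^~ e00).
  have := sol eps I1; rewrite (gt_eqF ep).
  by move=> /(is_solutionP p_ge1 a_lt_b _ _ _ sMAe (sf eps I1)).
apply: (sob_cvg_sobolev p_ge1 a_lt_b) => e e0.
have H := perturbed_solution_cvg p_ge1 a_lt_b MA0 sMA cA' lB lBeN bB cB kerB'
  (h0 := fun i t => f 0 t i 0) (h := fun eps i t => f eps t i 0) sM0 sy0 E0.
have {H} := H y _ _ _ e e0.
have P1 : \forall eps \near (0 : R)^'+, in_sobv p a b q n (y eps) /\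
    vode a b q (mxcoef (Aeps eps)) (fun i t => f eps t i 0) (y eps).
  by apply: filterS solN => eps [].
have P2 (e' : R) : 0 < e' -> \forall eps \near (0 : R)^'+,
    forall i, sob p a b n e' (fun t => f eps t i 0 - f 0 t i 0).
  move=> e'0; have sfN : \forall eps \near (0 : R)^'+, sobolev_mx n p a b (f eps).
    by apply: filterS near1 => eps /andP[ep e1]; apply: sf; rewrite ltW.
  have := cvg_sobolev_sob p_ge1 a_lt_b cf (sf 0 I0) sfN e'0.
  by apply: filterS => eps H i.
have P3 (e' : R) : 0 < e' -> \forall eps \near (0 : R)^'+,
    mxnorm1 (Beps eps (y eps) - B (y 0)) <= e'.
  move=> e'0; apply: filterS2 solN (cvg_mx_near cc e'0) => eps [_ _ ->].
  by rewrite B0.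
move=> /(_ P1 P2 P3); apply: filterS => eps He i j; rewrite (ord1 j) addnC.
apply: (sob_cong a_lt_b _ (He i)).
by apply: sob_eqW => t _; rewrite !mxE.
Unshelve. all: by end_near.
Qed.
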